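(* Let $f$ be a tamely ramified rational map over a field $K$ such that the Frattini subgroup of $\overline{\mathrm{IMG}}$ is open. If $\widehat K_f$ is hilbertian, then there is a Hilbert subset of $\widehat K_f$ such that, for every (non-post-critical) $a$ in it, the specialization at $t=a$ over $\widehat K_f$ is surjective, i.e. the decomposition subgroup $\mathrm{Gal}(\widehat K_f(f^{-\infty}(a))/\widehat K_f)$ is all of $\mathrm{Gal}(\widehat K_f(f^{-\infty}(t))/\widehat K_f(t))\cong\overline{\mathrm{IMG}}$.
   Context: Let $t$ be transcendental over $K$, $\overline{K(t)}$ a separable closure of $K(t)$, $\bar K$ the algebraic closure of $K$ in it. $f$ is tamely ramified if $\bar K(x)/\bar K(t)$, $f(x)=t$, is tamely ramified. $f^{-\infty}(t)$ (resp. $f^{-\infty}(a)$) is the set of all solutions of $f^n(x)=t$ (resp. $f^n(x)=a$), $n\ge0$. Put $\overline{\mathrm{IMG}}=\mathrm{Gal}(\bar K(f^{-\infty}(t))/\bar K(t))$. $\widehat K_f$ is the algebraic closure of $K$ in $K(f^{-\infty}(t))$; restriction gives $\overline{\mathrm{IMG}}\cong\mathrm{Gal}(\widehat K_f(f^{-\infty}(t))/\widehat K_f(t))$. A point is post-critical if it is $f^n(c)$ for a critical point $c$ and some $n\ge1$. If $a\in\widehat K_f$ is not post-critical, $\mathrm{Gal}(\widehat K_f(f^{-\infty}(a))/\widehat K_f)$ is identified, up to conjugacy, with a decomposition subgroup over $t-a$ in $\mathrm{Gal}(\widehat K_f(f^{-\infty}(t))/\widehat K_f(t))$. The Frattini subgroup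 of a profinite group is the intersection of its maximal open subgroups. Hilbertian fields and Hilbert subsets are in the sense of Fried–Jarden, Field Arithmetic: a Hilbert subset of a field $F$ is a set of those $a\in F$ at which finitely many given irreducible polynomials in $F(t)[X]$ specialize (at $t=a$) to irreducible polynomials over $F$ and a given nonzero polynomial does not vanish. *)

(* Defs.v *)
From HB Require Import structures.
From mathcomp Require Import all_boot all_order all_algebra separable.
From mathcomp Require Import boolp classical_sets.

Set Implicit Arguments.
Unset Strict Implicit.
Unset Printing Implicit Defensive.

Import GRing.Theory.

Local Open Scope ring_scope.
Local Open Scope classical_set_scope.

Record subfld (L : fieldType) := Subfld {
  subfld_pred : {pred L};
  subfld_closed : divring_closed subfld_pred
}.

HB.instance Definition _ (L : fieldType) (E : subfld L) :=
  GRing.isDivringClosed.Build L (subfld_pred E) (subfld_closed E).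

Canonical subfld_predType (L : fieldType) :=
  PredType (fun E : subfld L => subfld_pred E).

(* A wrapper rather than a sigma-type, so that the field structure below is
   keyed on the subfield. *)
Record subfld_of (L : fieldType) (E : subfld L) := SubfldOf {
  subfld_val :> L;
  subfld_valP : subfld_val \in subfld_pred E
}.

HB.instance Definition _ (L : fieldType) (E : subfld L) :=
  [isSub for @subfld_val L E].
HB.instance Definition _ (L : fieldType) (E : subfld L) :=
  [Choice of subfld_of E by <:].
HB.instance Definition _ (L : fieldType) (E : subfld L) :=
  [SubChoice_isSubIntegralDomain of subfld_of E by <:].
HB.instance Definition _ (L : fieldType) (E : subfld L) :=
  [SubIntegralDomain_isSubField of subfld_of E by <:].

Section GeneratedSubfield.
Variables (L : fieldType) (S : set L).

Definition gen_pred : {pred L} :=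
  [pred x | `[< forall E : subfld L, (forall y, S y -> y \in E) -> x \in E >]].

Lemma gen_predP x : reflect
  (forall E : subfld L, (forall y, S y -> y \in E) -> x \in E) (x \in gen_pred).
Proof. exact: asboolP. Qed.

Lemma gen_closed : divring_closed gen_pred.
Proof.
split=> [|x y /gen_predP xE /gen_predP yE|x y /gen_predP xE /gen_predP yE];
  apply/gen_predP => E SE.
- exact: (rpred1 (subfld_pred E)).
- exact: (rpredB (xE E SE) (yE E SE)).
- exact: (rpred_div (xE E SE) (yE E SE)).
Qed.

Definition generated : subfld L := Subfld gen_closed.
End GeneratedSubfield.

Section Algebraic.
Variables (K L : fieldType) (iota : {rmorphism K -> L}) (E : subfld L).

Definition alg_pred : {pred L} :=
  [pred x | (x \in E) && `[< algebraicOver iota x >]].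

Lemma alg_predP x :
  reflect (x \in E /\ algebraicOver iota x) (x \in alg_pred).
Proof.
by apply: (iffP andP) => -[xE xA]; split=> //; apply/asboolP.
Qed.

Lemma alg_closed : divring_closed alg_pred.
Proof.
split=> [|x y /alg_predP[xE xA] /alg_predP[yE yA]
         |x y /alg_predP[xE xA] /alg_predP[yE yA]]; apply/alg_predP; split.
- exact: (rpred1 (subfld_pred E)).
- exact: algebraic1.
- exact: (rpredB xE yE).
- exact: algebraic_sub.
- exact: (rpred_div xE yE).
- exact: algebraic_div.
Qed.

Definition alg_closure_in : subfld L := Subfld alg_closed.
End Algebraic.

Lemma full_closed (L : fieldType) : divring_closed (predT : {pred L}).
Proof. by []. Qed.

Definition full_subfld (L : fieldType) : subfld L := Subfld (@full_closed L).

Section Galois.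
Variables (L : fieldType) (F : {pred L}).

Definition is_galois_aut (s : L -> L) : Prop :=
  [/\ zmod_morphism s, monoid_morphism s, bijective s &
      forall x, x \in F -> s x = x].

Record gal := Gal {
  gal_fun :> L -> L;
  _ : `[< is_galois_aut gal_fun >]
}.

HB.instance Definition _ := [isSub for gal_fun].
HB.instance Definition _ := [Choice of gal by <:].

Lemma gal_autP (s : gal) : is_galois_aut s.
Proof. by case: s => s /= /asboolP. Qed.

Lemma gal_one_subproof : `[< is_galois_aut id >].
Proof. by apply/asboolP; split=> //; exists id. Qed.

Lemma gal_mul_subproof (s r : gal) : `[< is_galois_aut (s \o r) >].
Proof.
have [sB [s1 sM] sb sF] := gal_autP s; have [rB [r1 rM] rb rF] := gal_autP r.
apply/asboolP; split.
- by move=> x y /=; rewrite rB sB.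
- by split=> [|x y] /=; rewrite ?r1 ?s1 ?rM ?sM.
- exact: bij_comp.
- by move=> x xF /=; rewrite rF ?sF.
Qed.

Lemma gal_inv_ex (s : gal) : {g : L -> L | cancel s g /\ cancel g s}.
Proof.
by apply: cid; have [_ _ [g sK gK] _] := gal_autP s; exists g.
Qed.

Definition gal_inv_fun (s : gal) : L -> L := sval (gal_inv_ex s).

Lemma gal_funK (s : gal) : cancel s (gal_inv_fun s).
Proof. by case: (svalP (gal_inv_ex s)). Qed.

Lemma gal_inv_funK (s : gal) : cancel (gal_inv_fun s) s.
Proof. by case: (svalP (gal_inv_ex s)). Qed.

Lemma gal_inv_subproof (s : gal) : `[< is_galois_aut (gal_inv_fun s) >].
Proof.
have [sB [s1 sM] sb sF] := gal_autP s.
have sI := can_inj (gal_funK s); have sK := gal_inv_funK s.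
apply/asboolP; split.
- by move=> x y; apply: sI; rewrite sB !sK.
- by split=> [|x y]; apply: sI; rewrite ?sM !sK ?s1.
- by exists s; [exact: sK | exact: gal_funK].
- by move=> x xF; apply: sI; rewrite sK sF.
Qed.

Definition gal_one := Gal gal_one_subproof.
Definition gal_mul s r := Gal (gal_mul_subproof s r).
Definition gal_inv s := Gal (gal_inv_subproof s).

Lemma gal_mulA : associative gal_mul.
Proof. by move=> s r u; apply: val_inj. Qed.
Lemma gal_mul1 : left_id gal_one gal_mul.
Proof. by move=> s; apply: val_inj. Qed.
Lemma gal_mulr1 : right_id gal_one gal_mul.
Proof. by move=> s; apply: val_inj. Qed.
Lemma gal_mulV : left_inverse gal_one gal_inv gal_mul.
Proof. by move=> s; apply/val_inj/funext => x /=; rewrite gal_funK. Qed.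
Lemma gal_mulrV : right_inverse gal_one gal_inv gal_mul.
Proof. by move=> s; apply/val_inj/funext => x /=; rewrite gal_inv_funK. Qed.

HB.instance Definition _ :=
  isGroup.Build gal gal_mulA gal_mul1 gal_mulr1 gal_mulV gal_mulrV.

(* Basic neighbourhoods of [s]: the automorphisms agreeing with [s] on a
   finite set, i.e. the cosets [s Gal(L/F(xs))]. *)
Definition krull_open (U : set gal) : Prop :=
  forall s, U s -> exists xs : seq L,
    forall r : gal, {in xs, forall x, r x = s x} -> U r.

Definition is_subgroup (H : set gal) : Prop :=
  [/\ H 1%g, forall s r, H s -> H r -> H (s * r)%g
    & forall s, H s -> H (s^-1)%g].

Definition open_subgroup (H : set gal) : Prop := is_subgroup H /\ krull_open H.

Definition maximal_open_subgroup (H : set gal) : Prop :=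
  [/\ open_subgroup H, H <> setT &
      forall J, open_subgroup J -> H `<=` J -> J = H \/ J = setT].

Definition frattini : set gal :=
  \bigcap_(H in [set H | maximal_open_subgroup H]) H.
End Galois.

(* [relgal E F] is Gal(E/F), for subfields E and F of L. *)
Definition relgal (L : fieldType) (E F : subfld L) :=
  gal [pred x : subfld_of E | val x \in F].

Section Tame.
Variables (L : fieldType) (k F : {pred L}).

(* The value at 0 is irrelevant: it stands for infinity. *)
Definition normalized_valuation (v : L -> int) : Prop :=
  [/\ forall x y, x != 0 -> y != 0 -> v (x * y) = v x + v y,
      forall x y, x != 0 -> y != 0 -> x + y != 0 ->
        (Num.min (v x) (v y) <= v (x + y))%R,
      exists2 x, x != 0 & v x = 1
    & forall x, x \in k -> x != 0 -> v x = 0].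

Definition val_integer (v : L -> int) (x : L) : Prop := x = 0 \/ (0 <= v x)%R.
Definition val_maximal (v : L -> int) (x : L) : Prop := x = 0 \/ (0 < v x)%R.

(* [e] is the positive generator of the value group of [F], that is its index
   in the value group Z of [L]. *)
Definition ramification_index (v : L -> int) (e : nat) : Prop :=
  [/\ (0 < e)%N, exists2 x, x \in F & x != 0 /\ v x = e%:Z
    & forall x, x \in F -> x != 0 -> (e %| v x)%Z].

(* Each residue class is a simple root of the reduction of a polynomial with
   coefficients in the valuation ring of [F]. *)
Definition residually_separable (v : L -> int) : Prop :=
  forall x, val_integer v x -> exists p : {poly L},
    [/\ forall i, p`_i \in F /\ val_integer v p`_i,
        val_maximal v p.[x] & ~ val_maximal v (p^`()).[x]].

(* L/F, a finite extension of function fields of one variable over [k], is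
   tamely ramified at all places.  The ramification indices are prime to the
   characteristic exponent iff they are nonzero in L. *)
Definition tamely_ramified_ext : Prop :=
  forall v, normalized_valuation v ->
    residually_separable v /\
    forall e, ramification_index v e -> e%:R != 0 :> L.
End Tame.

(* Nonconstant, i.e. of degree [(maxn (size rnum) (size rden)).-1 >= 1]. *)
Record ratmap (K : fieldType) := Ratmap {
  rnum : {poly K};
  rden : {poly K};
  rcoprime : coprimep rnum rden;
  rnonconst : (1 < maxn (size rnum) (size rden))%N
}.

Section RationalMaps.
Variables (K L : fieldType) (iota : {rmorphism K -> L}) (f : ratmap K).

Definition rdeg : nat := (maxn (size (rnum f)) (size (rden f))).-1.

Definition ratdiv (u w : L) : option L := if w == 0 then None else Some (u / w).

(* [option L] is the projective line over L, with [None] the point at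
   infinity. *)
Definition reval (x : option L) : option L :=
  if x is Some c
  then ratdiv (map_poly iota (rnum f)).[c] (map_poly iota (rden f)).[c]
  else ratdiv (iota (rnum f)`_rdeg) (iota (rden f)`_rdeg).

(* Vanishing of the Wronskian of numerator and denominator is ramification of
   f at a finite point, whether or not it is a pole.  At infinity, use the
   coordinate 1/x at 0, where numerator and denominator have the reversed
   coefficients. *)
Definition critical_point (x : option L) : Prop :=
  if x is Some c
  then root (map_poly iota ((rnum f)^`() * rden f - rnum f * (rden f)^`())) c
  else (rnum f)`_rdeg.-1 * (rden f)`_rdeg = (rnum f)`_rdeg * (rden f)`_rdeg.-1.

Definition post_critical (a : L) : Prop :=
  exists c n, [/\ critical_point c, (1 <= n)%N & iter n reval c = Some a].

(* The finite points of the backward orbit of [a]; the point at infinity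
   generates no extension. *)
Definition backward_orbit (a : L) : set L :=
  [set x | exists n, iter n reval (Some x) = Some a].
End RationalMaps.

Section Hilbert.
Variable F : fieldType.
Local Notation Ft := {fraction {poly F}}.

Definition specializes (a : F) (u : Ft) (b : F) : Prop :=
  exists n d : {poly F},
    [/\ d.[a] != 0, u = tofrac n / tofrac d & b = n.[a] / d.[a]].

Definition specializes_poly (a : F) (p : {poly Ft}) (q : {poly F}) : Prop :=
  forall i, specializes a p`_i q`_i.

Definition hilbert_set (ps : seq {poly Ft}) (g : {poly F}) : set F :=
  [set a | g.[a] != 0 /\
    forall p, p \in ps -> exists2 q, specializes_poly a p q & irreducible_poly q].

Definition is_hilbert_subset (H : set F) : Prop :=
  exists ps g, [/\ forall p, p \in ps -> irreducible_poly p, g != 0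
                 & H = hilbert_set ps g].

(* Only polynomials separable in X are required to have irreducible
   specializations. *)
Definition hilbertian : Prop :=
  forall ps g,
    (forall p, p \in ps -> irreducible_poly p /\ separable_poly p) -> g != 0 ->
    hilbert_set ps g !=set0.
End Hilbert.

(* A place of L with residue field R; [None] is infinity, and the valuation
   ring is the set of [x] with [phi x <> None]. *)
Definition is_place (L R : fieldType) (phi : L -> option R) : Prop :=
  [/\ phi 1 = Some 1,
      forall x y u w, phi x = Some u -> phi y = Some w ->
        phi (x + y) = Some (u + w) /\ phi (x * y) = Some (u * w),
      forall x, phi x = None -> phi x^-1 = Some 0
    & forall u, exists x, phi x = Some u].

Section Monodromy.
Variables (K : fieldType) (f : ratmap K).
Variables (Om : fieldType) (iota : {rmorphism K -> Om}) (t : Om).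

Definition base_rat : subfld Om := generated (range iota `|` [set t]).

Definition is_separable_closure (F : subfld Om) : Prop :=
  (forall x : Om, exists p : {poly subfld_of F},
     separable_poly p /\ root (map_poly val p) x) /\
  (forall p : {poly Om}, separable_poly p -> (1 < size p)%N ->
     exists x, root p x).

Definition Kbar : subfld Om := alg_closure_in iota (full_subfld Om).

Definition adjoin (E : subfld Om) (S : set Om) : subfld Om :=
  generated ([set x | x \in E] `|` S).

Definition tamely_ramified : Prop :=
  exists2 x : Om, reval iota f (Some x) = Some t &
    @tamely_ramified_ext (subfld_of (adjoin Kbar [set x]))
      [pred y | val y \in Kbar] [pred y | val y \in adjoin Kbar [set t]].

Definition IMGbar :=
  relgal (adjoin Kbar (backward_orbit iota f t)) (adjoin Kbar [set t]).

(* K(f^{-oo}(t)); it contains [t] as f^0(t) = t. *)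
Definition Kinfty : subfld Om := adjoin base_rat (backward_orbit iota f t).

Definition Khat : subfld Om := alg_closure_in iota Kinfty.

Definition Khat_tree (b : Om) : subfld Om :=
  adjoin Khat (backward_orbit iota f b).

Definition generic_gal :=
  relgal (Khat_tree t) (adjoin Khat [set t]).

Definition specialized_gal (a : subfld_of Khat) :=
  relgal (Khat_tree (val a)) Khat.

Section Specialization.
Variable a : subfld_of Khat.
Local Notation M := (subfld_of (Khat_tree t)).
Local Notation Ma := (subfld_of (Khat_tree (val a))).

(* A place of Khat(f^{-oo}(t)) over t = a, together with an identification of
   its residue field with Khat(f^{-oo}(a)) over Khat. *)
Definition place_over (phi : M -> option Ma) : Prop :=
  [/\ is_place phi,
      forall (x : M) (c : Ma), val x \in Khat -> val x = val c ->
        phi x = Some c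
    & forall (x : M) (c : Ma), val x = t -> val c = val a -> phi x = Some c].

Definition decomposition_group (phi : M -> option Ma) : set generic_gal :=
  [set s | forall x, phi (s x) = None <-> phi x = None].

(* The identification of Gal(Khat(f^{-oo}(a))/Khat) with the decomposition
   group of [phi]: [spec r] induces [r] on the residue field. *)
Definition is_specialization (phi : M -> option Ma)
    (spec : specialized_gal a -> generic_gal) : Prop :=
  [/\ {morph spec : r s / (r * s)%g}, injective spec,
      range spec = decomposition_group phi
    & forall r x, phi (spec r x) = omap r (phi x)].

(* Different places give conjugate decomposition groups, so all of them are
   considered. *)
Definition specialization_surjective : Prop :=
  (exists phi, place_over phi) /\
  forall phi, place_over phi ->
    exists2 spec, is_specialization phi spec &
      decomposition_group phi = setT.
End Specialization.
End Monodromy.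

(* Main.v *)
(** An open Frattini subgroup contains the pointwise stabilizer of a finite set
    X of elements of the tower, so a closed subgroup is the whole group as soon
    as it induces on X all that the group does.  Take a primitive element theta
    for X together with its conjugates, and the Hilbert set of the a at which
    the minimal polynomial of theta over Khat(t) stays irreducible, away from
    the zeros and poles of its discriminant: over Khat the residue of theta is
    then conjugate to the residues of all conjugates of theta, and it remains
    to lift automorphisms of the residue field to the decomposition group.

    This is van der Waerden's argument: a polynomial whose roots encode all the
    conjugates of a tuple has coefficients in the base field, so every
    automorphism of the residue field permutes the residues of the conjugates.
    Tame ramification includes separability of the residue fields, so every
    fiber of f over a point of Kbar splits; at points that are not
    post-critical it is moreover free of double points, which are zeros of the
    Wronskian of f.  Thus all fibers in the trees over t and a consist of deg f
    points of the projective line, the place t = a is injective on the tree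
    over t, and lifts are unique.

    Places and automorphisms are both graphs, i.e. relations compatible with
    the ring operations, with discrete valuation; Zorn's lemma reduces their
    extension to adjoining one point of the tree, in a coordinate 1/(x - c) in
    which the points of its fiber are finite.  The same extension along
    constants identifies the geometric group with the group over Khat, because
    minimal polynomials of constants over the tower have constant coefficients. *)

From HB Require Import structures.
Require Import Defs.
From mathcomp Require Import all_boot all_order all_algebra falgebra fieldext separable.
From mathcomp Require Import ring.
From mathcomp Require Import boolp classical_sets.

Set Implicit Arguments.
Unset Strict Implicit.
Unset Printing Implicit Defensive.

Import GRing.Theory.
Local Open Scope ring_scope.

(** Every point adjoined to a place is a simple root of a reduced polynomial, so each step is
    unramified and keeps the uniformizer. Hence the valuation stays discrete with uniformizer
    [t - a] up the infinite tower, and the valuation ring of each step can be written down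
    explicitly; uniformizer 0 gives isomorphisms of fields. The field [Om] is closed only under
    separable extensions, so an inseparable polynomial may lack roots in it. In fibers over
    constants such factors are excluded by the residue fields of the places of [Kbar(x)]. In fibers
    over transcendental points a double point would be a zero of the Wronskian, hence algebraic; the
    Wronskian itself is nonzero because [x] is separable over [K(t)]. Lifts on finite sets glue
    without a compactness argument, because each element depends on finitely many points of the tree
    and the place is injective there. *)

Section RingRel.
Variables (A B : comNzRingType) (R : A -> B -> Prop).

(** A subring of the product [A * B]. Evaluation of polynomials respects such a relation, which
    covers homomorphisms, places and congruences alike. *)
Record ringrel : Prop := RingRel {
  ringrel1 : R 1 1;
  ringrelB : forall x y u w, R x u -> R y w -> R (x - y) (u - w);
  ringrelM : forall x y u w, R x u -> R y w -> R (x * y) (u * w)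
}.

End RingRel.

Definition polyrel (A B : comNzRingType) (R : A -> B -> Prop)
  (p : {poly A}) (q : {poly B}) := forall i, R p`_i q`_i.

Section RingRelTheory.
Variables (A B : comNzRingType) (R : A -> B -> Prop).
Hypothesis RR : ringrel R.
Local Notation polyrel := (polyrel R).

Lemma ringrel0 : R 0 0.
Proof. by have := ringrelB RR (ringrel1 RR) (ringrel1 RR); rewrite !subrr. Qed.

Lemma ringrelN x u : R x u -> R (- x) (- u).
Proof. by move=> h; have := ringrelB RR ringrel0 h; rewrite !sub0r. Qed.

Lemma ringrelD x y u w : R x u -> R y w -> R (x + y) (u + w).
Proof.
by move=> h k; have := ringrelB RR h (ringrelN k); rewrite !opprK.
Qed.

Lemma ringrelX n x u : R x u -> R (x ^+ n) (u ^+ n).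
Proof.
move=> h; elim: n => [|n IH]; first by rewrite !expr0; exact: ringrel1.
by rewrite !exprS; exact: ringrelM.
Qed.

Lemma ringrelMn n x u : R x u -> R (x *+ n) (u *+ n).
Proof.
move=> h; elim: n => [|n IH]; first by rewrite !mulr0n; exact: ringrel0.
by rewrite !mulrS; exact: ringrelD.
Qed.

Lemma ringrel_sum (I : Type) (r : seq I) (P : pred I) F G :
  (forall i, P i -> R (F i) (G i)) ->
  R (\sum_(i <- r | P i) F i) (\sum_(i <- r | P i) G i).
Proof.
move=> h; elim/big_rec2: _ => [|i u x Pi]; first exact: ringrel0.
by apply: ringrelD; apply: h.
Qed.

Lemma ringrel_prod (I : Type) (r : seq I) (P : pred I) F G :
  (forall i, P i -> R (F i) (G i)) ->
  R (\prod_(i <- r | P i) F i) (\prod_(i <- r | P i) G i).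
Proof.
move=> h; elim/big_rec2: _ => [|i u x Pi]; first exact: ringrel1.
by apply: ringrelM => //; apply: h.
Qed.

Lemma polyrelC a b : R a b -> polyrel a%:P b%:P.
Proof. by move=> h i; rewrite !coefC; case: ifP => // _; exact: ringrel0. Qed.

Lemma polyrelX : polyrel 'X 'X.
Proof.
by move=> i; rewrite !coefX; case: eqP => _; [exact: ringrel1|exact: ringrel0].
Qed.

Lemma polyrel_ring : ringrel polyrel.
Proof.
split.
- by apply: polyrelC; exact: ringrel1.
- by move=> p q r s h k i; rewrite !coefB; exact: ringrelB.
- by move=> p q r s h k i; rewrite !coefM; apply: ringrel_sum => j _;
    exact: ringrelM.
Qed.

Lemma polyrel_horner p q x u : polyrel p q -> R x u -> R p.[x] q.[u].
Proof.
move=> h k; pose n := maxn (size p) (size q).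
rewrite (@horner_coef_wide _ n) ?leq_maxl //.
rewrite (@horner_coef_wide _ n q) ?leq_maxr //.
by apply: ringrel_sum => i _; apply: ringrelM => //; exact: ringrelX.
Qed.

Lemma polyrel_deriv p q : polyrel p q -> polyrel p^`() q^`().
Proof. by move=> h i; rewrite !coef_deriv; exact: ringrelMn. Qed.

Lemma polyrelZ a b p q : R a b -> polyrel p q -> polyrel (a *: p) (b *: q).
Proof. by move=> h k i; rewrite !coefZ; exact: ringrelM. Qed.

Lemma polyrelXsubC a b : R a b -> polyrel ('X - a%:P) ('X - b%:P).
Proof.
by move=> h; apply: (ringrelB polyrel_ring); [exact: polyrelX|exact: polyrelC].
Qed.

Lemma polyrel_poly n F G : (forall i, (i < n)%N -> R (F i) (G i)) ->
  polyrel (\poly_(i < n) F i) (\poly_(i < n) G i).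
Proof.
by move=> h i; rewrite !coef_poly; case: ifP => [/h //|_]; exact: ringrel0.
Qed.

Lemma polyrel_liftr (p : {poly A}) : (forall i, exists u, R p`_i u) -> exists q, polyrel p q.
Proof.
move=> /choice[g h]; exists (\poly_(i < size p) g i).
rewrite -[p in polyrel p]coefK; exact: polyrel_poly.
Qed.

Lemma polyrel_liftl (q : {poly B}) : (forall i, exists x, R x q`_i) -> exists p, polyrel p q.
Proof.
move=> /choice[g h]; exists (\poly_(i < size q) g i).
move=> i; rewrite coef_poly; case: ltnP => // /(nth_default 0)->.
exact: ringrel0.
Qed.

End RingRelTheory.

(** * Polynomials with coefficients in a subfield *)

Section SubfieldPolynomials.
Variables (L : fieldType) (E : subfld L).
Implicit Types p q : {poly L}.

Lemma subfld1 : 1 \in E. Proof. exact: (rpred1 (subfld_pred E)). Qed.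
Lemma subfld0 : 0 \in E. Proof. exact: (rpred0 (subfld_pred E)). Qed.
Lemma subfldB x y : x \in E -> y \in E -> x - y \in E.
Proof. exact: (@rpredB _ (subfld_pred E)). Qed.
Lemma subfldD x y : x \in E -> y \in E -> x + y \in E.
Proof. exact: (@rpredD _ (subfld_pred E)). Qed.
Lemma subfldN x : x \in E -> - x \in E.
Proof. by move=> h; rewrite (rpredN (subfld_pred E)). Qed.
Lemma subfldM x y : x \in E -> y \in E -> x * y \in E.
Proof. exact: (@rpredM _ (subfld_pred E)). Qed.
Lemma subfldV x : x \in E -> x^-1 \in E.
Proof. by move=> h; rewrite (rpredV (subfld_pred E)). Qed.
Lemma subfld_div x y : x \in E -> y \in E -> x / y \in E.
Proof. exact: (@rpred_div _ (subfld_pred E)). Qed.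
Lemma subfldX n x : x \in E -> x ^+ n \in E.
Proof. exact: (@rpredX _ (subfld_pred E)). Qed.
(** A predicate on polynomials over the ambient field, since several subfields are compared at once.
    Quotients, remainders, gcds and Bezout coefficients stay over [E] because they are compatible
    with field extensions. *)
Definition pover (p : {poly L}) := forall i, p`_i \in E.

Lemma poverP p : pover p <-> exists p' : {poly subfld_of E}, p = map_poly val p'.
Proof.
split=> [h|[p' ->] i]; last by rewrite coef_map; exact: (valP p'`_i).
exists (\poly_(i < size p) SubfldOf (h i)); apply/polyP => i.
rewrite coef_map coef_poly /=; case: ltnP => // /(nth_default 0)->.
exact/esym/(rmorph0 (val : subfld_of E -> L)).
Qed.

Lemma poverD p q : pover p -> pover q -> pover (p + q).
Proof. by move=> hp hq i; rewrite coefD; exact: subfldD. Qed.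

Lemma poverB p q : pover p -> pover q -> pover (p - q).
Proof. by move=> hp hq i; rewrite coefB; exact: subfldB. Qed.

Lemma poverM p q : pover p -> pover q -> pover (p * q).
Proof.
by move=> /poverP[p' ->] /poverP[q' ->]; apply/poverP; exists (p' * q');
  rewrite rmorphM.
Qed.

Lemma poverC c : c \in E -> pover c%:P.
Proof. by move=> h i; rewrite coefC; case: ifP => // _; exact: subfld0. Qed.

Lemma poverX : pover 'X.
Proof. by apply/poverP; exists 'X; rewrite map_polyX. Qed.

Lemma poverXsubC c : c \in E -> pover ('X - c%:P).
Proof. by move=> h; apply: poverB; [exact: poverX|exact: poverC]. Qed.

Lemma poverZ c p : c \in E -> pover p -> pover (c *: p).
Proof. by move=> h k i; rewrite coefZ; exact: subfldM. Qed.

Lemma pover1 : pover 1.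
Proof. by apply: poverC; exact: subfld1. Qed.

Lemma pover0 : pover 0.
Proof. by apply: poverC; exact: subfld0. Qed.

Lemma pover_exp p n : pover p -> pover (p ^+ n).
Proof.
move=> h; elim: n => [|n IH]; first by rewrite expr0; exact: pover1.
by rewrite exprS; exact: poverM.
Qed.

Lemma pover_sum (I : Type) (r : seq I) (P : pred I) F :
  (forall i, P i -> pover (F i)) -> pover (\sum_(i <- r | P i) F i).
Proof.
by move=> h; elim/big_ind: _ => //; [exact: pover0|exact: poverD].
Qed.

Lemma pover_prod (I : eqType) (r : seq I) F :
  {in r, forall i, pover (F i)} -> pover (\prod_(i <- r) F i).
Proof.
by move=> h; rewrite big_seq; elim/big_ind: _ => //; [exact: pover1|exact: poverM].
Qed.

Lemma pover_deriv p : pover p -> pover p^`().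
Proof.
by move=> /poverP[p' ->]; apply/poverP; exists p'^`(); rewrite deriv_map.
Qed.

Lemma pover_divp p q : pover p -> pover q -> pover (p %/ q).
Proof.
by move=> /poverP[p' ->] /poverP[q' ->]; apply/poverP; exists (p' %/ q');
  rewrite map_divp.
Qed.

Lemma pover_modp p q : pover p -> pover q -> pover (p %% q).
Proof.
by move=> /poverP[p' ->] /poverP[q' ->]; apply/poverP; exists (p' %% q');
  rewrite map_modp.
Qed.

Lemma pover_gcdp p q : pover p -> pover q -> pover (gcdp p q).
Proof.
by move=> /poverP[p' ->] /poverP[q' ->]; apply/poverP; exists (gcdp p' q');
  rewrite gcdp_map.
Qed.

Lemma pover_horner p x : pover p -> x \in E -> p.[x] \in E.
Proof.
move=> hp hx; rewrite horner_coef.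
apply: (@rpred_sum _ (subfld_pred E)) => i _.
by apply: subfldM => //; exact: subfldX.
Qed.

Lemma pover_Bezout p q : pover p -> pover q -> coprimep p q ->
  exists uv : {poly L} * {poly L},
    [/\ pover uv.1, pover uv.2 & uv.1 * p + uv.2 * q = 1].
Proof.
move=> /poverP[p' ->] /poverP[q' ->]; rewrite coprimep_map.
case/Bezout_eq1_coprimepP => -[u v] /= e.
exists (map_poly val u, map_poly val v); split=> /=.
- by apply/poverP; exists u.
- by apply/poverP; exists v.
- by have := congr1 (map_poly val) e; rewrite rmorphD !rmorphM rmorph1.
Qed.

Lemma minpoly_ex x : (exists p, [/\ p != 0, pover p & root p x]) ->
  exists p, [/\ p \is monic, pover p, root p x &
    forall q, pover q -> root q x -> p %| q].
Proof.
move=> [p0 [p0n p0E p0x]].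
pose Q n := `[< exists p, [/\ p != 0, pover p, root p x & size p = n] >].
have exQ : exists n, Q n by exists (size p0); apply/asboolP; exists p0.
have [n /asboolP[p [pn pE px sp]] minn] := ex_minnP exQ.
have lc0 : lead_coef p != 0 by rewrite lead_coef_eq0.
have p'E : pover ((lead_coef p)^-1 *: p).
  by apply: poverZ => //; apply: subfldV; exact: pE.
exists ((lead_coef p)^-1 *: p); split => //.
- by rewrite monicE lead_coefZ mulVf.
- by rewrite rootZ // invr_eq0.
move=> q qE qx; rewrite dvdpZl ?invr_eq0 //.
apply: contraT => nd; 
suff /minn : Q (size (q %% p)) by rewrite leqNgt -sp ltn_modp pn.
apply/asboolP; exists (q %% p); split => //; first exact: pover_modp.
have := qx; rewrite {1}(divp_eq q p) !rootE hornerD hornerM (rootP px).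
by rewrite mulr0 add0r.
Qed.

End SubfieldPolynomials.

(** * Generated subfields *)

Section Generated.
Variables (L : fieldType).

Lemma mem_generated (S : set L) x : S x -> x \in generated S.
Proof. by move=> h; apply/gen_predP => E; exact. Qed.

Lemma generated_min (S : set L) (E : subfld L) :
  (forall y, S y -> y \in E) -> forall x, x \in generated S -> x \in E.
Proof. by move=> h x /gen_predP; apply. Qed.

(** The closure conditions make [P] itself a subfield. The quotient clause includes [y = 0], where
    [x / y = 0], which is why inductions by this principle treat zero separately. *)
Lemma generated_ind (S : set L) (P : L -> Prop) :
  (forall x, S x -> P x) -> P 1 -> (forall x y, P x -> P y -> P (x - y)) ->
  (forall x y, P x -> P y -> P (x / y)) -> forall x, x \in generated S -> P x.
Proof.
move=> h0 h1 hB hD.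
have c : divring_closed [pred x | `[< P x >]].
  split=> [|x y /asboolP hx /asboolP hy|x y /asboolP hx /asboolP hy];
    apply/asboolP => //; [exact: hB|exact: hD].
move=> x /(@generated_min _ (Subfld c)) xP.
by apply/asboolP/xP => y Sy; apply/asboolP/h0.
Qed.

Lemma mem_adjoin_base (E : subfld L) (S : set L) x : x \in E -> x \in adjoin E S.
Proof. by move=> h; apply: mem_generated; left. Qed.

Lemma mem_adjoin (E : subfld L) (S : set L) x : S x -> x \in adjoin E S.
Proof. by move=> h; apply: mem_generated; right. Qed.

Lemma adjoin_min (E F : subfld L) (S : set L) :
  (forall x, x \in E -> x \in F) -> (forall x, S x -> x \in F) ->
  forall x, x \in adjoin E S -> x \in F.
Proof. by move=> h k; apply: generated_min => y []; [apply: h|apply: k]. Qed.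

Lemma adjoin_ind (E : subfld L) (S : set L) (P : L -> Prop) :
  (forall x, x \in E -> P x) -> (forall x, S x -> P x) ->
  (forall x y, P x -> P y -> P (x - y)) ->
  (forall x y, P x -> P y -> P (x / y)) -> forall x, x \in adjoin E S -> P x.
Proof.
move=> hE hS hB hD; apply: generated_ind => // [y []|]; [exact: hE|exact: hS|].
by apply: hE; exact: subfld1.
Qed.

End Generated.

(* The graph of a place of E: [R x u] says that x is integral with residue u. *)
Record pgraph (L1 L2 : fieldType) (E : subfld L1) (R : L1 -> L2 -> Prop) :
    Prop := PGraph {
  pg_ring : ringrel R;
  pg_0 : forall u, R 0 u -> u = 0;
  pg_dom : forall x u, R x u -> x \in E;
  pg_val : forall x, x \in E -> (exists u, R x u) \/ R x^-1 0
}.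

(** * Graphs of places *)

Section PGraph.
Variables (L1 L2 : fieldType) (E : subfld L1) (R : L1 -> L2 -> Prop).
Hypothesis PR : pgraph E R.
Let RR := pg_ring PR.

Lemma pg_fun x u w : R x u -> R x w -> u = w.
Proof.
move=> h k; apply/eqP; rewrite -subr_eq0; apply/eqP/(pg_0 PR).
by rewrite -(subrr x); exact: (ringrelB RR).
Qed.

Lemma pg_neq0 x u : R x u -> u != 0 -> x != 0.
Proof.
by move=> h; apply: contra_neq => x0; apply: (pg_0 PR); rewrite -x0.
Qed.

Lemma pg_inv x u : R x u -> u != 0 -> R x^-1 u^-1.
Proof.
move=> h u0; have x0 := pg_neq0 h u0.
have [[w hw]|] := pg_val PR (subfldV (pg_dom PR h)); last first.
  by rewrite invrK => /(pg_fun h) u00; rewrite u00 eqxx in u0.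
suff -> : u^-1 = w by [].
apply: (mulfI u0); rewrite mulfV //.
apply: (pg_fun (ringrel1 RR)).
by rewrite -[X in R X](mulfV x0); exact: ringrelM.
Qed.

Lemma pg_pover p q : polyrel R p q -> pover E p.
Proof. by move=> h i; exact: pg_dom (h i). Qed.

Lemma pg_polyfun p q q' : polyrel R p q -> polyrel R p q' -> q = q'.
Proof. by move=> h k; apply/polyP => i; exact: pg_fun (h i) (k i). Qed.

Lemma pg_monic p q : p \is monic -> polyrel R p q ->
  q \is monic /\ size q = size p.
Proof.
move=> pm h; have lq : q`_(size p).-1 = 1.
  by apply: pg_fun (h _) _; rewrite -lead_coefE (monicP pm); exact: ringrel1.
have sp : (0 < size p)%N by rewrite size_poly_gt0 monic_neq0.
have sq : size q = size p.
  apply/eqP; rewrite eqn_leq; apply/andP; split.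
    apply/leq_sizeP => j hj; apply: (pg_0 PR).
    by have := h j; rewrite nth_default.
  rewrite -(prednK sp) ltnNge; apply/negP => /(nth_default 0) q0.
  by move: lq; rewrite q0 => /eqP; rewrite eq_sym oner_eq0.
by rewrite monicE lead_coefE sq lq.
Qed.

(* j has the least valuation in the family l. *)
Lemma pg_norm (l : seq L1) : {in l, forall x, x \in E} ->
  (exists2 x, x \in l & x != 0) ->
  exists2 j, j \in l /\ j != 0 & {in l, forall x, exists u, R (x / j) u}.
Proof.
elim: l => [_ [x]|y l IH hl hx]; first by rewrite in_nil.
have hl' : {in l, forall x, x \in E}.
  by move=> x xl; apply: hl; rewrite inE xl orbT.
have yE : y \in E by apply: hl; rewrite inE eqxx.
case: (pselect (exists2 x, x \in l & x != 0)) => [hx'|hx'].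
  have [j [jl j0] hj] := IH hl' hx'.
  case: (pg_val PR (subfld_div yE (hl' _ jl))) => [hu|hu].
    exists j; first by rewrite inE jl orbT.
    by move=> x; rewrite inE => /predU1P[->//|]; exact: hj.
  have [y0|y0] := eqVneq y 0.
    exists j; first by rewrite inE jl orbT.
    move=> x; rewrite inE => /predU1P[->|]; last exact: hj.
    by rewrite y0 mul0r; exists 0; exact: ringrel0.
  exists y; first by rewrite inE eqxx.
  move=> x; rewrite inE => /predU1P[->|xl].
    by rewrite divff //; exists 1; exact: ringrel1.
  have [u hxu] := hj _ xl; exists (u * 0).
  rewrite -(divfK j0 x) -mulrA; apply: (ringrelM RR) => //.
  by move: hu; rewrite invf_div.
have l0 : {in l, forall x, x = 0}.
  by move=> x xl; apply: contra_notP hx' => /eqP x0; exists x.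
exists y.
  rewrite inE eqxx; split=> //; case: hx => x; rewrite inE.
  by case/predU1P => [->//|/l0->]; rewrite eqxx.
move=> x; rewrite inE => /predU1P[->|/l0->].
  have [->|y0] := eqVneq y 0; first by rewrite mul0r; exists 0; exact: ringrel0.
  by rewrite divff //; exists 1; exact: ringrel1.
by rewrite mul0r; exists 0; exact: ringrel0.
Qed.

(** Divide by a coefficient of least valuation: that coefficient becomes 1 and survives in the
    reduction. *)
Lemma pg_primitive p : p != 0 -> pover E p ->
  exists e q, [/\ e \in E, e != 0, polyrel R (e *: p) q & q != 0].
Proof.
move=> p0 pE.
have [||j [jp j0] hj] := @pg_norm p.
- by move=> x /(nthP 0)[i _ <-].
- exists (lead_coef p); last by rewrite lead_coef_eq0.
  by rewrite lead_coefE mem_nth // prednK // size_poly_gt0.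
have /(polyrel_liftr RR)[q hq] : forall i, exists u, R (j^-1 *: p)`_i u.
  move=> i; rewrite coefZ mulrC.
  have [hi|hi] := ltnP i (size p); first by apply: hj; exact: mem_nth.
  by rewrite nth_default // mul0r; exists 0; exact: ringrel0.
exists j^-1, q; split=> //; last 1 first.
- apply/eqP => q0; have /(nthP 0)[i _ ji] := jp.
  have := hq i; rewrite coefZ ji mulVf // q0 coef0 => /(pg_fun (ringrel1 RR))/eqP.
  by rewrite oner_eq0.
- by apply: subfldV; have /(nthP 0)[i _ <-] := jp.
- by rewrite invr_eq0.
Qed.

(** Gauss's lemma. Scale both factors to primitive ones; the scalars [e] and [d] are integral, being
    leading coefficients. The product of the two reductions is nonzero, so [e] and [d] have nonzero
    residues and the scaling can be undone. *)
Lemma pg_Gauss p q P Pb : p \is monic -> q \is monic -> pover E p ->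
    pover E q -> P = p * q -> polyrel R P Pb ->
  exists pb qb, [/\ polyrel R p pb, polyrel R q qb & Pb = pb * qb].
Proof.
move=> pm qm pE qE PE hP.
have [e [p1 [eE e0 hp1 p10]]] := pg_primitive (monic_neq0 pm) pE.
have [d [q1 [dE d0 hq1 q10]]] := pg_primitive (monic_neq0 qm) qE.
have [u hu] : exists u, R e u.
  exists p1`_(size p).-1; have := hp1 (size p).-1.
  by rewrite coefZ -lead_coefE (monicP pm) mulr1.
have [w hw] : exists w, R d w.
  exists q1`_(size q).-1; have := hq1 (size q).-1.
  by rewrite coefZ -lead_coefE (monicP qm) mulr1.
have h1 := ringrelM (polyrel_ring RR) hp1 hq1.
have h2 := polyrelZ RR (ringrelM RR hu hw) hP.
have e12 : p1 * q1 = (u * w) *: Pb.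
  apply: (pg_polyfun h1).
  by rewrite -scalerAl -scalerAr scalerA -PE.
have uw0 : u * w != 0.
  apply: contra_neq (mulf_neq0 p10 q10); rewrite e12 => ->.
  by rewrite scale0r.
move: uw0; rewrite mulf_eq0 negb_or => /andP[u0 w0].
have hp : polyrel R p (u^-1 *: p1).
  rewrite -[p](scalerK e0); apply: polyrelZ => //; exact: pg_inv.
have hq : polyrel R q (w^-1 *: q1).
  rewrite -[q](scalerK d0); apply: polyrelZ => //; exact: pg_inv.
exists (u^-1 *: p1), (w^-1 *: q1); split=> //.
apply: (pg_polyfun hP); rewrite PE.
by apply: (ringrelM (polyrel_ring RR)).
Qed.

(** Valuation rings are integrally closed: by Gauss's lemma the factor [X - z] has integral
    coefficients. *)
Lemma pg_integral z P Pb : P \is monic -> polyrel R P Pb -> z \in E ->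
  root P z -> exists w, R z w.
Proof.
move=> Pm hP zE /factor_theorem[q Pq].
have qm : q \is monic by rewrite -(monicMr _ (monicXsubC z)) -Pq.
have qE : pover E q.
  have -> : q = P %/ ('X - z%:P) by rewrite Pq mulpK // polyXsubC_eq0.
  by apply: pover_divp; [exact: pg_pover hP|exact: poverXsubC].
have [pb [qb [_ h _]]] :=
  pg_Gauss qm (monicXsubC z) qE (poverXsubC zE) Pq hP.
exists (- qb`_0); have := ringrelN RR (h 0%N).
by rewrite coefB coefX coefC /= sub0r opprK.
Qed.

End PGraph.

(* A place of the field of fractions of the domain of R whose valuation ring is
   discrete with uniformizer s, or the whole field when s = 0. *)
Record dgraph (L1 L2 : fieldType) (s : L1) (R : L1 -> L2 -> Prop) :
    Prop := DGraph {
  dg_ring : ringrel R;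
  dg_0 : forall u, R 0 u -> u = 0;
  dg_inv : forall x u, R x u -> u != 0 -> R x^-1 u^-1;
  dg_s : R s 0;
  dg_disc : forall x u, R x u -> x != 0 ->
    exists k y w, [/\ R y w, w != 0 & x = s ^+ k * y]
}.

(** * Discrete places *)

Section DGraph.
Variables (L1 L2 : fieldType) (s : L1) (R : L1 -> L2 -> Prop).
Hypothesis DR : dgraph s R.
Let RR := dg_ring DR.

Definition frac_pred : {pred L1} :=
  [pred x | `[< exists y u z w, [/\ R y u, R z w, z != 0 & x = y / z] >]].

Lemma frac_predP x : reflect
  (exists y u z w, [/\ R y u, R z w, z != 0 & x = y / z]) (x \in frac_pred).
Proof. exact: asboolP. Qed.

Lemma frac_closed : divring_closed frac_pred.
Proof.
split=> [|x x' /frac_predP[y [u [z [w [hy hz z0 ->]]]]]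
              /frac_predP[y' [u' [z' [w' [hy' hz' z0' ->]]]]]
         |x x' /frac_predP[y [u [z [w [hy hz z0 ->]]]]]
              /frac_predP[y' [u' [z' [w' [hy' hz' z0' ->]]]]]]; apply/frac_predP.
- by exists 1, 1, 1, 1; rewrite divr1 oner_eq0; split=> //; exact: ringrel1.
- exists (y * z' - y' * z), (u * w' - u' * w), (z * z'), (w * w').
  split; [|exact: ringrelM|by rewrite mulf_neq0|].
    by apply: ringrelB => //; apply: ringrelM.
  by rewrite -mulNr addf_div // mulNr.
have [->|y0'] := eqVneq y' 0.
  exists 0, 0, 1, 1; rewrite mul0r invr0 mulr0 mul0r oner_eq0.
  by split=> //; [exact: ringrel0|exact: ringrel1].
exists (y * z'), (u * w'), (z * y'), (w * u').
by split; [exact: ringrelM|exact: ringrelM|rewrite mulf_neq0|rewrite invf_div mulf_div].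
Qed.

Definition frac_subfld : subfld L1 := Subfld frac_closed.

Lemma mem_frac x u : R x u -> x \in frac_subfld.
Proof.
move=> h; apply/frac_predP; exists x, u, 1, 1.
by rewrite divr1 oner_eq0; split=> //; exact: ringrel1.
Qed.

(** Numerator and denominator are powers of [s] times units, and comparing the exponents shows the
    fraction or its inverse to be integral. *)
Lemma dg_pgraph : pgraph frac_subfld R.
Proof.
split; [exact: RR|exact: (dg_0 DR)|exact: mem_frac|].
move=> x /frac_predP[y [u [z [w [hy hz z0 ->]]]]].
have [->|y0] := eqVneq y 0; first by left; exists 0; rewrite mul0r; exact: ringrel0.
have [k [y1 [u1 [hy1 u10 ->]]]] := dg_disc DR hy y0.
have [l [z1 [w1 [hz1 w10 ez]]]] := dg_disc DR hz z0.
(* This covers [s = 0] too: there [z != 0] forces [l = 0]. *)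
have /andP[sl0 z10] : (s ^+ l != 0) && (z1 != 0) by rewrite -negb_or -mulf_eq0 -ez.
have hs n := ringrelX RR n (dg_s DR).
have [kl|lk] := leqP l k.
  (* The power of 0 is the residue of the power of [s]: it is 1 when [k = l] and 0 otherwise. *)
  left; exists (0 ^+ (k - l) * (u1 / w1)); rewrite ez.
  have -> : s ^+ k * y1 / (s ^+ l * z1) = s ^+ (k - l) * (y1 / z1).
    by rewrite -(subnK kl) exprD addnK -mulf_div mulfK.
  by apply: ringrelM => //; apply: ringrelM => //; exact: (dg_inv DR).
right; rewrite ez.
have -> : (s ^+ k * y1 / (s ^+ l * z1))^-1 = s ^+ (l - k) * (z1 / y1).
  rewrite invf_div -{1}(subnK (ltnW lk)) exprD.
  have sk0 : s ^+ k != 0.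
    by move: sl0; rewrite -(subnK (ltnW lk)) exprD mulf_eq0 negb_or => /andP[].
  by rewrite -mulf_div -[X in X * _]mulrA divff // mulr1.
have -> : 0 = 0 ^+ (l - k) * (w1 / u1) :> L2.
  by rewrite expr0n subn_eq0 leqNgt lk mul0r.
by apply: ringrelM => //; apply: ringrelM => //; exact: (dg_inv DR).
Qed.

Definition res_pred : {pred L2} := [pred u | `[< exists x, R x u >]].

Lemma res_predP u : reflect (exists x, R x u) (u \in res_pred).
Proof. exact: asboolP. Qed.

Lemma res_closed : divring_closed res_pred.
Proof.
split=> [|u w /res_predP[x hx] /res_predP[y hy]
         |u w /res_predP[x hx] /res_predP[y hy]]; apply/res_predP.
- by exists 1; exact: ringrel1.
- by exists (x - y); exact: ringrelB.
have [->|w0] := eqVneq w 0; first by exists 0; rewrite invr0 mulr0; exact: ringrel0.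
by exists (x / y); apply: ringrelM => //; exact: (dg_inv DR).
Qed.

Definition res_subfld : subfld L2 := Subfld res_closed.

Lemma mem_res x u : R x u -> u \in res_subfld.
Proof. by move=> h; apply/res_predP; exists x. Qed.

Lemma res_pover p q : polyrel R p q -> pover res_subfld q.
Proof. by move=> h i; exact: mem_res (h i). Qed.

Lemma res_lift q : pover res_subfld q -> exists p, polyrel R p q.
Proof. by move=> h; apply: (polyrel_liftl RR) => i; apply/res_predP/h. Qed.

(** The maximal ideal is generated by [s]: exponent 0 would make the residue of [c] that of a
    unit. *)
Lemma dg_max c : R c 0 -> exists y w, R y w /\ c = s * y.
Proof.
move=> h; have [->|c0] := eqVneq c 0.
  by exists 0, 0; rewrite mulr0; split=> //; exact: ringrel0.
have [[|k] [y [w [hy w0 ec]]]] := dg_disc DR h c0.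
  move: h; rewrite ec expr0 mul1r => /(pg_fun dg_pgraph hy) e.
  by rewrite e eqxx in w0.
exists (s ^+ k * y), (0 ^+ k * w); split; last by rewrite ec exprS mulrA.
by apply: ringrelM => //; apply: ringrelX => //; exact: (dg_s DR).
Qed.

(** A denominator is a power of [s] times a unit, so powers of [s] suffice to clear denominators. *)
Lemma dg_denom p : pover frac_subfld p ->
  exists j q qb, [/\ s ^+ j != 0, polyrel R q qb & s ^+ j *: p = q].
Proof.
elim/poly_ind: p => [_|p c IH hpc].
  exists 0, 0, 0; rewrite expr0 oner_eq0 scaler0; split=> //.
  by apply: (ringrel0 (polyrel_ring RR)).
have [j [q [qb [sj0 hq eq]]]] : exists j q qb,
    [/\ s ^+ j != 0, polyrel R q qb & s ^+ j *: p = q].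
  apply: IH => i; have := hpc i.+1.
  by rewrite coefD coefMX coefC /= addr0.
have : c \in frac_subfld by have := hpc 0; rewrite coefD coefMX coefC /= add0r.
case/frac_predP => [y [u [z [w [hy hz z0 ec]]]]].
have [l [z1 [w1 [hz1 w10 ez]]]] := dg_disc DR hz z0.
have /andP[sl0 z10] : (s ^+ l != 0) && (z1 != 0) by rewrite -negb_or -mulf_eq0 -ez.
have hs n := ringrelX RR n (dg_s DR).
exists (j + l)%N, (s ^+ l *: q * 'X + (s ^+ j * (y / z1))%:P),
  (0 ^+ l *: qb * 'X + (0 ^+ j * (u / w1))%:P); split.
- by rewrite exprD mulf_neq0.
- apply: (ringrelD (polyrel_ring RR)).
    apply: (ringrelM (polyrel_ring RR)); last exact: polyrelX.
    exact: polyrelZ.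
  apply: polyrelC => //; apply: ringrelM => //; apply: ringrelM => //.
  exact: (dg_inv DR).
rewrite scalerDr -eq scalerA -exprD addnC scalerAl; congr (_ + _).
rewrite -mul_polyC -polyCM; congr _%:P.
rewrite ec ez addnC exprD -mulrA; congr (_ * _).
by rewrite mulrCA invfM mulVKf.
Qed.

End DGraph.

(** The gcd cannot vanish at [x], so its cofactor in [p] does; by minimality this cofactor has the
    size of [p], and the gcd is constant. *)
Lemma minpoly_coprime (L : fieldType) (E : subfld L) x (p g : {poly L}) :
    p \is monic -> pover E p -> root p x ->
    (forall q, pover E q -> root q x -> p %| q) ->
  pover E g -> ~~ root g x -> coprimep g p.
Proof.
move=> pm pE px pmin gE gx; pose d := gcdp g p; pose c := p %/ d.
have dE : pover E d by exact: pover_gcdp.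
have pc : p = c * d by rewrite divpK // dvdp_gcdr.
have : root c x.
  move: px; rewrite {1}pc rootM => /orP[//|/factor_theorem[q qe]].
  by rewrite -(divpK (dvdp_gcdl g p)) -/d qe mulrA rootM root_XsubC eqxx orbT in gx.
move=> /(pmin _ (pover_divp pE dE)) /dvdp_leq; have p0 := monic_neq0 pm.
have c0 : c != 0 by apply: contra_neq p0 => c0; rewrite pc c0 mul0r.
have d0 : d != 0 by apply: contra_neq p0 => d0; rewrite pc d0 mulr0.
move=> /(_ c0); have -> : size p = (size c + size d).-1 by rewrite {1}pc size_mul.
rewrite /coprimep -/d; move: c0 d0; rewrite -!size_poly_gt0.
case: (size c) => [//|m]; case: (size d) => [//|[//|n]] _ _.
by rewrite addSn /= -[m.+1]addn1 leq_add2l.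
Qed.

(** * Adjoining a simple root to a discrete place *)

Section ExtensionStep.
Variables (L1 L2 : fieldType) (s : L1) (R : L1 -> L2 -> Prop).
Hypothesis DR : dgraph s R.
Variables (x : L1) (p : {poly L1}) (x0 : L2) (pb : {poly L2}).
Hypotheses (pm : p \is monic) (hp : polyrel R p pb) (px : root p x)
  (pmin : forall q, pover (frac_subfld DR) q -> root q x -> p %| q)
  (px0 : root pb x0) (px1 : ~~ root pb^`() x0).
Let E := frac_subfld DR.
Let RR := dg_ring DR.
Let PR := dg_pgraph DR.
Let PP := polyrel_ring RR.

(** Residues at [x0] are well defined: [g] is a multiple of [p], with a cofactor that need not be
    integral. After scaling the cofactor to a primitive one, either the scalar has a nonzero residue
    and [pb] divides [gb], or its inverse has residue 0 and [gb = 0]. *)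
Lemma ext_zero g gb : polyrel R g gb -> g.[x] = 0 -> gb.[x0] = 0.
Proof.
move=> hg gx; have gE := pg_pover PR hg; have pE := pg_pover PR hp.
have /divpK : p %| g by apply: pmin => //; apply/rootP.
set q := g %/ p => gq; have qE : pover E q by exact: pover_divp.
have [q0|q0] := eqVneq q 0.
  move: hg; rewrite -gq q0 mul0r => /(pg_polyfun PR (ringrel0 PP)) <-.
  by rewrite horner0.
have [e [q1 [eE e0 hq1 q10]]] := pg_primitive PR q0 qE.
have pb0 : pb != 0 by rewrite monic_neq0 //; have [] := pg_monic PR pm hp.
have h1 := ringrelM PP hq1 hp.
case: (pg_val PR eE) => [[u hu]|hu].
  have h2 := polyrelZ RR hu hg.
  have e12 : q1 * pb = u *: gb.
    by apply: (pg_polyfun PR h1); rewrite -scalerAl gq.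
  have u0 : u != 0.
    by apply: contra_neq (mulf_neq0 q10 pb0); rewrite e12 => ->; rewrite scale0r.
  have := congr1 (horner^~ x0) e12; rewrite hornerM (rootP px0) mulr0 hornerZ.
  by move/esym/eqP; rewrite mulf_eq0 (negPf u0) => /eqP.
have : polyrel R g (0 *: (q1 * pb)).
  have -> : g = e^-1 *: (e *: q * p) by rewrite -scalerAl scalerA mulVf // scale1r gq.
  exact: polyrelZ.
by move=> /(pg_polyfun PR hg) ->; rewrite scale0r horner0.
Qed.

(** The localization, at the residue point [x0], of the ring generated by [x] over the valuation
    ring. As [x0] is a simple root of [pb], this extension is unramified and [s] remains a
    uniformizer. *)
Definition ext_rel (y : L1) (u : L2) : Prop :=
  exists g gb h hb, [/\ polyrel R g gb, polyrel R h hb, hb.[x0] != 0,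
    y = g.[x] / h.[x] & u = gb.[x0] / hb.[x0]].

Lemma ext_neq0 h hb : polyrel R h hb -> hb.[x0] != 0 -> h.[x] != 0.
Proof. by move=> hh; apply: contra_neq; exact: ext_zero. Qed.

Lemma ext_poly g gb : polyrel R g gb -> ext_rel g.[x] gb.[x0].
Proof.
move=> hg; exists g, gb, 1, 1; rewrite !hornerC !divr1 oner_eq0; split=> //.
exact: (ringrel1 PP).
Qed.

Lemma ext_sub y u : R y u -> ext_rel y u.
Proof.
by move=> h; rewrite -[y](hornerC _ x) -[u](hornerC _ x0); apply: ext_poly;
  exact: polyrelC.
Qed.

Lemma ext_gen : ext_rel x x0.
Proof.
rewrite -{1}[x]hornerX -[x0]hornerX; apply: ext_poly; exact: polyrelX.
Qed.

Lemma ext_ring : ringrel ext_rel.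
Proof.
split.
- by apply: ext_sub; exact: ringrel1.
- move=> _ _ _ _ [g [gb [h [hb [hg hh hb0 -> ->]]]]]
    [g' [gb' [h' [hb' [hg' hh' hb0' -> ->]]]]].
  have h0 := ext_neq0 hh hb0; have h0' := ext_neq0 hh' hb0'.
  exists (g * h' - g' * h), (gb * hb' - gb' * hb), (h * h'), (hb * hb'); split.
  + by apply: (ringrelB PP); apply: (ringrelM PP).
  + exact: (ringrelM PP).
  + by rewrite hornerM mulf_neq0.
  + by rewrite -mulNr addf_div // !hornerE mulNr.
  + by rewrite -mulNr addf_div // !hornerE mulNr.
- move=> _ _ _ _ [g [gb [h [hb [hg hh hb0 -> ->]]]]]
    [g' [gb' [h' [hb' [hg' hh' hb0' -> ->]]]]].
  exists (g * g'), (gb * gb'), (h * h'), (hb * hb'); split.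
  + exact: (ringrelM PP).
  + exact: (ringrelM PP).
  + by rewrite hornerM mulf_neq0.
  + by rewrite !hornerM mulf_div.
  + by rewrite !hornerM mulf_div.
Qed.

(* x0 is a simple root of pb, so a factor of pb prime to it cofactors gb. *)
Lemma ext_shrink g gb : polyrel R g gb -> gb.[x0] = 0 ->
  exists h hb g1 g1b, [/\ polyrel R h hb, polyrel R g1 g1b, hb.[x0] != 0 &
    g.[x] * h.[x] = s * g1.[x]].
Proof.
move=> hg gx0; pose d := gcdp gb pb; pose c := pb %/ d.
have gbE := res_pover DR hg; have pbE := res_pover DR hp.
have dE : pover (res_subfld DR) d by exact: pover_gcdp.
have cE : pover (res_subfld DR) c by exact: pover_divp.
have pbc : pb = c * d by rewrite divpK // dvdp_gcdr.
have rd : root d x0 by rewrite root_gcd px0 andbT; apply/rootP.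
have cx0 : c.[x0] != 0.
  apply: contra px1 => cx0; rewrite pbc derivM rootE hornerD !hornerM.
  by rewrite (eqP cx0) (rootP rd) mulr0 mul0r addr0.
pose r := gb %/ d.
have rE : pover (res_subfld DR) r by exact: pover_divp.
have gbr : gb = r * d by rewrite divpK // dvdp_gcdl.
have [h hh] := res_lift cE; have [q hq] := res_lift rE.
(* Both products reduce to the least common multiple of [gb] and [pb], so each coefficient of the
   difference is divisible by [s], while [p] vanishes at [x]. *)
have : polyrel R (g * h - p * q) 0.
  have -> : 0 = gb * c - pb * r by rewrite pbc gbr -!mulrA [d * c]mulrC [d * r]mulrC mulrCA subrr.
  by apply: (ringrelB PP); apply: (ringrelM PP).
move=> h0.
have /choice[f hf] : forall i, exists yw : L1 * L2,
    R yw.1 yw.2 /\ (g * h - p * q)`_i = s * yw.1.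
  move=> i; have := h0 i; rewrite coef0 => /(dg_max DR)[y [w [? ?]]].
  by exists (y, w).
pose n := size (g * h - p * q).
exists h, c, (\poly_(i < n) (f i).1), (\poly_(i < n) (f i).2); split=> //.
- by apply: polyrel_poly => // i _; have [] := hf i.
have : g * h - p * q = s *: \poly_(i < n) (f i).1.
  apply/polyP => i; rewrite coefZ coef_poly; case: ltnP => hi.
    by have [] := hf i.
  by rewrite mulr0 nth_default.
move/(congr1 (horner^~ x)); rewrite hornerD hornerN !hornerM (rootP px) mul0r.
by rewrite subr0 hornerZ.
Qed.

(** A Bezout relation with the minimal polynomial, freed of denominators, shows that [g.[x]] divides
    a power [s ^+ j]. This bounds how often a factor [s] can be split off by [ext_shrink]. *)
Lemma ext_disc g gb : polyrel R g gb -> g.[x] != 0 ->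
  exists k h hb g1 g1b, [/\ polyrel R h hb, polyrel R g1 g1b,
    hb.[x0] != 0, g1b.[x0] != 0 & g.[x] * h.[x] = s ^+ k * g1.[x]].
Proof.
move=> hg gx; have gE := pg_pover PR hg.
have gp : coprimep g p := minpoly_coprime pm (pg_pover PR hp) px pmin gE gx.
have [[a b] /= [aE _ ab]] := pover_Bezout gE (pg_pover PR hp) gp.
have [j [T [Tb [sj0 hT eT]]]] := dg_denom aE.
have gT : g.[x] * T.[x] = s ^+ j.
  have := congr1 (horner^~ x) ab; rewrite hornerD !hornerM (rootP px) mulr0 addr0.
  by rewrite hornerC -eT hornerZ mulrCA [g.[x] * _]mulrC => ->; rewrite mulr1.
(* If no [g1b.[x0]] is ever nonzero, then [ext_shrink] can be repeated forever. *)
apply: contrapT => H.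
have {}H k : exists h hb g1 g1b, [/\ polyrel R h hb, polyrel R g1 g1b,
    hb.[x0] != 0 & g.[x] * h.[x] = s ^+ k * g1.[x]].
  elim: k => [|k [h [hb [g1 [g1b [hh hg1 hb0 e]]]]]].
    exists 1, 1, g, gb; rewrite !hornerC oner_eq0 expr0 mulr1 mul1r.
    by split=> //; exact: (ringrel1 PP).
  have [g10|g10] := eqVneq g1b.[x0] 0; last first.
    by case: H; exists k, h, hb, g1, g1b.
  have [h' [hb' [g2 [g2b [hh' hg2 hb0' e']]]]] := ext_shrink hg1 g10.
  exists (h * h'), (hb * hb'), g2, g2b; split=> //.
  - exact: (ringrelM PP).
  - by rewrite hornerM mulf_neq0.
  - by rewrite hornerM mulrA e -mulrA e' exprSr mulrA.
(* One step beyond the bound [j], the cofactor [h.[x]] is itself a multiple of [s], against [hb.[x0]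
   != 0]. *)
have [h [hb [g1 [g1b [hh hg1 hb0 e]]]]] := H j.+1.
have hx : h.[x] = (s *: (T * g1)).[x].
  apply: (mulfI sj0); rewrite -{1}gT [_ * T.[x]]mulrC -mulrA e hornerZ hornerM.
  by rewrite exprSr -!mulrA mulrCA [T.[x] * _]mulrCA.
have hz : polyrel R (h - s *: (T * g1)) (hb - 0 *: (Tb * g1b)).
  apply: (ringrelB PP) => //; apply: polyrelZ => //; first exact: (dg_s DR).
  exact: (ringrelM PP).
have := ext_zero hz; rewrite hornerD hornerN hx subrr => /(_ erefl).
by rewrite scale0r subr0 => /eqP; rewrite (negPf hb0).
Qed.

Lemma ext_dgraph : dgraph s ext_rel.
Proof.
split; first exact: ext_ring.
- move=> _ [g [gb [h [hb [hg hh hb0 /esym/eqP e ->]]]]].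
  move: e; rewrite mulf_eq0 invr_eq0 (negPf (ext_neq0 hh hb0)) orbF => /eqP.
  by move/(ext_zero hg) ->; rewrite mul0r.
- move=> _ _ [g [gb [h [hb [hg hh hb0 -> ->]]]]].
  rewrite mulf_eq0 negb_or => /andP[gb0 _]; rewrite !invf_div.
  by exists h, hb, g, gb.
- by apply: ext_sub; exact: (dg_s DR).
- move=> _ _ [g [gb [h [hb [hg hh hb0 -> _]]]]].
  rewrite mulf_eq0 negb_or => /andP[g0 h0].
  have [k [h' [hb' [g1 [g1b [hh' hg1 hb0' g10 e]]]]]] := ext_disc hg g0.
  have h'0 := ext_neq0 hh' hb0'.
  exists k, (g1.[x] / (h * h').[x]), (g1b.[x0] / (hb * hb').[x0]); split.
  + exists g1, g1b, (h * h'), (hb * hb'); split=> //; first exact: (ringrelM PP).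
    by rewrite hornerM mulf_neq0.
  + by rewrite hornerM mulf_neq0 // invr_eq0 mulf_neq0.
  + by rewrite mulrA -e hornerM -mulf_div divff // mulr1.
Qed.

End ExtensionStep.

(** * Maximal discrete places *)

Section Maximal.
Variables (L1 L2 : fieldType) (s : L1) (P : L1 -> L2 -> Prop).

(** Each axiom concerns at most two pairs at a time and the uniformizer is fixed in advance, so
    discreteness passes to unions of chains. The predicate [P] confines the graphs to given
    fields. *)
Lemma dgraph_max R0 : dgraph s R0 -> (forall x u, R0 x u -> P x u) ->
  exists R, [/\ dgraph s R, forall x u, R0 x u -> R x u,
    forall x u, R x u -> P x u &
    forall R', dgraph s R' -> (forall x u, R x u -> R' x u) ->
      (forall x u, R' x u -> P x u) -> forall x u, R' x u -> R x u].
Proof.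
move=> D0 P0.
pose C (S : set (L1 * L2)) := S = set0 \/ [/\ dgraph s (fun x u => S (x, u)),
  forall x u, R0 x u -> S (x, u) & forall x u, S (x, u) -> P x u].
have [|S [CS maxS]] := @Zorn_bigcup _ C.
  move=> F FC tF.
  case: (pselect (exists2 S, F S & exists z, S z)) => [[S0 FS0 [z0 Sz0]]|nF]; last first.
    by left; rewrite predeqE => z; split=> // -[S FS Sz]; case: nF; exists S => //; exists z.
  right.
  have up z1 z2 : (\bigcup_(X in F) X)%classic z1 -> (\bigcup_(X in F) X)%classic z2 ->
      exists S, [/\ F S, S z1, S z2 & C S /\ S <> set0].
    move=> [S1 F1 h1] [S2 F2 h2]; case: (tF _ _ F1 F2) => sub.
      exists S2; split=> //; [exact: sub|split; first exact: FC].
      by move=> e; rewrite e in h2.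
    exists S1; split=> //; [exact: sub|split; first exact: FC].
    by move=> e; rewrite e in h1.
  have up1 z1 : (\bigcup_(X in F) X)%classic z1 -> exists S, [/\ F S, S z1 &
      [/\ dgraph s (fun x u => S (x, u)), forall x u, R0 x u -> S (x, u) &
         forall x u, S (x, u) -> P x u]].
    by move=> h; have [S [FS h1 _ [[//|CS] _]]] := up _ _ h h; exists S.
  have h0 : (\bigcup_(X in F) X)%classic z0 by exists S0.
  have inF S z : F S -> S z -> (\bigcup_(X in F) X)%classic z by move=> *; exists S.
  split.
  - split; [split|..].
    + have [S [FS _ [D _ _]]] := up1 _ h0.
      by apply: (inF S) => //; exact: (ringrel1 (dg_ring D)).
    + move=> x y u w hx hy; have [S [FS h1 h2 [[//|[D _ _]] _]]] := up _ _ hx hy.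
      by apply: (inF S) => //; exact: (ringrelB (dg_ring D)).
    + move=> x y u w hx hy; have [S [FS h1 h2 [[//|[D _ _]] _]]] := up _ _ hx hy.
      by apply: (inF S) => //; exact: (ringrelM (dg_ring D)).
    + by move=> u /up1[S [FS h1 [D _ _]]]; exact: (dg_0 D).
    + move=> x u /up1[S [FS h1 [D _ _]]] u0; apply: (inF S) => //.
      exact: (dg_inv D).
    + have [S [FS _ [D _ _]]] := up1 _ h0.
      by apply: (inF S) => //; exact: (dg_s D).
    + move=> x u /up1[S [FS h1 [D _ _]]] x0.
      have [k [y [w [hy w0 ->]]]] := dg_disc D h1 x0.
      by exists k, y, w; split=> //; exact: (inF S).
  - move=> x u hx; have [S [FS _ [_ D _]]] := up1 _ h0.
    by apply: (inF S) => //; exact: D.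
  - by move=> x u /up1[S [FS h1 [_ _ D]]]; exact: D.
have [DS S0 SP] : [/\ dgraph s (fun x u => S (x, u)),
    forall x u, R0 x u -> S (x, u) & forall x u, S (x, u) -> P x u].
  case: CS => // e; case: (maxS (fun z => R0 z.1 z.2)).
    rewrite e; split=> // h; suff : @set0 (L1 * L2) (1, 1) by [].
    by apply: h => /=; exact: (ringrel1 (dg_ring D0)).
  by right.
exists (fun x u => S (x, u)); split=> // R' DR' SR' PR' x u hxu.
apply: contrapT => nS; case: (maxS (fun z => R' z.1 z.2)).
  split=> [[y w] /= /SR'//|]; move=> /(_ (x, u)) h; exact/nS/h.
by right; split=> // y w hy; apply/SR'/S0.
Qed.

End Maximal.

Lemma roots_finite (L : fieldType) (p : {poly L}) : p != 0 ->
  exists l : seq L, forall c, root p c -> c \in l.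
Proof.
move: {2}(size p) (leqnn (size p)) => n; elim: n p => [p|n IH p sp p0].
  by rewrite leqn0 size_poly_eq0 => ->.
case: (pselect (exists c, root p c)) => [[c]|nr]; last first.
  by exists [::] => c pc; case: nr; exists c.
move=> /factor_theorem[q eq]; have q0 : q != 0.
  by apply: contra_neq p0 => q0; rewrite eq q0 mul0r.
have [|l hl] := IH q _ q0.
  by move: sp; rewrite eq size_Mmonic ?monicXsubC // size_XsubC addn2.
exists (c :: l) => e; rewrite eq rootM root_XsubC inE orbC.
by case/orP => [->//|/hl->]; rewrite orbT.
Qed.


(** * Fibers of rational maps *)

Section Points.
Variables (K L : fieldType) (iota : {rmorphism K -> L}) (f : ratmap K).
Local Notation num := (map_poly iota (rnum f)).
Local Notation den := (map_poly iota (rden f)).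
Local Notation D := (rdeg f).
Local Notation reval := (reval iota f).

Lemma rdeg_gt0 : (0 < D)%N.
Proof. by rewrite /rdeg -subn1 subn_gt0; exact: rnonconst. Qed.

Lemma size_num_le : (size num <= D.+1)%N.
Proof.
rewrite size_map_poly /rdeg prednK ?leq_maxl //.
exact: (ltn_trans _ (rnonconst f)).
Qed.

Lemma size_den_le : (size den <= D.+1)%N.
Proof.
rewrite size_map_poly /rdeg prednK ?leq_maxr //.
exact: (ltn_trans _ (rnonconst f)).
Qed.

Lemma num_den_coprime : coprimep num den.
Proof. by rewrite coprimep_map; exact: rcoprime. Qed.

Lemma num_den_neq0 x : num.[x] = 0 -> den.[x] != 0.
Proof. by move=> h; apply: (coprimep_root num_den_coprime); apply/rootP. Qed.

Lemma num_den_lead : (num`_D != 0) || (den`_D != 0).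
Proof.
rewrite -negb_and; apply/negP => /andP[/eqP n0 /eqP d0].
have aux (p : {poly L}) : (size p <= D.+1)%N -> p`_D = 0 -> (size p <= D)%N.
  move=> sp p0; apply/leq_sizeP => j; rewrite leq_eqVlt => /predU1P[<-//|].
  by move=> h; rewrite nth_default // (leq_trans sp).
have := aux _ size_num_le n0; have := aux _ size_den_le d0.
rewrite !size_map_poly => h1 h2.
have : (maxn (size (rnum f)) (size (rden f)) <= D)%N by rewrite geq_max h1 h2.
by rewrite /rdeg leqNgt ltn_predL (ltn_trans _ (rnonconst f)).
Qed.

(* The form whose zeros on the projective line are the preimages of y, in the
   affine coordinate; its coefficient of degree [rdeg f] is its value at
   infinity. *)
Definition fiber_poly (y : option L) : {poly L} :=
  if y is Some c then num - c *: den else den.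

Lemma size_fiber y : (size (fiber_poly y) <= D.+1)%N.
Proof.
case: y => [c|] /=; last exact: size_den_le.
rewrite (leq_trans (size_polyD _ _)) // geq_max size_num_le size_polyN.
by rewrite (leq_trans (size_scale_leq _ _)) // size_den_le.
Qed.

(** Otherwise numerator and denominator would be proportional, hence constant, being coprime. *)
Lemma fiber_neq0 y : fiber_poly y != 0.
Proof.
have cop := num_den_coprime; have szlt := rnonconst f.
case: y => [c|] /=; apply/eqP.
  move/eqP; rewrite subr_eq0 => /eqP e; have szd : size den == 1%N.
    by have := cop; rewrite e /coprimep; have /eqp_size-> : gcdp (c *: den) den %= den
      by apply: dvdp_gcd_idr; rewrite -mul_polyC dvdp_mulIr.
  have : (size num <= 1)%N by rewrite e (leq_trans (size_scale_leq _ _)) // (eqP szd).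
  move: szd szlt; rewrite !size_map_poly ltnNge geq_max => /eqP -> /negP h1 h2.
  by apply: h1; rewrite h2.
move=> e; have := cop; rewrite e coprimep0.
move=> /eqp_size; rewrite size_poly1 => szn.
move: szlt; rewrite ltnNge geq_max => /negP[].
by move: szn e; rewrite size_map_poly => -> /eqP; rewrite map_poly_eq0 => /eqP->;
  rewrite size_poly0.
Qed.

Lemma reval_fiber x y : reval (Some x) = y <-> root (fiber_poly y) x.
Proof.
rewrite /= /ratdiv; case: eqP => [d0|/eqP d0].
  case: y => [c|] /=; last by split=> // _; apply/rootP.
  split=> // /rootP; rewrite !hornerE d0 mulr0 subr0 => /num_den_neq0.
  by rewrite d0 eqxx.
case: y => [c|] /=; last by split=> // /rootP e; rewrite e eqxx in d0.
split=> [[<-]|/rootP].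
  by apply/rootP; rewrite !hornerE divfK // subrr.
by rewrite !hornerE => /eqP; rewrite subr_eq0 => /eqP->; rewrite mulfK.
Qed.

Lemma reval_fiber_inf y : reval None = y <-> (fiber_poly y)`_D = 0.
Proof.
have n0 := num_den_lead; rewrite /= /ratdiv.
have -> : iota (rnum f)`_D = num`_D by rewrite coef_map.
have -> : iota (rden f)`_D = den`_D by rewrite coef_map.
case: eqP => [d0|/eqP d0].
  case: y => [c|] /=; last by rewrite d0.
  split=> //; rewrite coefB coefZ d0 mulr0 subr0 => e.
  by rewrite e d0 eqxx in n0.
case: y => [c|] /=; last by split=> // /eqP; rewrite (negPf d0).
rewrite coefB coefZ; split=> [[<-]|]; first by rewrite divfK // subrr.
by move=> /eqP; rewrite subr_eq0 => /eqP->; rewrite mulfK.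
Qed.

(* The form F in the coordinate z = 1/(x - c). *)
Definition chart_poly (F : {poly L}) (c : L) : {poly L} :=
  \sum_(i < D.+1) F`_i *: ('X^(D - i) * (c *: 'X + 1) ^+ i).

Definition chart (c : L) (p : option L) : L :=
  if p is Some x then (x - c)^-1 else 0.

Lemma chart_polyZ e F c : chart_poly (e *: F) c = e *: chart_poly F c.
Proof.
by rewrite scaler_sumr; apply: eq_bigr => i _; rewrite coefZ scalerA.
Qed.

Lemma size_chart F c : (size (chart_poly F c) <= D.+1)%N.
Proof.
apply: (leq_trans (size_sum _ _ _)); apply/bigmax_leqP => i _.
apply: (leq_trans (size_scale_leq _ _)).
apply: (leq_trans (size_polyMleq _ _)); rewrite size_polyXn addSn /=.
have h : (size (c *: 'X + 1 : {poly L})%R <= 2)%N.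
  rewrite (leq_trans (size_polyD _ _)) // size_poly1 geq_max andbT.
  by rewrite (leq_trans (size_scale_leq _ _)) // size_polyX.
have : (size ((c *: 'X + 1) ^+ i : {poly L})%R <= i.+1)%N.
  apply: (leq_trans (size_poly_exp_leq _ _)); rewrite ltnS.
  by case: (size _) h => [|[|[]]] //= _; rewrite ?mul0n ?mul1n.
by move=> hs; rewrite -[X in (_ <= X.+1)%N](subnK (ltn_ord i : (i <= D)%N)) -addnS leq_add2l.
Qed.

(** The point [z = oo] of the chart is [x = c]. So the degree is exactly [rdeg f] when [c] is not a
    zero of the form. *)
Lemma chart_lead (F : {poly L}) c : (size F <= D.+1)%N -> (chart_poly F c)`_D = F.[c].
Proof.
move=> sF; rewrite coef_sum (horner_coef_wide _ sF); apply: eq_bigr => i _.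
rewrite coefZ coefXnM ltnNge leq_subr /= subKn; last by rewrite -ltnS.
congr (_ * _).
have -> : c *: 'X + 1 = \poly_(j < 2) (if j == 0%N then 1 else c) :> {poly L}.
  apply/polyP => j; rewrite coef_poly coefD coefZ coefX coef1.
  by case: j => [|[|j]] /=; rewrite ?mulr0 ?mulr1 ?add0r ?addr0.
elim: (i : nat) => [|n IH]; first by rewrite !expr0 coef1.
have szn : (size ((\poly_(j < 2) (if j == 0%N then 1 else c)) ^+ n : {poly L})%R <= n.+1)%N.
  apply: (leq_trans (size_poly_exp_leq _ _)); rewrite ltnS.
  have := size_poly 2 (fun j => if j == 0%N then 1 else c : L).
  by case: (size _) => [|[|[]]] //= _; rewrite ?mul0n ?mul1n.
rewrite !exprSr coefMr 2!big_ord_recl /= !coef_poly /= subn0.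
rewrite [X in X * _ + _]nth_default // mul0r add0r subSS subn0 IH.
by rewrite big1 ?addr0 // => j _; rewrite coef_poly /= mulr0.
Qed.

Lemma chart_horner (F : {poly L}) c x : (size F <= D.+1)%N -> x != c ->
  (chart_poly F c).[(x - c)^-1] = (x - c)^-1 ^+ D * F.[x].
Proof.
move=> sF xc; set z := _^-1; have z0 : z != 0 by rewrite invr_eq0 subr_eq0.
rewrite horner_sum (horner_coef_wide _ sF) mulr_sumr; apply: eq_bigr => i _.
rewrite hornerZ hornerM hornerXn horner_exp hornerD hornerZ hornerX hornerC.
have -> : c * z + 1 = x * z.
  have xz : (x - c) * z = 1 by rewrite /z divff // subr_eq0.
  by rewrite -[in RHS](subrK c x) mulrDl xz addrC.
rewrite exprMn [RHS]mulrCA; congr (_ * _).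
by rewrite mulrCA -exprD subnK 1?mulrC // -ltnS.
Qed.

Lemma chart_horner0 F c : (chart_poly F c).[0] = F`_D.
Proof.
rewrite horner_sum big_ord_recr /= big1 ?add0r => [|i _].
  rewrite subnn expr0 mul1r hornerZ horner_exp hornerD hornerZ hornerX hornerC.
  by rewrite mulr0 add0r expr1n mulr1.
by rewrite hornerZ hornerM hornerXn expr0n subn_eq0 leqNgt ltn_ord mul0r mulr0.
Qed.

Lemma root_chart y c p : (fiber_poly y).[c] != 0 -> reval p = y ->
  root (chart_poly (fiber_poly y) c) (chart c p).
Proof.
move=> yc; case: p => [x|] h; last first.
  by rewrite rootE chart_horner0; apply/eqP/reval_fiber_inf.
have /rootP Fx : root (fiber_poly y) x by apply/reval_fiber.
have xc : x != c by apply: contra_neq yc => <-.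
by rewrite rootE chart_horner ?size_fiber // Fx mulr0.
Qed.

Lemma chart_inj y c p q : (fiber_poly y).[c] != 0 -> reval p = y ->
  reval q = y -> chart c p = chart c q -> p = q.
Proof.
move=> yc hp hq.
have aux x : reval (Some x) = y -> (x - c) != 0.
  move=> h; rewrite subr_eq0; apply: contra_neq yc => <-.
  by apply/rootP/reval_fiber.
case: p q hp hq => [x|] [w|] hp hq //= e.
- by have /addIr-> := invr_inj e.
- by have := aux _ hp; rewrite -invr_eq0 e eqxx.
- by have := aux _ hq; rewrite -invr_eq0 -e eqxx.
Qed.

Lemma chart_poly_neq0 y c : (fiber_poly y).[c] != 0 ->
  size (chart_poly (fiber_poly y) c) = D.+1.
Proof.
move=> yc; apply/eqP; rewrite eqn_leq size_chart ltnNge.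
by apply: contra yc => /(nth_default 0); rewrite chart_lead ?size_fiber // => ->.
Qed.

(** In a chart centred off the fiber all its points, infinity included, are finite roots of one
    polynomial of degree [rdeg f]. *)
Lemma fiber_card y c (rs : seq (option L)) : (fiber_poly y).[c] != 0 ->
  uniq rs -> {in rs, forall r, reval r = y} -> (size rs <= D)%N.
Proof.
move=> yc urs hrs; rewrite -ltnS -(chart_poly_neq0 yc) -(size_map (chart c)).
apply: max_poly_roots.
- by rewrite -size_poly_eq0 chart_poly_neq0.
- by apply/allP => _ /mapP[r rrs ->]; apply: root_chart => //; exact: hrs.
- rewrite map_inj_in_uniq // => p q hp hq.
  by apply: (chart_inj yc); exact: hrs.
Qed.

(** This asks both that the fiber has no multiple point and that all its points are rational over
    [L]. *)
Definition unramified_over (y : option L) : Prop :=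
  exists rs, [/\ uniq rs, size rs = D & {in rs, forall r, reval r = y}].

Lemma chart_split y c rs : (fiber_poly y).[c] != 0 ->
    uniq rs -> size rs = D -> {in rs, forall r, reval r = y} ->
  (fiber_poly y).[c]^-1 *: chart_poly (fiber_poly y) c =
    \prod_(z <- map (chart c) rs) ('X - z%:P).
Proof.
move=> yc urs srs hrs; set G := chart_poly _ _.
have lG : lead_coef G = (fiber_poly y).[c].
  by rewrite lead_coefE chart_poly_neq0 // chart_lead // size_fiber.
rewrite {1}(@all_roots_prod_XsubC _ G (map (chart c) rs)) ?lG ?scalerK //.
- by rewrite chart_poly_neq0 // size_map srs.
- by apply/allP => _ /mapP[r rrs ->]; apply: root_chart => //; exact: hrs.
- rewrite uniq_rootsE map_inj_in_uniq // => p q hp hq.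
  by apply: (chart_inj yc); exact: hrs.
Qed.

End Points.

(** Reduction of points of the projective line. Unlike [R] it is defined at every point with
    coordinate in the domain of the place. *)
Definition point_rel (L1 L2 : fieldType) (R : L1 -> L2 -> Prop)
    (p : option L1) (q : option L2) : Prop :=
  match p, q with
  | Some x, Some u => R x u
  | Some x, None => x != 0 /\ R x^-1 0
  | None, None => True
  | None, Some _ => False
  end.

Section PointRel.
Variables (L1 L2 : fieldType) (A : subfld L1) (R : L1 -> L2 -> Prop).
Hypothesis PR : pgraph A R.
Let RR := pg_ring PR.

Lemma point_rel_fun p q q' : point_rel R p q -> point_rel R p q' -> q = q'.
Proof.
have aux x u : R x u -> x != 0 -> R x^-1 0 -> False.
  move=> h x0 k; have := ringrelM RR h k; rewrite mulfV // mulr0.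
  by move/(pg_fun PR (ringrel1 RR))/eqP; rewrite oner_eq0.
case: p => [x|]; case: q q' => [u|] [w|] //=.
- by move=> /(pg_fun PR) h /h ->.
- by move=> h [x0 k]; case: (aux _ _ h x0 k).
- by move=> [x0 k] h; case: (aux _ _ h x0 k).
Qed.

Lemma point_rel_ex p : (forall x, p = Some x -> x \in A) ->
  exists q, point_rel R p q.
Proof.
case: p => [x|] h; last by exists None.
have [->|x0] := eqVneq x 0; first by exists (Some 0); exact: ringrel0.
case: (pg_val PR (h _ erefl)) => [[u hu]|hx]; first by exists (Some u).
by exists None.
Qed.

(** Reduction in homogeneous coordinates, which must not both reduce to 0. *)
Lemma ratdiv_rel n1 n2 d1 d2 : R n1 n2 -> R d1 d2 -> (n2 != 0) || (d2 != 0) ->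
  point_rel R (ratdiv n1 d1) (ratdiv n2 d2).
Proof.
move=> hn hd; rewrite /ratdiv; have [d20|d20] := eqVneq d2 0.
  rewrite orbF => n20; have n10 := pg_neq0 PR hn n20.
  have [//|d10] := eqVneq d1 0; split; first by rewrite mulf_neq0 ?invr_eq0.
  rewrite invf_div -(mul0r n2^-1); apply: (ringrelM RR); first by rewrite -d20.
  exact: (pg_inv PR).
move=> _; rewrite (negPf (pg_neq0 PR hd d20)) /=.
by apply: (ringrelM RR) => //; exact: (pg_inv PR).
Qed.

Section Maps.
Variables (K : fieldType) (iota1 : {rmorphism K -> L1})
  (iota2 : {rmorphism K -> L2}) (f : ratmap K).
Hypothesis RK : forall c, R (iota1 c) (iota2 c).
Local Notation D := (rdeg f).

Lemma map_poly_rel (p : {poly K}) :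
  polyrel R (map_poly iota1 p) (map_poly iota2 p).
Proof. by move=> i; rewrite !coef_map; exact: RK. Qed.

Lemma chart_rel F Fb c d : polyrel R F Fb -> R c d ->
  polyrel R (chart_poly f F c) (chart_poly f Fb d).
Proof.
move=> hF hc; have PP := polyrel_ring RR; apply: (ringrel_sum PP) => i _.
apply: (polyrelZ RR) => //; apply: (ringrelM PP).
  by apply: (ringrelX PP); exact: polyrelX.
apply: (ringrelX PP); apply: (ringrelD PP); last exact: (ringrel1 PP).
by apply: (polyrelZ RR) => //; exact: polyrelX.
Qed.

(** The map has good reduction: its coefficients are constants, so numerator and denominator have no
    common zero after reduction. *)
Lemma reval_rel p q : point_rel R p q ->
  point_rel R (reval iota1 f p) (reval iota2 f q).
Proof.
(* At a point reducing to infinity both forms are divided by [x ^+ D]; in the chart at 0 they then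
   reduce to their coefficients of degree [D]. *)
have aux (P : {poly K}) (x : L1) : (size P <= D.+1)%N -> x != 0 ->
    R x^-1 0 -> R ((x ^+ D)^-1 * (map_poly iota1 P).[x]) (iota2 P`_D).
  move=> sP x0 hx.
  have := polyrel_horner RR (chart_rel (map_poly_rel P) (ringrel0 RR)) hx.
  rewrite chart_horner0 coef_map; congr R.
  have -> : x^-1 = (x - 0)^-1 by rewrite subr0.
  by rewrite chart_horner ?subr0 ?size_map_poly // exprVn.
have le1 : (size (rnum f) <= D.+1)%N by rewrite -(size_map_poly iota1) size_num_le.
have le2 : (size (rden f) <= D.+1)%N by rewrite -(size_map_poly iota1) size_den_le.
have lead : (iota2 (rnum f)`_D != 0) || (iota2 (rden f)`_D != 0).
  by have := num_den_lead iota2 f; rewrite !coef_map.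
case: p q => [x|] [u|] //= h; last by apply: ratdiv_rel.
  apply: ratdiv_rel.
  - by apply: (polyrel_horner RR) => //; exact: map_poly_rel.
  - by apply: (polyrel_horner RR) => //; exact: map_poly_rel.
  - by rewrite -negb_and; apply/negP => /andP[/eqP/num_den_neq0 /negPf->].
case: h => x0 hx; have xD : (x ^+ D)^-1 != 0 by rewrite invr_eq0 expf_neq0.
have -> : ratdiv (map_poly iota1 (rnum f)).[x] (map_poly iota1 (rden f)).[x] =
    ratdiv ((x ^+ D)^-1 * (map_poly iota1 (rnum f)).[x])
      ((x ^+ D)^-1 * (map_poly iota1 (rden f)).[x]).
  rewrite /ratdiv mulf_eq0 (negPf xD) /=; case: eqP => // d0.
  by rewrite -mulf_div divff // mul1r.
by apply: ratdiv_rel => //; apply: aux.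
Qed.

Lemma iter_point_rel n p q : point_rel R p q ->
  point_rel R (iter n (reval iota1 f) p) (iter n (reval iota2 f) q).
Proof. by move=> h; elim: n => //= n IH; exact: reval_rel. Qed.

(** If [y = c] reduces to infinity, its form has a coefficient with a pole; the multiple by [- c^-1]
    is integral and reduces to the denominator. *)
Lemma fiber_rel y q : point_rel R y q -> exists F e,
  [/\ polyrel R F (fiber_poly iota2 f q), e != 0 &
    F = e *: fiber_poly iota1 f y].
Proof.
have PP := polyrel_ring RR.
case: y q => [c|] [u|] //= h.
- exists (map_poly iota1 (rnum f) - c *: map_poly iota1 (rden f)), 1.
  rewrite scale1r oner_eq0; split=> //; apply: (ringrelB PP).
    exact: map_poly_rel.
  by apply: (polyrelZ RR) => //; exact: map_poly_rel.
- case: h => c0 hc.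
  exists (map_poly iota1 (rden f) - c^-1 *: map_poly iota1 (rnum f)), (- c^-1).
  split; last 2 first.
  + by rewrite oppr_eq0 invr_eq0.
  + by rewrite scalerBr !scaleNr opprK scalerA mulVf // scale1r addrC.
  rewrite -[X in polyrel R _ X]subr0 -(scale0r (map_poly iota2 (rnum f))).
  apply: (ringrelB PP); first exact: map_poly_rel.
  by apply: (polyrelZ RR) => //; exact: map_poly_rel.
- exists (map_poly iota1 (rden f)), 1; rewrite scale1r oner_eq0; split=> //.
  exact: map_poly_rel.
Qed.

Lemma chart_point_rel c d p q : R c d -> q != Some d -> point_rel R p q ->
  R (chart c p) (chart d q).
Proof.
move=> hc; case: p q => [x|] [u|] //= ud h; last exact: ringrel0.
  apply: (pg_inv PR); first exact: (ringrelB RR).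
  by rewrite subr_eq0; apply: contra ud => /eqP->.
case: h => x0 hx.
have h1 : R (1 - c * x^-1) 1.
  rewrite -[X in R _ X]subr0 -(mulr0 d).
  by apply: (ringrelB RR); [exact: (ringrel1 RR)|exact: (ringrelM RR)].
have -> : (x - c)^-1 = x^-1 * (1 - c * x^-1)^-1.
  by rewrite -invfM mulrBr mulr1 mulrCA divff // mulr1.
rewrite -(mul0r (1^-1 : L2)); apply: (ringrelM RR) => //; apply: (pg_inv PR) => //.
exact: oner_neq0.
Qed.

(** Making the chart polynomials monic removes the unknown scalar of [fiber_rel]. *)
Lemma fiber_chart_rel y q c d : point_rel R y q -> R c d ->
  (fiber_poly iota2 f q).[d] != 0 ->
  (fiber_poly iota1 f y).[c] != 0 /\
  polyrel R
    ((fiber_poly iota1 f y).[c]^-1 *: chart_poly f (fiber_poly iota1 f y) c)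
    ((fiber_poly iota2 f q).[d]^-1 *: chart_poly f (fiber_poly iota2 f q) d).
Proof.
move=> hyq hc qd; have [F [e [hF e0 eF]]] := fiber_rel hyq.
have hFc := polyrel_horner RR hF hc.
have := pg_neq0 PR hFc qd; rewrite eF hornerZ mulf_eq0 negb_or => /andP[_ yc].
split=> //.
have -> : (fiber_poly iota1 f y).[c]^-1 *: chart_poly f (fiber_poly iota1 f y) c =
    F.[c]^-1 *: chart_poly f F c.
  by rewrite eF chart_polyZ hornerZ scalerA invfM mulrAC mulVf // mul1r.
apply: (polyrelZ RR); first exact: (pg_inv PR).
exact: chart_rel.
Qed.

Lemma fiber_chart_monic y c : (fiber_poly iota1 f y).[c] != 0 ->
  (fiber_poly iota1 f y).[c]^-1 *: chart_poly f (fiber_poly iota1 f y) c \is monic.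
Proof.
move=> yc; rewrite monicE lead_coefZ lead_coefE chart_poly_neq0 //.
by rewrite chart_lead ?size_fiber // mulVf.
Qed.

(** Two points with the same reduction give two linear factors of the chart polynomial with the same
    reduction; by Gauss's lemma the reduced polynomial has a square factor, though its roots are
    distinct. *)
Lemma reduction_inj y q c d p1 p2 q' : point_rel R y q -> R c d ->
    (fiber_poly iota2 f q).[d] != 0 -> unramified_over iota2 f q ->
    (forall x, p1 = Some x -> x \in A) -> (forall x, p2 = Some x -> x \in A) ->
    reval iota1 f p1 = y -> reval iota1 f p2 = y ->
    point_rel R p1 q' -> point_rel R p2 q' ->
  p1 = p2.
Proof.
move=> hyq hc qd [rs [urs srs hrs]] A1 A2 e1 e2 h1 h2.
have [yc hP] := fiber_chart_rel hyq hc qd.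
have Pm := fiber_chart_monic yc.
have e' : reval iota2 f q' = q.
  by apply: point_rel_fun hyq; rewrite -e1; exact: reval_rel.
have q'd : q' != Some d.
  by apply: contra_neq qd => e; apply/rootP/reval_fiber; rewrite -e.
have w1 := chart_point_rel hc q'd h1; have w2 := chart_point_rel hc q'd h2.
have r1 := root_chart yc e1; have r2 := root_chart yc e2.
apply: (chart_inj yc e1 e2); apply/eqP/negPn/negP => z12.
set P := _ *: _ in hP Pm; set z1 := chart c p1 in z12 r1 w1 *.
set z2 := chart c p2 in z12 r2 w2 *; set w := chart d q' in w1 w2.
have /factor_theorem[H eH] : root P z1 by rewrite rootE hornerZ (rootP r1) mulr0.
have : root P z2 by rewrite rootE hornerZ (rootP r2) mulr0.
rewrite eH rootM root_XsubC eq_sym (negPf z12) orbF => /factor_theorem[H' eH'].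
have PE : P = H' * (('X - z2%:P) * ('X - z1%:P)) by rewrite eH eH' mulrA.
have mq : ('X - z2%:P) * ('X - z1%:P) \is monic by rewrite monicMl ?monicXsubC.
have H'm : H' \is monic by rewrite -(monicMr _ mq) -PE.
have z1A : z1 \in A by exact: pg_dom w1.
have z2A : z2 \in A by exact: pg_dom w2.
have qE : pover A (('X - z2%:P) * ('X - z1%:P)) by apply: poverM; apply: poverXsubC.
have H'E : pover A H'.
  have -> : H' = P %/ (('X - z2%:P) * ('X - z1%:P)) by rewrite PE mulpK // monic_neq0.
  by apply: pover_divp => //; exact: (pg_pover PR hP).
have [Hb [qb [hHb hqb ePb]]] := pg_Gauss PR H'm mq H'E qE PE hP.
have eqb : qb = ('X - w%:P) * ('X - w%:P).
  apply: (pg_polyfun PR hqb); apply: (ringrelM (polyrel_ring RR));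
    exact: polyrelXsubC.
have : separable_poly (Hb * qb).
  rewrite -ePb (chart_split qd urs srs hrs) separable_prod_XsubC.
  rewrite map_inj_in_uniq // => p p' hp hp'.
  by apply: (chart_inj qd); exact: hrs.
rewrite eqb mulrA separable_root => /andP[_].
by rewrite rootM root_XsubC eqxx orbT.
Qed.

End Maps.
End PointRel.

(** * Extension of a place along the tree *)

Section TreeExtension.
Variables (K Om : fieldType) (iota : {rmorphism K -> Om}) (f : ratmap K).
Variables (s : Om) (A1 A2 k : subfld Om) (b b' : Om).
Hypotheses (kinf : forall l : seq Om, exists2 c, c \in k & c \notin l)
  (iotak : forall c, iota c \in k)
  (kA1 : forall c, c \in k -> c \in A1) (kA2 : forall c, c \in k -> c \in A2)
  (tree1 : forall x, backward_orbit iota f b x -> x \in A1)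
  (tree2 : forall x, backward_orbit iota f b' x -> x \in A2)
  (unr : forall n q, iter n (reval iota f) q = Some b' ->
    unramified_over iota f q).
Local Notation reval := (reval iota f).

Lemma chart_exists y : exists2 c, c \in k & (fiber_poly iota f y).[c] != 0.
Proof.
have [l hl] := roots_finite (fiber_neq0 iota f y).
by have [c ck cl] := kinf l; exists c => //; apply: contra cl => /hl.
Qed.

(** The induction is on the level. Once the image of a point reduces to [q], the monic chart
    polynomial of the fiber through the point is integral, and by [unr] its reduction is a product
    of distinct linear factors. So a missing point satisfies the hypotheses of the extension
    step. *)
Theorem tree_extension R0 : dgraph s R0 -> (forall c, c \in k -> R0 c c) ->
    R0 b b' -> (forall x u, R0 x u -> x \in A1 /\ u \in A2) ->
  exists R (DR : dgraph s R), [/\ forall x u, R0 x u -> R x u,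
    forall x u, R x u -> x \in A1 /\ u \in A2 &
    forall n p, iter n reval p = Some b ->
      exists q, point_rel R p q /\ iter n reval q = Some b'].
Proof.
move=> D0 R0k R0b R0A.
have [R [DR R0R RA maxR]] := dgraph_max D0 R0A.
exists R, DR; split=> // n.
have RR := dg_ring DR; have PR := dg_pgraph DR.
have RK c : R (iota c) (iota c) by apply/R0R/R0k/iotak.
have EA x : x \in frac_subfld DR -> x \in A1.
  case/frac_predP => y [u [z [w [/RA[yA _] /RA[zA _] _ ->]]]].
  exact: subfld_div.
elim: n => [|n IH] p; first by move=> /= ->; exists (Some b'); split=> //; exact: R0R.
have [->{p}|[x ->{p}]] : p = None \/ exists x, p = Some x by case: p => [x|]; [right; exists x|left].
  rewrite iterSr => /IH[q [hq eq]]; exists None; split=> //.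
  rewrite iterSr; suff -> : reval None = q by [].
  by apply: (point_rel_fun PR) hq; exact: (reval_rel PR f RK (p := None) (q := None)).
move=> ex; have := ex; rewrite iterSr => /IH[q [hq eq]].
(* Membership in the domain suffices: a reduction then exists, and [reval_rel] places it over
   [q]. *)
suff xE : x \in frac_subfld DR.
  have [|q' hq'] := @point_rel_ex _ _ _ _ PR (Some x); first by move=> _ [<-].
  exists q'; split=> //; rewrite iterSr; suff -> : reval q' = q by [].
  by apply: (point_rel_fun PR) hq; exact: (reval_rel PR f RK).
have [c ck qc] := chart_exists q.
have hc : R c c by apply/R0R/R0k.
have [yc hP] := fiber_chart_rel PR RK hq hc qc.
have Pm := fiber_chart_monic yc; have rx := root_chart yc (erefl (reval (Some x))).
set P := _ *: _ in hP Pm.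
have xA : x \in A1 by apply: tree1; exists n.+1.
pose z := (x - c)^-1; have zA : z \in A1.
  by apply: subfldV; apply: subfldB => //; exact: kA1.
have Pz : root P z by rewrite rootE hornerZ (rootP rx) mulr0.
have [p [pm pE pz pmin]] : exists p, [/\ p \is monic, pover (frac_subfld DR) p,
    root p z & forall q, pover (frac_subfld DR) q -> root q z -> p %| q].
  by apply: minpoly_ex; exists P; split; [exact: monic_neq0|exact: (pg_pover PR hP)|].
have /divpK eP := pmin _ (pg_pover PR hP) Pz.
have qm : P %/ p \is monic by rewrite -(monicMr _ pm) eP.
have qE : pover (frac_subfld DR) (P %/ p).
  by apply: pover_divp => //; exact: (pg_pover PR hP).
(* The minimal polynomial of [z] divides the integral polynomial [P], hence is integral as well. *)
have [qb [pb [_ hpb ePb]]] := pg_Gauss PR qm pm qE pE (esym eP) hP.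
have [rs [urs srs hrs]] := unr eq.
have usep : uniq (map (chart c) rs).
  rewrite map_inj_in_uniq // => r r' hr hr'.
  by apply: (chart_inj qc); exact: hrs.
rewrite (chart_split qc urs srs hrs) in ePb.
have pbdvd : pb %| \prod_(z <- map (chart c) rs) ('X - z%:P) by rewrite ePb dvdp_mulIr.
have [pbm szpb] := pg_monic PR pm hpb.
have [m /eqp_root rpb] := dvdp_prod_XsubC pbdvd.
(* Any root of the reduced minimal polynomial will do; it is simple because the points over [q] are
   distinct. *)
have [z0 rz0] : exists z0, root pb z0.
  have /dvdp_prod_XsubC[m' em'] := pbdvd.
  have sz : (1 < size pb)%N.
    by rewrite szpb; apply: root_size_gt1 pz; exact: monic_neq0.
  have := sz; rewrite (eqp_size em') size_prod_XsubC ltnS.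
  case: (mask _ _) em' => [//|z0 l] em' _; exists z0.
  by rewrite (eqp_root em') root_prod_XsubC inE eqxx.
have : root (\prod_(z <- map (chart c) rs) ('X - z%:P)) z0.
  by rewrite ePb rootM rz0 orbT.
rewrite root_prod_XsubC => /mapP[r rrs ez0].
have z0A : z0 \in A2.
  have cA := kA2 ck; rewrite ez0; case: r rrs {ez0} => [u|] ur /=; last exact: subfld0.
  apply: subfldV; apply: subfldB => //; apply: tree2; exists n.+1.
  by rewrite iterSr (hrs _ ur).
have spb : separable_poly pb.
  by apply: (dvdp_separable pbdvd); rewrite separable_prod_XsubC.
have rpb' : ~~ root pb^`() z0.
  by apply: (@coprimep_root _ pb) rz0; move: spb; rewrite unlock.
have D' := ext_dgraph pm hpb pz pmin rz0 rpb'.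
(* The extended graph still lies between [A1] and [A2], so maximality puts it inside [R]. *)
have hz : R z z0.
  apply: (maxR _ D') => [y u|y u|]; [exact: (ext_sub DR)| |exact: (ext_gen DR)].
  case=> g [gb [h [hb [hg hh _ -> ->]]]].
  have aux (g1 g2 : {poly Om}) : polyrel R g1 g2 -> pover A1 g1 /\ pover A2 g2.
    by move=> hh'; split=> i; have [] := RA _ _ (hh' i).
  have [gA1 gA2] := aux _ _ hg; have [hA1 hA2] := aux _ _ hh.
  by split; apply: subfld_div; exact: pover_horner.
have -> : x = c + z^-1 by rewrite invrK addrC subrK.
by apply: subfldD; [exact: mem_frac hc|apply: subfldV; exact: mem_frac hz].
Qed.

End TreeExtension.

Section GalMorphism.
Variables (L : fieldType) (F : {pred L}) (s : gal F).

Lemma gal_zmod_morphism : zmod_morphism (gal_fun s).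
Proof. by have [] := gal_autP s. Qed.

Lemma gal_monoid_morphism : monoid_morphism (gal_fun s).
Proof. by have [] := gal_autP s. Qed.

HB.instance Definition _ :=
  GRing.isZmodMorphism.Build L L (gal_fun s) gal_zmod_morphism.
HB.instance Definition _ :=
  GRing.isMonoidMorphism.Build L L (gal_fun s) gal_monoid_morphism.

Lemma gal_fix x : x \in F -> s x = x.
Proof. by have [_ _ _] := gal_autP s; apply. Qed.

End GalMorphism.

(** * Galois groups and residue automorphisms *)

Section AbstractGalois.
Variables (L : fieldType) (F : {pred L}).
Local Notation G := (gal F).
Implicit Types (s r : G) (x y : L).

Lemma galM s r x : (s * r)%g x = s (r x). Proof. by []. Qed.
Lemma gal1 x : (1%g : G) x = x. Proof. by []. Qed.
Lemma galK s x : (s^-1)%g (s x) = x. Proof. exact: gal_funK. Qed.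
Lemma galVK s x : s ((s^-1)%g x) = x. Proof. exact: gal_inv_funK. Qed.

Lemma gal_ext s r : (forall x, s x = r x) -> s = r.
Proof. by move=> h; apply/val_inj/funext. Qed.

Lemma gal_mulVK s r : (s * (s^-1 * r))%g = r.
Proof. by apply: gal_ext => x; exact: galVK. Qed.

Hypothesis finorb : forall x, exists O : seq L, forall s, s x \in O.

Section Orbits.
Variables (T : eqType) (act : G -> T -> T).
Hypotheses (actM : forall s r (x : T), act (s * r)%g x = act s (act r x))
  (act1 : forall x : T, act 1%g x = x).

Lemma orbit_enum (x : T) (B : seq T) : (forall s, act s x \in B) ->
  exists O : seq T, uniq O /\ forall y : T, y \in O <-> exists s, y = act s x.
Proof.
move=> hB; exists (undup [seq y <- B | `[< exists s, y = act s x >]]); split.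
  exact: undup_uniq.
move=> y; rewrite mem_undup mem_filter; split=> [/andP[/asboolP//]|[s ey]].
by apply/andP; split; [apply/asboolP; exists s|rewrite ey].
Qed.

Lemma orbit_perm (x : T) (O : seq T) s : uniq O ->
  (forall y : T, y \in O <-> exists s, y = act s x) -> perm_eq (map (act s) O) O.
Proof.
have sK (y : T) : act s (act (s^-1)%g y) = y.
  by rewrite -actM -[RHS]act1; congr act; apply: gal_ext => z; exact: galVK.
have Ks (y : T) : act (s^-1)%g (act s y) = y.
  by rewrite -actM -[RHS]act1; congr act; apply: gal_ext => z; exact: galK.
move=> uO hO; apply: uniq_perm => //; first by rewrite map_inj_uniq //; exact: can_inj Ks.
move=> y; apply/mapP/idP => [[z /hO[r ->] ->]|/hO[r ey]].
  by apply/hO; exists (s * r)%g.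
by exists (act (s^-1)%g y) => //; apply/hO; exists (s^-1 * r)%g; rewrite ey actM.
Qed.

End Orbits.

Lemma orbit_list (Y : seq L) : exists O : seq (seq L),
  uniq O /\ forall Z, Z \in O <-> exists s, Z = map s Y.
Proof.
suff [B hB] : exists B : seq (seq L), forall s, map s Y \in B.
  exact: (orbit_enum (act := fun s => map s)) hB.
elim: Y => [|y Y [B hB]]; first by exists [:: [::]] => s; rewrite inE.
have [O hO] := finorb y.
exists [seq z :: Z | z <- O, Z <- B] => s /=.
by apply: allpairs_f; [exact: hO|exact: hB].
Qed.

Lemma orbit_list_map (Y : seq L) (O : seq (seq L)) s : uniq O ->
  (forall Z, Z \in O <-> exists s, Z = map s Y) -> perm_eq (map (map s) O) O.
Proof.
apply: (orbit_perm (act := fun s => map s)) => [s1 s2 Z|Z]; last exact: map_id.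
by rewrite -map_comp.
Qed.

Lemma orbit1 x : exists O : seq L, uniq O /\ forall y, y \in O <-> exists s, y = s x.
Proof. by have [B hB] := finorb x; exact: (orbit_enum (act := fun s => s)) hB. Qed.

Lemma orbit1_map x (O : seq L) s : uniq O ->
  (forall y, y \in O <-> exists s, y = s x) -> perm_eq (map s O) O.
Proof. exact: (orbit_perm (act := fun s => s)). Qed.

Lemma orbit_stable (X : seq L) : exists O : seq L,
  {subset X <= O} /\ forall s, {in O, forall y, s y \in O}.
Proof.
elim: X => [|x X [O [XO hO]]]; first by exists [::].
have [O' [_ hO']] := orbit1 x; exists (O' ++ O); split.
  move=> y; rewrite inE mem_cat => /predU1P[->|/XO->]; last by rewrite orbT.
  by apply/orP; left; apply/hO'; exists 1%g.
move=> s y; rewrite !mem_cat => /orP[/hO'[r ->]|/(hO s)->]; last by rewrite orbT.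
by apply/orP; left; apply/hO'; exists (s * r)%g.
Qed.

Section Residue.
Variables (k : fieldType) (R : L -> k -> Prop).
Hypothesis PR : pgraph (full_subfld L) R.
Let RR := pg_ring PR.

(* The elements integral at all conjugates of the place. *)
Definition gal_integral x := forall s, exists u, R (s x) u.

(** Scale the polynomial of the conjugates of [x] by a coefficient of least valuation to an
    invariant [C]. Its tails satisfy [b N x = C_N + x * b (N+1) x] and are integral at all
    conjugates. Since some coefficient of [C] is 1, not all tails have residue 0, and
    [x = (b N x - C_N) / b (N+1) x] for a suitable [N]. *)
Lemma gal_integral_frac x u : R x u -> exists y z w,
  [/\ gal_integral y, gal_integral z, R z w, w != 0 & x = y / z].
Proof.
move=> hx; have [O [uO hO]] := orbit1 x.
pose P : {poly L} := \prod_(y <- O) ('X - y%:P).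
have Pm : P \is monic by exact: monic_prod_XsubC.
have Pfix s : map_poly s P = P.
  rewrite rmorph_prod /= -[RHS](perm_big _ (orbit1_map s uO hO)) big_map.
  by apply: eq_bigr => y _; rewrite rmorphB /= map_polyX map_polyC.
have [||j [jP j0] hj] := @pg_norm _ _ _ _ PR P.
- by [].
- exists 1; last exact: oner_neq0.
  by rewrite -(monicP Pm) lead_coefE mem_nth // prednK // size_poly_gt0 monic_neq0.
have /(nthP 0)[i0 i0P ej] := jP.
pose C : {poly L} := j^-1 *: P.
have Cfix s i : s C`_i = C`_i.
  rewrite coefZ rmorphM fmorphV; congr (_^-1 * _); last by rewrite -coef_map Pfix.
  by rewrite -ej -coef_map Pfix.
have hC i : exists v, R C`_i v.
  rewrite coefZ mulrC; have [hi|hi] := ltnP i (size P).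
    by apply: hj; exact: mem_nth.
  by rewrite nth_default // mul0r; exists 0; exact: ringrel0.
have Cx s : C.[s x] = 0.
  rewrite hornerZ (rootP (_ : root P (s x))) ?mulr0 // root_prod_XsubC.
  by apply/hO; exists s.
pose b N y := (drop_poly N C).[y].
have bS N y : b N y = C`_N + y * b N.+1 y.
  rewrite /b; have -> : drop_poly N C = (C`_N)%:P + drop_poly N.+1 C * 'X.
    apply/polyP => i; rewrite coefD coefMX coefC !coef_drop_poly.
    by case: i => [|i] /=; rewrite ?addr0 // add0r addnS.
  by rewrite !hornerE mulrC.
have bfix s N : s (b N x) = b N (s x).
  rewrite /b -horner_map; congr (_.[_]); apply/polyP => i.
  by rewrite coef_map !coef_drop_poly; exact: Cfix.
have bint N : gal_integral (b N x).
  move=> s; rewrite bfix; have [v hv] := polyrel_liftr RR hC.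
  case: (pg_val PR (isT : s x \in full_subfld L)) => [[w hw]|hw].
    exists (drop_poly N v).[w]; apply: (polyrel_horner RR) => // i.
    by rewrite !coef_drop_poly.
  (* Here the inverse of [s x] has residue 0: go up from [b 0 (s x) = C.[s x] = 0], dividing by
     [s x]. *)
  elim: N => [|N [t ht]]; first by rewrite /b drop_poly0l Cx; exists 0; exact: ringrel0.
  have [sx0|sx0] := eqVneq (s x) 0.
    exists (drop_poly N.+1 v).[0]; rewrite sx0; apply: (polyrel_horner RR).
      by move=> i; rewrite !coef_drop_poly.
    exact: ringrel0.
  exists ((t - v`_N) * 0).
  have -> : b N.+1 (s x) = (b N (s x) - C`_N) * (s x)^-1.
    by rewrite (bS N) addrC addKr mulrC mulKf.
  by apply: (ringrelM RR) => //; exact: (ringrelB RR).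
have [N [w [hw w0]]] : exists N w, R (b N x) w /\ w != 0.
  apply: contrapT => H.
  have b0 N : R (b N x) 0.
    have [w hw] := bint N 1%g; rewrite gal1 in hw.
    by have [w0|w0] := eqVneq w 0; [rewrite -w0|case: H; exists N, w].
  have : R C`_i0 0.
    have -> : C`_i0 = b i0 x - x * b i0.+1 x by rewrite (bS i0) addrK.
    rewrite -[0](subrr 0) -{2}[0](mulr0 u); apply: (ringrelB RR) => //.
    exact: (ringrelM RR).
  rewrite coefZ ej mulVf // => /(pg_fun PR (ringrel1 RR))/eqP.
  by rewrite oner_eq0.
case: N hw => [|N] hw.
  by move: hw; rewrite /b drop_poly0l (Cx 1%g) => /(pg_0 PR) e; rewrite e eqxx in w0.
exists (b N x - C`_N), (b N.+1 x), w; split=> //.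
- move=> s; have [v hv] := bint N s; have [v' hv'] := hC N.
  by exists (v - v'); rewrite rmorphB /= Cfix; exact: (ringrelB RR).
- by rewrite (bS N) addrC addKr mulfK // (pg_neq0 PR hw).
Qed.

Variable r : {rmorphism k -> k}.
Hypothesis rfix : forall x u, (forall s, s x = x) -> R x u -> r u = u.

(* The polynomial [\prod_s (X - \sum_i s(y_i) T^i)] has coefficients in the
   fixed field, so its reduction is fixed by r; hence r permutes the reductions
   of the conjugates of the tuple Y. *)
Lemma lift_residue_integral (Y : seq L) : {in Y, forall y, gal_integral y} ->
  exists s, {in Y, forall y u, R y u -> R (s y) (r u)}.
Proof.
move=> hY; have [O [uO hO]] := orbit_list Y.
pose P : {poly {poly L}} := \prod_(Z <- O) ('X - (Poly Z)%:P).
have PolyM s (Z : seq L) : map_poly s (Poly Z) = Poly (map s Z).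
  apply/polyP => i; rewrite coef_map !coef_Poly.
  have [hi|hi] := ltnP i (size Z); first by rewrite (nth_map 0).
  by rewrite !nth_default ?size_map //; exact: (rmorph0 s).
have Pfix s i j : s P`_i`_j = P`_i`_j.
  rewrite -!coef_map; congr (nth _ (polyseq (nth _ (polyseq _) _)) _).
  rewrite rmorph_prod /= -[RHS](perm_big _ (orbit_list_map s uO hO)) big_map.
  apply: eq_bigr => Z _; rewrite rmorphB /= map_polyX map_polyC /=.
  by rewrite PolyM.
have /choice[zb hzb] : forall Z : seq L, exists q, Z \in O -> polyrel R (Poly Z) q.
  move=> Z; case: (boolP (Z \in O)) => [/hO[s ->]|_]; last by exists 0.
  have [|q hq] := @polyrel_liftr _ _ _ RR (Poly (map s Y)); last by exists q.
  move=> i; rewrite coef_Poly; have [hi|hi] := ltnP i (size Y).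
    by rewrite (nth_map 0) //; apply: hY; exact: mem_nth.
  by rewrite nth_default ?size_map //; exists 0; exact: ringrel0.
pose Pb : {poly {poly k}} := \prod_(Z <- O) ('X - (zb Z)%:P).
have hP : polyrel (polyrel R) P Pb.
  rewrite /P /Pb big_seq [X in polyrel _ _ X]big_seq.
  apply: (ringrel_prod (polyrel_ring (polyrel_ring RR))) => Z ZO.
  by apply: (polyrelXsubC (polyrel_ring RR)); exact: hzb.
have Pbfix : map_poly (map_poly r) Pb = Pb.
  apply/polyP => i; rewrite coef_map; apply/polyP => j; rewrite coef_map.
  by apply: (rfix (x := P`_i`_j)) => [s|]; [exact: Pfix|exact: hP].
have YO : Y \in O by apply/hO; exists 1%g; rewrite -[LHS]map_id.
(* [Y] is one of the conjugate tuples, so its reduction is a root of [Pb]; [r] carries it to a root,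
   since [Pb] is fixed by [r]. *)
have : Pb.[map_poly r (zb Y)] = 0.
  rewrite -Pbfix rmorph_prod /= horner_prod; apply/eqP; rewrite prodf_seq_eq0.
  apply/hasP; exists Y => //=.
  by rewrite rmorphB /= map_polyX map_polyC /= !hornerE subrr.
rewrite horner_prod => /eqP; rewrite prodf_seq_eq0 => /hasP[Z /hO[s eZ]].
rewrite /= hornerXsubC subr_eq0 => /eqP eYZ; exists s => y yY u hu.
have := hzb Z; rewrite eZ => h; have ZO : map s Y \in O by apply/hO; exists s.
have := h ZO (index y Y); rewrite coef_Poly (nth_map 0) ?index_mem // nth_index //.
suff -> : (zb (map s Y))`_(index y Y) = r u by [].
rewrite -eZ -eYZ coef_map; congr (r _); apply: (pg_fun PR) hu.
by have := hzb Y YO (index y Y); rewrite coef_Poly nth_index.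
Qed.

(** The integral case applies to the numerators and denominators from [gal_integral_frac], whose
    denominators have nonzero residues. *)
Lemma lift_residue (U : seq L) :
  exists s, {in U, forall x u, R x u -> R (s x) (r u)}.
Proof.
have /choice[g hg] : forall x, exists yz : L * L, forall u, R x u ->
    [/\ gal_integral yz.1, gal_integral yz.2,
      exists2 w, R yz.2 w & w != 0 & x = yz.1 / yz.2].
  move=> x; case: (pselect (exists u, R x u)) => [[u hu]|nu]; last first.
    by exists (0, 0) => u hu; case: nu; exists u.
  have [y [z [w [hy hz hw w0 ->]]]] := gal_integral_frac hu.
  by exists (y, z) => v _; split=> //; exists w.
pose V := [seq x <- U | `[< exists u, R x u >]].
pose Y := [seq (g x).1 | x <- V] ++ [seq (g x).2 | x <- V].
have [|s hs] := @lift_residue_integral Y.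
  by move=> y; rewrite mem_cat => /orP[] /mapP[x];
    rewrite mem_filter => /andP[/asboolP[u hu] _] ->; have [] := hg x u hu.
exists s => x xU u hu; have [hy hz [w hw w0] ex] := hg x u hu.
have xV : x \in V by rewrite mem_filter xU andbT; apply/asboolP; exists u.
have [v hv] := hy 1%g; rewrite gal1 in hv.
have eu : u = v / w.
  apply: (pg_fun PR hu); rewrite ex; apply: (ringrelM RR) => //.
  exact: (pg_inv PR).
rewrite eu ex !rmorphM !fmorphV; apply: (ringrelM RR).
  by apply: hs => //; rewrite mem_cat; apply/orP; left; apply/mapP; exists x.
apply: (pg_inv PR); last by rewrite fmorph_eq0.
by apply: hs => //; rewrite mem_cat; apply/orP; right; apply/mapP; exists x.
Qed.

End Residue.

Section Subgroups.

Lemma subgroup_setT_or_not (H : set G) : H = setT \/ exists s, ~ H s.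
Proof.
case: (pselect (exists s, ~ H s)) => h; [by right|left].
by rewrite predeqE => s; split=> // _; apply: contrapT => hs; apply: h; exists s.
Qed.

(** Subgroups containing the pointwise stabilizer of [O] are open and determined by their images
    among the self-maps of the finite set [O]. A proper one above [H] with largest image is
    therefore maximal. *)
Lemma maximal_open_above (H : set G) (O : seq L) s0 : is_subgroup H ->
    (forall s, {in O, forall y, s y \in O}) ->
    (forall s, H s -> exists2 y, y \in O & s y <> s0 y) ->
  exists J : set G, maximal_open_subgroup J /\ (forall s, H s -> J s).
Proof.
move=> [H1 HM HV] Ostab Hs0.
pose T := seq_sub O.
pose rho (s : G) : {ffun T -> T} := [ffun x : T => SeqSub (Ostab s _ (ssvalP x))].
have rhoP s r : rho s = rho r <-> {in O, forall y, s y = r y}.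
  split=> [e y yO|e]; last by apply/ffunP => x; rewrite !ffunE; apply/val_inj/e/ssvalP.
  by have := congr1 (fun h : {ffun T -> T} => val (h (SeqSub yO))) e; rewrite !ffunE.
pose good (J : set G) := [/\ is_subgroup J, (forall s, H s -> J s),
  (forall s, {in O, forall y, s y = y} -> J s) & J <> setT].
pose im (J : set G) := [set h : {ffun T -> T} | `[< exists2 s, J s & rho s = h >]]%SET.
have satur J : is_subgroup J -> (forall s, {in O, forall y, s y = y} -> J s) ->
    forall s r, J s -> {in O, forall y, r y = s y} -> J r.
  move=> [J1 JM JV] JN s r Js e; rewrite -[r](gal_mulVK s); apply: JM => //.
  by apply: JN => y yO; rewrite galM e // galK.
have imP J s : is_subgroup J -> (forall s, {in O, forall y, s y = y} -> J s) ->
    rho s \in im J -> J s.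
  move=> sJ JN; rewrite inE => /asboolP[r Jr /rhoP e].
  by apply: (satur J sJ JN r) => // y yO; rewrite e.
pose Q n := `[< exists J, good J /\ #|im J| = n >].
have [n0 Qn0] : exists n, Q n.
  (* [J0] is [H] times the pointwise stabilizer of [O]; it misses [s0]. *)
  pose J0 : set G := fun s => exists2 d, H d & {in O, forall y, s y = d y}.
  exists #|im J0|; apply/asboolP; exists J0; split=> //; split.
  - split; first by exists 1%g.
    + move=> s r [d hd ed] [e he ee]; exists (d * e)%g; first exact: HM.
      by move=> y yO; rewrite !galM ee // ed // (Ostab e y yO).
    + move=> s [d hd ed]; exists (d^-1)%g; first exact: HV.
      move=> y yO; rewrite -{1}(galVK d y) -ed ?galK //.
      by rewrite (Ostab (d^-1)%g _ yO).
  - by move=> s hs; exists s.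
  - by move=> s e; exists 1%g.
  - move=> e; have [d hd ed] : J0 s0 by rewrite e.
    by have [y yO] := Hs0 _ hd; rewrite ed.
have [|n /asboolP[J [[sJ HJ NJ JT] cJ]] maxn] := ex_maxnP (ex_intro Q _ Qn0)
    (m := #|{ffun T -> T}|).
  by move=> n /asboolP[J [_ <-]]; exact: max_card.
have opn J' : is_subgroup J' -> (forall s, {in O, forall y, s y = y} -> J' s) ->
    krull_open J'.
  by move=> sJ' NJ' s hs; exists O => r e; apply: (satur J' sJ' NJ' s).
exists J; split=> //; split=> //; first by split=> //; exact: opn.
move=> J' [sJ' _] JJ'; case: (pselect (J' = setT)) => [->|J'T]; [by right|left].
have NJ' s : {in O, forall y, s y = y} -> J' s by move=> /NJ /JJ'.
have : Q #|im J'| by apply/asboolP; exists J'; split=> //; split=> // s /HJ/JJ'.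
move=> /maxn; rewrite -cJ => le.
have sub : im J \subset im J'.
  apply/fintype.subsetP => h; rewrite !finset.inE => /asboolP[s Js e]; apply/asboolP.
  by exists s => //; exact: JJ'.
have /eqP e : im J == im J' by rewrite eqEcard sub.
rewrite predeqE => s; split=> [J's|/JJ'//].
apply: imP => //; rewrite e inE; apply/asboolP; exists s => //.
Qed.

(* A closed subgroup D with D N = G for a subgroup N of the Frattini subgroup
   that fixes the finite set X is everything. *)
Lemma frattini_criterion (H : set G) (X : seq L) : is_subgroup H ->
    (forall s, ~ H s -> exists x, forall r, r x = s x -> ~ H r) ->
    (forall J, maximal_open_subgroup J ->
      forall s, {in X, forall x, s x = x} -> J s) ->
    (forall s, exists2 d, H d & {in X, forall x, d x = s x}) ->
  H = setT.
Proof.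
move=> sH Hcl XJ HX; case: (subgroup_setT_or_not H) => // -[s0 ns0].
(* One element [x] separates [s0] from the closed subgroup [H], so some maximal open subgroup
   contains [H]. It contains the stabilizer of [X] as well, and the two together give the whole
   group. *)
have [x hx] := Hcl _ ns0; have [O [xO Ostab]] := orbit_stable [:: x].
have [|J [mJ HJ]] := maximal_open_above (s0 := s0) sH Ostab.
  move=> s Hs; exists x; first by apply: xO; rewrite inE.
  by move=> e; case: (hx _ e).
case: (mJ) => [[[J1 JM JV] _] JT _]; case: JT.
rewrite predeqE => s; split=> // _; have [d Hd ed] := HX s.
rewrite -[s](gal_mulVK d); apply: JM; first exact: HJ.
by apply: (XJ J mJ) => y yX; rewrite galM -ed // galK.
Qed.

End Subgroups.

End AbstractGalois.

(** The axioms of a place mention only 1, sums, products and poles, so the values at 0 and -1 are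
    derived first. *)
Lemma place_pgraph (L k : fieldType) (phi : L -> option k) : is_place phi ->
  pgraph (full_subfld L) (fun x u => phi x = Some u).
Proof.
move=> phiP; have [p1 pDM pN ps] := phiP.
have [x hx] := ps 0; have p0 : phi 0 = Some 0.
  have e0 : exists u, phi 0 = Some u.
    (* A pole at 0 would give the inverse of 0, which is 0 again, the value 0. *)
    by case e: (phi 0) => [u|]; [exists u|have := pN _ e; rewrite invr0 e].
  have [u hu] := e0; have [+ _] := pDM _ _ _ _ hu p1.
  by rewrite add0r p1 => -[] /eqP; rewrite -subr_eq0 opprD addrCA subrr addr0
    oppr_eq0 => /eqP u0; rewrite hu u0.
have pN1 : phi (-1) = Some (-1).
  case e: (phi (-1)) => [u|]; last by have := pN _ e; rewrite invrN1 e.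
  have [+ _] := pDM _ _ _ _ p1 e; rewrite subrr p0 => -[/eqP].
  by rewrite eq_sym addr_eq0 => /eqP ->; rewrite opprK.
split=> [|u|//|y _].
- split=> // [y z u w hy hz|y z u w hy hz]; last by have [] := pDM _ _ _ _ hy hz.
  have [_ h] := pDM _ _ _ _ pN1 hz; rewrite !mulN1r in h.
  by have [] := pDM _ _ _ _ hy h.
- by rewrite p0 => -[].
- by case e: (phi y) => [u|]; [left; exists u|right; exact: pN].
Qed.

(** * Decomposition groups and automorphisms of the residue field *)

Section Specialization.
Variables (L k : fieldType) (F : {pred L}) (F' : {pred k}) (phi : L -> option k).
Hypotheses (finorb : forall x, exists O : seq L, forall s : gal F, s x \in O)
  (phiP : is_place phi)
  (resfix : forall x u, (forall s : gal F, s x = x) -> phi x = Some u -> u \in F')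
  (const : forall u, u \in F' -> exists2 x, x \in F & phi x = Some u).
(** [T] stands for the tree: each element depends on finitely many elements of [T], and the place
    separates the conjugates of each of these. *)
Variable T : set L.
Hypotheses
  (gen : forall x, exists S : seq L, (forall y, y \in S -> T y) /\
    forall s r : gal F, {in S, forall y, s y = r y} -> s x = r x)
  (inj : forall x (s r : gal F), T x -> phi (s x) = phi (r x) -> s x = r x).
Let PR := place_pgraph phiP.

Lemma place_fun_eq (s r : gal F) : (forall x, phi (s x) = phi (r x)) -> s = r.
Proof.
move=> h; apply: gal_ext => x; have [S [ST hS]] := gen x.
by apply: hS => y /ST yT; exact: inj.
Qed.

Lemma place_None x : phi x = None <-> x != 0 /\ phi x^-1 = Some 0.
Proof.
have [p1 pDM pN ps] := phiP; split=> [h|[x0 h]].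
  split; last exact: pN.
  apply: contra_eq_neq h => ->; have := ringrel0 (pg_ring PR) => /= ->.
  by [].
case e: (phi x) => [u|//]; have [_] := pDM _ _ _ _ e h.
by rewrite mulfV // p1 mulr0 => -[/eqP]; rewrite oner_eq0.
Qed.

(** Lifts exist on each finite set. By [inj] two of them agree on the elements of [T] they both
    treat, hence on everything these generate, so they glue. *)
Lemma lift_residue_aut (r : gal F') :
  exists s : gal F, forall x, phi (s x) = omap r (phi x).
Proof.
have rfix x u : (forall s : gal F, s x = x) -> phi x = Some u -> r u = u.
  by move=> h e; apply: gal_fix; exact: resfix h e.
have lift (U : seq L) : exists s : gal F, {in U, forall x, phi (s x) = omap r (phi x)}.
  have [s hs] := lift_residue finorb PR rfix (U ++ map (fun x => x^-1) U).
  exists s => x xU; case e: (phi x) => [u|] /=.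
    by apply: hs => //; rewrite mem_cat xU.
  move/place_None: e => [x0 hx]; apply/place_None; rewrite fmorph_eq0; split=> //.
  rewrite -fmorphV -[in RHS](rmorph0 r); apply: hs => //.
  by rewrite mem_cat map_f ?orbT.
have /choice[S hS] := gen.
have /choice[c hc] : forall x, exists s : gal F,
    {in x :: S x, forall y, phi (s y) = omap r (phi y)} by move=> x; exact: lift.
(* The value at [x] comes from a lift chosen for [x]; [sgE] shows that on any finite set these
   values come from a single automorphism. *)
pose sg x := c x x.
have sgE (U : seq L) : exists s : gal F,
    {in U, forall x, sg x = s x /\ phi (s x) = omap r (phi x)}.
  have [s hs] := lift (U ++ flatten (map S U)); exists s => x xU; split; last first.
    by apply: hs; rewrite mem_cat xU.
  have [ST hSx] := hS x; apply: hSx => y yS; apply: inj; first exact: ST.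
  rewrite hc ?inE ?yS ?orbT // hs // mem_cat; apply/orP; right.
  by apply/flattenP; exists (S x) => //; exact: map_f.
have sg_aut : is_galois_aut F sg.
  split.
  - move=> x y; have [s hs] := sgE [:: x - y; x; y].
    by rewrite !(proj1 (hs _ _)) ?inE ?eqxx ?orbT // rmorphB.
  - split=> [|x y].
      by have [s hs] := sgE [:: 1]; rewrite !(proj1 (hs _ _)) ?inE // rmorph1.
    have [s hs] := sgE [:: x * y; x; y].
    by rewrite !(proj1 (hs _ _)) ?inE ?eqxx ?orbT // rmorphM.
  - have sginj : injective sg.
      move=> x y; have [s hs] := sgE [:: x; y].
      by rewrite !(proj1 (hs _ _)) ?inE ?eqxx ?orbT // => /fmorph_inj.
    have /choice[g hg] : forall y, exists x, sg x = y.
      move=> y; have [O hO] := finorb y; have [s hs] := sgE O.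
      exists ((s^-1)%g y); rewrite (proj1 (hs _ (hO _))); exact: galVK.
    by exists g => // x; apply: sginj; rewrite hg.
  - move=> x xF; have [s hs] := sgE [:: x].
    by rewrite !(proj1 (hs _ _)) ?inE // gal_fix.
exists (Gal (introT (asboolP _) sg_aut)) => x /=.
by have [s hs] := sgE [:: x]; have [-> ->] := hs x (mem_head _ _).
Qed.

Definition abs_decomposition : set (gal F) :=
  fun s => forall x, phi (s x) = None <-> phi x = None.

Lemma abs_decomposition_subgroup : is_subgroup abs_decomposition.
Proof.
split=> [x|s r hs hr x|s hs x]; first by [].
  by rewrite galM hs hr.
by rewrite -[X in _ <-> phi X = _](galVK s) hs.
Qed.

(** Failure to preserve the valuation ring is witnessed by one element, so the decomposition group
    is closed. *)
Lemma abs_decomposition_closed (s : gal F) : ~ abs_decomposition s ->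
  exists x, forall r : gal F, r x = s x -> ~ abs_decomposition r.
Proof.
move=> h; case: (pselect (exists x, ~ (phi (s x) = None <-> phi x = None))).
  by case=> x hx; exists x => r e hr; apply: hx; rewrite -e.
by move=> hn; case: h => x; apply: contrapT => hx; apply: hn; exists x.
Qed.

(** An automorphism preserving the valuation ring preserves its maximal ideal, whose nonzero
    elements are the inverses of the poles. *)
Lemma decomposition_residue (s : gal F) : abs_decomposition s ->
  exists g : k -> k, forall x u, phi x = Some u -> phi (s x) = Some (g u).
Proof.
move=> hs; have [p1 pDM pN ps] := phiP.
have sdef x u : phi x = Some u -> exists w, phi (s x) = Some w.
  case e: (phi (s x)) => [w|] h; first by exists w.
  by move/hs: e; rewrite h.
have /choice[g hg] : forall u, exists w, exists2 x, phi x = Some u & phi (s x) = Some w.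
  by move=> u; have [x hx] := ps u; have [w hw] := sdef _ _ hx; exists w, x.
exists g => x u hx; have [y hy hw] := hg u; have [w hw'] := sdef _ _ hx.
rewrite hw'; congr Some; apply/eqP; rewrite -subr_eq0; apply/negPn/negP => n0.
have hxy : phi (x - y) = Some 0.
  by rewrite -(subrr u); exact: (ringrelB (pg_ring PR)).
have hsxy : phi (s (x - y)) = Some (w - g u).
  by rewrite rmorphB; exact: (ringrelB (pg_ring PR)).
have : phi (s (x - y)^-1) = Some (w - g u)^-1.
  by rewrite fmorphV; exact: (pg_inv PR).
suff -> : phi (s (x - y)^-1) = None by [].
apply/hs/place_None; rewrite invrK invr_eq0; split=> //.
by have := pg_neq0 PR hsxy n0; rewrite fmorph_eq0.
Qed.

(** By [place_fun_eq] lifts are unique, hence multiplicative in [r]; an element of the decomposition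
    group is the lift of the residue automorphism that it induces. *)
Theorem residue_automorphisms : exists spec : gal F' -> gal F,
  [/\ {morph spec : r s / (r * s)%g}, injective spec,
    range spec = abs_decomposition &
    forall r x, phi (spec r x) = omap r (phi x)].
Proof.
have /choice[spec hspec] := lift_residue_aut; have [p1 pDM pN ps] := phiP.
exists spec; split=> //.
- move=> r s; apply: place_fun_eq => x; rewrite galM !hspec.
  by case: (phi x).
- move=> r s e; apply: gal_ext => u; have [x hx] := ps u.
  by have := hspec r x; rewrite e hspec hx => -[].
rewrite predeqE => s; split=> [[r _ <-] x|hs]; first by rewrite hspec; case: (phi x).
have [g hg] := decomposition_residue hs.
have [_ _ hV] := abs_decomposition_subgroup.
have [g' hg'] := decomposition_residue (hV _ hs).
have gaut : is_galois_aut F' g.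
  split.
  - move=> u w; have [x hx] := ps u; have [y hy] := ps w.
    have h := ringrelB (pg_ring PR) hx hy.
    have := hg _ _ h; rewrite rmorphB.
    by rewrite (ringrelB (pg_ring PR) (hg _ _ hx) (hg _ _ hy)) => -[].
  - split=> [|u w].
      by have := hg _ _ p1; rewrite rmorph1 p1 => -[].
    have [x hx] := ps u; have [y hy] := ps w.
    have [_ h] := pDM _ _ _ _ hx hy.
    have [_ h'] := pDM _ _ _ _ (hg _ _ hx) (hg _ _ hy).
    by have := hg _ _ h; rewrite rmorphM h' => -[].
  - exists g' => u; have [x hx] := ps u.
      by have := hg' _ _ (hg _ _ hx); rewrite galK hx => -[].
    by have := hg _ _ (hg' _ _ hx); rewrite galVK hx => -[].
  - move=> u /const[x xF hx]; have := hg _ _ hx.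
    by rewrite gal_fix // hx => -[].
exists (Gal (introT (asboolP _) gaut)) => //; apply: place_fun_eq => x; rewrite hspec.
case e: (phi x) => [u|] /=; first by rewrite (hg _ _ e).
by apply/esym/hs.
Qed.

End Specialization.

Lemma irreducible_factor (L : fieldType) (E : subfld L) (p : {poly L}) :
  pover E p -> (1 < size p)%N -> exists q, [/\ pover E q, (1 < size q)%N, q %| p &
    forall d, pover E d -> d %| q -> (1 < size d)%N -> q %| d].
Proof.
move=> pE sp; pose Q n := `[< exists q, [/\ pover E q, (1 < size q)%N, q %| p & size q = n] >].
have exQ : exists n, Q n by exists (size p); apply/asboolP; exists p.
have [n /asboolP[q [qE sq qp sn]] minn] := ex_minnP exQ.
exists q; split=> // d dE dq sd.
have := minn (size d) (introT (asboolP _) (ex_intro _ d _)).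
rewrite -sn => /(_ (And4 dE sd (dvdp_trans dq qp) erefl)) le.
have q0 : q != 0 by rewrite -size_poly_gt0; exact: ltnW.
have : size d == size q by rewrite eqn_leq le dvdp_leq.
by rewrite dvdp_size_eqp // => /andP[].
Qed.

(** Serves to reach multiple roots, which may lie outside a separably closed field. *)
Lemma root_in_extension (L : fieldType) (p : {poly L}) : (1 < size p)%N ->
  exists (L' : fieldType) (j : {rmorphism L -> L'}) (z : L'), root (map_poly j p) z.
Proof.
move=> sp; have [|q [_ sq qp qmin]] := @irreducible_factor _ (full_subfld L) p _ sp.
  by [].
have qirr : irreducible_poly q.
  split=> // d sd dq; apply/andP; split=> //; apply: qmin => //.
  have : d != 0 by apply: contraTneq dq => ->; rewrite dvd0p -size_poly_gt0 (ltnW sq).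
  by rewrite -size_poly_gt0; case: (size d) sd => [|[]].
have [L' _ [z qz _]] := irredp_FAdjoin qirr.
exists L', (in_alg L'), z; have /dvdpP[c ->] := qp.
by rewrite rmorphM rootM qz orbT.
Qed.

(** With uniformizer 0 the only nonunit is 0, so [R] is the graph of an isomorphism between
    subfields. *)
Lemma dg0_neq0 (L1 L2 : fieldType) (R : L1 -> L2 -> Prop) x u :
  dgraph 0 R -> R x u -> x != 0 -> u != 0.
Proof.
move=> DR h x0; have [[|n] [y [w [hy w0 ex]]]] := dg_disc DR h x0.
  by move: ex h; rewrite expr0 mul1r => -> /(pg_fun (dg_pgraph DR) hy) <-.
by move: x0; rewrite ex expr0n mul0r eqxx.
Qed.

Lemma dgraph0_converse (L1 L2 : fieldType) (R : L1 -> L2 -> Prop) :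
  dgraph 0 R -> dgraph 0 (fun u x => R x u).
Proof.
move=> DR; have RR := dg_ring DR; split.
- split; first exact: ringrel1 RR.
    by move=> u w x y hx hy; exact: ringrelB RR _ _ _ _ hx hy.
  by move=> u w x y hx hy; exact: ringrelM RR _ _ _ _ hx hy.
- move=> x hx; apply/eqP; apply: contraT => /(dg0_neq0 DR hx).
  by rewrite eqxx.
- by move=> u x h x0; apply: (dg_inv DR) => //; exact: dg0_neq0 DR h x0.
- exact: dg_s DR.
- move=> u x h u0; exists 0%N, u, x; rewrite expr0 mul1r; split=> //.
  by apply: contra_neq u0 => x0; apply: (dg_0 DR); rewrite -x0.
Qed.

Definition graph_of (L : fieldType) (A : subfld L) (s : subfld_of A -> subfld_of A)
    (x u : L) : Prop :=
  exists y : subfld_of A, x = val y /\ u = val (s y).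

(** * Automorphisms as graphs *)

Section GraphAutomorphism.
Variables (L : fieldType) (A k : subfld L) (S : set L).

Lemma aut_dgraph (s : subfld_of A -> subfld_of A) :
  zmod_morphism s -> monoid_morphism s -> dgraph 0 (graph_of s).
Proof.
move=> sB [s1 sM].
have s0 : s 0 = 0 by have := sB 0 0; rewrite !subrr.
have sinv x : s x^-1 = (s x)^-1.
  have [->|x0] := eqVneq x 0; first by rewrite s0 !invr0.
  have e : s x * s x^-1 = 1 by rewrite -sM divff.
  have sx0 : s x != 0 by apply: contra_eq_neq e => ->; rewrite mul0r eq_sym oner_eq0.
  by apply: (mulfI sx0); rewrite e divff.
have sneq x : s x = 0 -> x = 0.
  move=> h; have [//|x0] := eqVneq x 0; have := oner_neq0 (subfld_of A).
  by rewrite -s1 -(divff x0) sM h mul0r eqxx.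
split; [split| | | |].
- by exists 1; rewrite s1.
- by move=> _ _ _ _ [x [-> ->]] [y [-> ->]]; exists (x - y); rewrite sB.
- by move=> _ _ _ _ [x [-> ->]] [y [-> ->]]; exists (x * y); rewrite sM.
- move=> u [x [/esym e ->]]; have -> : x = 0 by exact: val_inj.
  by rewrite s0.
- by move=> _ _ [x [-> ->]] _; exists x^-1; rewrite sinv.
- by exists 0; rewrite s0.
- move=> _ _ [x [-> _]] x0; exists 0%N, (val x), (val (s x)).
  rewrite expr0 mul1r; split=> //; first by exists x.
  apply: contra x0 => /eqP e; have /sneq -> : s x = 0 by exact: val_inj.
  by [].
Qed.

Lemma aut_pgraph (s : subfld_of A -> subfld_of A) :
  zmod_morphism s -> monoid_morphism s -> pgraph A (graph_of s).
Proof.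
move=> sB sM; have D := aut_dgraph sB sM; split.
- exact: dg_ring D.
- exact: dg_0 D.
- by move=> _ _ [x [-> _]]; exact: (valP x).
- by move=> x xA; left; exists (val (s (SubfldOf xA))), (SubfldOf xA).
Qed.

Lemma dgraph_adjoin_dom (R : L -> L -> Prop) : dgraph 0 R ->
    (forall c, c \in k -> R c c) -> (forall x, S x -> exists2 u, S u & R x u) ->
  forall x, x \in adjoin k S -> exists2 u, u \in adjoin k S & R x u.
Proof.
move=> DR Rk RS; apply: adjoin_ind.
- by move=> x xk; exists x; [exact: mem_adjoin_base|exact: Rk].
- by move=> x /RS[u uS h]; exists u => //; exact: mem_adjoin.
- move=> x y [u uA hu] [w wA hw]; exists (u - w); first exact: subfldB.
  exact: ringrelB (dg_ring DR) _ _ _ _ hu hw.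
- move=> x y [u uA hu] [w wA hw]; exists (u / w); first exact: subfld_div.
  apply: (ringrelM (dg_ring DR)) => //; have [y0|y0] := eqVneq y 0.
    move: hw; rewrite y0 => /(dg_0 DR) ->; rewrite !invr0.
    exact: ringrel0 (dg_ring DR).
  by apply: (dg_inv DR) => //; exact: dg0_neq0 DR hw y0.
Qed.

Variable R : L -> L -> Prop.
Hypotheses (DR : dgraph 0 R) (Rk : forall c, c \in k -> R c c)
  (RS : forall x, S x -> exists2 u, S u & R x u)
  (SR : forall u, S u -> exists2 x, S x & R x u).

Lemma graph_aut : exists s : subfld_of (adjoin k S) -> subfld_of (adjoin k S),
  [/\ zmod_morphism s, monoid_morphism s, bijective s &
    forall x, R (val x) (val (s x))].
Proof.
have PR := dg_pgraph DR; have RR := dg_ring DR.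
have /choice[s hs] : forall x : subfld_of (adjoin k S),
    exists u : subfld_of (adjoin k S), R (val x) (val u).
  move=> x; have [u uA h] := dgraph_adjoin_dom DR Rk RS (valP x).
  by exists (SubfldOf uA).
have /choice[g hg] : forall u : subfld_of (adjoin k S),
    exists x : subfld_of (adjoin k S), R (val x) (val u).
  move=> u; have [x xA h] := dgraph_adjoin_dom (dgraph0_converse DR) Rk SR (valP u).
  by exists (SubfldOf xA).
have funR x u w : R x u -> R x w -> u = w by exact: pg_fun PR x u w.
have injR x y u : R x u -> R y u -> x = y.
  move=> hx hy; apply/eqP; rewrite -subr_eq0; apply: contraT => n0.
  have := dg0_neq0 DR (ringrelB RR hx hy) n0.
  by rewrite subrr eqxx.
exists s; split=> //.
- move=> x y; apply/val_inj; apply: (funR _ _ _ (hs _)).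
  rewrite !rmorphB; exact: ringrelB RR _ _ _ _ (hs x) (hs y).
- split=> [|x y]; apply/val_inj; apply: (funR _ _ _ (hs _)).
    by rewrite !rmorph1; exact: ringrel1.
  rewrite !rmorphM; exact: ringrelM RR _ _ _ _ (hs x) (hs y).
- exists g => x; apply/val_inj; first exact: injR (hg _) (hs _).
  exact: funR (hs _) (hg _).
Qed.

End GraphAutomorphism.

(** * Algebraic and transcendental points of the tree *)

Section Algebraic.
Variables (K Om : fieldType) (iota : {rmorphism K -> Om}) (f : ratmap K).
Local Notation alg := (algebraicOver iota).
Local Notation reval := (reval iota f).
Local Notation Kb := (Kbar iota).
Local Notation num := (map_poly iota (rnum f)).
Local Notation den := (map_poly iota (rden f)).

Lemma mem_Kbar x : x \in Kb <-> alg x.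
Proof.
split=> [/alg_predP[]//|h]; by apply/alg_predP.
Qed.

Lemma iota_Kbar c : iota c \in Kb.
Proof. by apply/mem_Kbar; exact: algebraic_id. Qed.

Lemma Kbar_root (p : {poly Om}) x : p != 0 -> pover Kb p -> root p x -> x \in Kb.
Proof.
move=> p0 pE px; apply/mem_Kbar/integral_algebraic.
apply: (integral_root p0 px) => c /(nthP 0)[i _ <-].
by apply/integral_algebraic/mem_Kbar/pE.
Qed.

Lemma Kbar_transc (p : {poly Om}) x : x \notin Kb -> pover Kb p -> p.[x] = 0 -> p = 0.
Proof.
move=> xK pE px; apply/eqP; apply: contraNT xK => p0.
by apply: (Kbar_root p0 pE); apply/rootP.
Qed.

Lemma pover_iota (p : {poly K}) (E : subfld Om) : (forall c, iota c \in E) ->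
  pover E (map_poly iota p).
Proof. by move=> h i; rewrite coef_map; exact: h. Qed.

Definition algpt (p : option Om) := forall x, p = Some x -> x \in Kb.

Lemma algpt_reval p : algpt p -> algpt (reval p).
Proof.
have aux u w : u \in Kb -> w \in Kb -> algpt (ratdiv u w).
  by move=> uK wK x; rewrite /ratdiv; case: eqP => // _ [<-]; exact: subfld_div.
case: p => [x|] h; apply: aux; try exact: iota_Kbar.
  by apply: pover_horner; [apply: pover_iota; exact: iota_Kbar|exact: h].
by apply: pover_horner; [apply: pover_iota; exact: iota_Kbar|exact: h].
Qed.

Lemma pover_fiber (E : subfld Om) y : (forall c, iota c \in E) ->
  (forall x, y = Some x -> x \in E) -> pover E (fiber_poly iota f y).
Proof.
move=> iE; case: y => [c|] h /=; last exact: pover_iota.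
by apply: poverB; [exact: pover_iota|apply: poverZ; [exact: h|exact: pover_iota]].
Qed.

Lemma algpt_fiber p : algpt (reval p) -> algpt p.
Proof.
case: p => [x|] // h _ [<-].
have xr : root (fiber_poly iota f (reval (Some x))) x by apply/reval_fiber.
apply: Kbar_root xr; first exact: fiber_neq0.
by apply: pover_fiber => //; exact: iota_Kbar.
Qed.

(** Images and preimages of algebraic points are algebraic, so a tree consists of algebraic points
    only or, over a transcendental point, of finite transcendental ones. *)
Lemma algpt_iter n p : algpt (iter n reval p) <-> algpt p.
Proof.
elim: n p => [//|n IH] p; rewrite iterSr; split=> [/IH|h]; first exact: algpt_fiber.
by apply/IH; exact: algpt_reval.
Qed.

Lemma fiber_finite y : exists l : seq (option Om), forall p, reval p = y -> p \in l.
Proof.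
have [l hl] := roots_finite (fiber_neq0 iota f y).
exists (None :: map Some l) => -[x|] h; last by rewrite inE.
by rewrite inE; apply/map_f/hl/reval_fiber.
Qed.

Lemma level_finite n y : exists l : seq (option Om),
  forall p, iter n reval p = y -> p \in l.
Proof.
elim: n => [|n [l hl]] /=; first by exists [:: y] => p ->; rewrite inE.
have /choice[g hg] := fiber_finite.
exists (flatten (map g l)) => p; rewrite -iterS iterSr => /hl h.
by apply/flattenP; exists (g (reval p)); [exact: map_f|exact: hg].
Qed.

Definition wronskian (p q : {poly K}) := p^`() * q - p * q^`().

Lemma wronskian0 (p q : {poly K}) : coprimep p q -> q != 0 -> wronskian p q = 0 ->
  p^`() = 0 /\ q^`() = 0.
Proof.
move=> cpq q0 /eqP; rewrite subr_eq0 => /eqP e.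
have dq : q^`() = 0.
  apply/eqP; apply: contraT => dq0.
  have : q %| p * q^`() by rewrite -e dvdp_mulIr.
  rewrite Gauss_dvdpr; last by rewrite coprimep_sym.
  by move/(dvdp_leq dq0); rewrite leqNgt lt_size_deriv.
split=> //; move: e; rewrite dq mulr0 => /eqP; rewrite mulf_eq0 (negPf q0) orbF.
by move/eqP.
Qed.

Lemma rden_neq0 : rden f != 0.
Proof. by have := fiber_neq0 iota f None; rewrite /= map_poly_eq0. Qed.


(** At a double zero the values of numerator and denominator, and those of their derivatives,
    satisfy the same linear relation. *)
Lemma fiber_double (L : fieldType) (j : {rmorphism K -> L}) y z :
  root (fiber_poly j f y) z -> root (fiber_poly j f y)^`() z ->
  root (map_poly j (wronskian (rnum f) (rden f))) z.
Proof.
rewrite rmorphB !rmorphM /= -!deriv_map => h h'.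
apply/rootP; rewrite hornerD hornerN !hornerM; case: y h h' => [c|] /=; last first.
  by move=> /rootP -> /rootP ->; rewrite !mulr0 subrr.
rewrite derivB derivZ => /rootP + /rootP; rewrite !hornerE.
by move=> /eqP; rewrite subr_eq0 => /eqP -> /eqP; rewrite subr_eq0 => /eqP ->;
  rewrite -mulrA [_.[z] * _.[z]]mulrC mulrA subrr.
Qed.

End Algebraic.

(** * Fractions in one generator over a subfield *)

Section Fractions.
Variables (L : fieldType) (E : subfld L) (t : L).

Lemma adjoin_frac x : x \in adjoin E [set t]%classic -> exists n d : {poly L},
  [/\ pover E n, pover E d, d.[t] != 0 & x = n.[t] / d.[t]].
Proof.
move: x; apply: adjoin_ind.
- move=> x xE; exists x%:P, 1; rewrite !hornerC divr1 oner_eq0; split=> //.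
  + exact: poverC.
  + by apply: poverC; exact: subfld1.
- move=> x ->; exists 'X, 1; rewrite hornerX hornerC divr1 oner_eq0; split=> //.
  + exact: poverX.
  + by apply: poverC; exact: subfld1.
- move=> _ _ [n [d [nE dE d0 ->]]] [n' [d' [nE' dE' d0' ->]]].
  exists (n * d' - n' * d), (d * d'); split.
  + by apply: poverB; apply: poverM.
  + exact: poverM.
  + by rewrite hornerM mulf_neq0.
  + by rewrite -mulNr addf_div // !hornerE mulNr.
- move=> _ _ [n [d [nE dE d0 ->]]] [n' [d' [nE' dE' d0' ->]]].
  have [n0|n0] := eqVneq n'.[t] 0.
    exists 0, 1; rewrite n0 mul0r invr0 mulr0 !hornerC mul0r oner_eq0; split=> //.
    + by apply: poverC; exact: subfld0.
    + by apply: poverC; exact: subfld1.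
  exists (n * d'), (d * n'); split.
  + exact: poverM.
  + exact: poverM.
  + by rewrite hornerM mulf_neq0.
  + by rewrite !hornerM invf_div mulf_div.
Qed.

Lemma adjoin_frac_coprime x : x \in adjoin E [set t]%classic ->
  exists n d : {poly L}, [/\ pover E n, pover E d, d.[t] != 0, coprimep n d &
    x = n.[t] / d.[t]].
Proof.
move=> /adjoin_frac[n [d [nE dE d0 ->]]].
pose r := gcdp n d; have rE : pover E r by exact: pover_gcdp.
have er : r.[t] != 0.
  by apply: contra d0 => /eqP r0; rewrite -(divpK (dvdp_gcdr n d)) hornerM r0 mulr0.
have en : n.[t] = (n %/ r).[t] * r.[t] by rewrite -hornerM divpK // dvdp_gcdl.
have ed : d.[t] = (d %/ r).[t] * r.[t] by rewrite -hornerM divpK // dvdp_gcdr.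
exists (n %/ r), (d %/ r); split; try exact: pover_divp.
- by move: d0; rewrite ed mulf_eq0 negb_or => /andP[].
- apply: coprimep_div_gcd; apply/orP; right.
  by apply: contra_neq d0 => ->; rewrite horner0.
- by rewrite en ed -mulf_div divff // mulr1.
Qed.

Lemma frac_adjoin (n d : {poly L}) : pover E n -> pover E d ->
  n.[t] / d.[t] \in adjoin E [set t]%classic.
Proof.
have aux (p : {poly L}) : pover E p -> p.[t] \in adjoin E [set t]%classic.
  move=> pE; apply: pover_horner; last exact: mem_adjoin.
  by move=> i; apply: mem_adjoin_base; exact: pE.
by move=> nE dE; apply: subfld_div; exact: aux.
Qed.

Lemma adjoin_common_denom (p : {poly L}) : pover (adjoin E [set t]%classic) p ->
  exists (d : {poly L}) (n : nat -> {poly L}), [/\ pover E d, d.[t] != 0,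
    forall i, pover E (n i) & forall i, d.[t] * p`_i = (n i).[t]].
Proof.
move=> pE.
have {pE} : forall i, (i < size p)%N -> p`_i \in adjoin E [set t]%classic by move=> i _; exact: pE.
elim: (size p) {-2}p (leqnn (size p)) => [|m IH] q sq qE.
  exists 1, (fun _ => 0); rewrite hornerC oner_eq0; split=> //.
  + by apply: poverC; exact: subfld1.
  + by move=> _; apply: poverC; exact: subfld0.
  + by move=> i; rewrite horner0 nth_default ?mulr0 // (leq_trans sq).
have qm : q`_m \in adjoin E [set t]%classic.
  have [h|h] := ltnP m (size q); first exact: qE.
  by rewrite nth_default //; exact: subfld0.
have [n1 [d1 [n1E d1E d10 e1]]] := adjoin_frac qm.
have [||d [n [dE d0 nE en]]] := IH (take_poly m q).
- exact: size_take_poly.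
- move=> i hi; rewrite coef_take_poly; case: ifP => // him; last exact: subfld0.
  have [h|h] := ltnP i (size q); first exact: qE.
  by rewrite nth_default //; exact: subfld0.
exists (d * d1), (fun i => if i == m then n1 * d else n i * d1); split.
- exact: poverM.
- by rewrite hornerM mulf_neq0.
- by move=> i; case: eqP => _; exact: poverM.
move=> i; case: eqP => [->|/eqP im]; rewrite !hornerM.
  by rewrite e1 -mulrA [d1.[t] * _]mulrC divfK // mulrC.
rewrite -en coef_take_poly mulrAC; case: ltnP => // mi.
by rewrite nth_default // (leq_trans sq) // ltn_neqAle eq_sym im.
Qed.

End Fractions.

Lemma split_prod_XsubC (L : fieldType) (E : subfld L) (p : {poly L}) :
    pover E p -> p != 0 ->
    (forall q, pover E q -> q %| p -> (1 < size q)%N -> exists2 z, z \in E & root q z) ->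
  exists rs, p = lead_coef p *: \prod_(r <- rs) ('X - r%:P).
Proof.
move: {2}(size p) (leqnn (size p)) => n.
elim: n p => [|n IH] p sp pE p0 hp; first by move: sp; rewrite leqn0 size_poly_eq0 (negPf p0).
case: (ltnP 1 (size p)) => [sp1|sp1]; last first.
  have ep := size1_polyC sp1.
  by exists [::]; rewrite big_nil alg_polyC [in RHS]ep lead_coefC -ep.
have [z zE /factor_theorem[q eq]] := hp p pE (dvdpp p) sp1.
have q0 : q != 0 by apply: contra_neq p0 => q0; rewrite eq q0 mul0r.
have [||//|r rE rq|rs ers] := IH q.
- by move: sp; rewrite eq size_Mmonic ?monicXsubC // size_XsubC addn2.
- have -> : q = p %/ ('X - z%:P) by rewrite eq mulpK // polyXsubC_eq0.
  by apply: pover_divp => //; exact: poverXsubC.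
- by apply: hp => //; apply: dvdp_trans rq _; rewrite eq dvdp_mulIl.
by exists (z :: rs); rewrite eq lead_coefM lead_coefXsubC mulr1 big_cons {1}ers -scalerAl mulrC.
Qed.

(** * Fibers over transcendental points *)

Section SeparablyClosed.
Variables (K Om : fieldType) (iota : {rmorphism K -> Om}) (f : ratmap K).
Hypothesis sepcl : forall p : {poly Om}, separable_poly p -> (1 < size p)%N ->
  exists x, root p x.
Local Notation Kb := (Kbar iota).
Local Notation reval := (reval iota f).
Local Notation num := (map_poly iota (rnum f)).
Local Notation den := (map_poly iota (rden f)).

Lemma separable_split (p : {poly Om}) : separable_poly p ->
  exists2 rs, uniq rs & p = lead_coef p *: \prod_(r <- rs) ('X - r%:P).
Proof.
move=> psep; have p0 := separable_poly_neq0 psep.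
have [//|q _ qp sq|rs ers] := @split_prod_XsubC _ (full_subfld Om) p _ p0.
  by have [z qz] := sepcl (dvdp_separable qp psep) sq; exists z.
exists rs => //; move: psep; rewrite ers -mul_polyC separable_mul => /and3P[_ + _].
by rewrite separable_prod_XsubC.
Qed.

Lemma wronskian_neq0 (t x : Om) (E : subfld Om) (p : {poly subfld_of E}) :
    (forall y, y \in E -> y \in adjoin Kb [set t]%classic) ->
    x \notin Kb -> reval (Some x) = Some t ->
    separable_poly p -> root (map_poly val p) x ->
  wronskian (rnum f) (rden f) != 0.
Proof.
move=> EK xK xt psep px; apply/eqP => /(wronskian0 (rcoprime f) (rden_neq0 iota f)).
case=> dn0 dd0; set q := map_poly val p in px.
have numd : num^`() = 0 by rewrite deriv_map dn0 rmorph0.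
have dend : den^`() = 0 by rewrite deriv_map dd0 rmorph0.
have qE : pover (adjoin Kb [set t]%classic) q.
  by move=> i; rewrite coef_map; apply: EK; exact: valP.
have qsep : separable_poly q by rewrite separable_map.
have dqx : q^`().[x] != 0.
  by apply: (@coprimep_root _ q) px; move: qsep; rewrite unlock.
have [d [n [dE d0 nE dn]]] := adjoin_common_denom qE.
have denx : den.[x] != 0.
  by apply/eqP => e; move: xt; rewrite /= /ratdiv e eqxx.
have et : t = num.[x] / den.[x] by move: xt; rewrite /= /ratdiv (negPf denx) => -[].
have iK := iota_Kbar iota.
pose m := size q; pose N := \max_(i < m) size (n i).
have nN i : (i < m)%N -> (size (n i) <= N)%N.
  by move=> im; apply: (leq_bigmax (Ordinal im)).
(* This is [n i] at [num / den], times [den ^+ N]; its derivative is 0, so it acts as a constant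
   when [H] is differentiated. *)
pose h i : {poly Om} := \sum_(j < N) (n i)`_j *: (num ^+ j * den ^+ (N - j)).
have hE i : pover Kb (h i).
  apply: pover_sum => j _; apply: poverZ; first exact: nE.
  by apply: poverM; apply: pover_exp; exact: pover_iota.
have hx i : (i < m)%N -> (h i).[x] = den.[x] ^+ N * (d.[t] * q`_i).
  move=> im; rewrite dn (horner_coef_wide _ (nN i im)) horner_sum mulr_sumr.
  apply: eq_bigr => j _; rewrite hornerZ hornerM !horner_exp et expr_div_n.
  rewrite [RHS]mulrCA; congr (_ * _); rewrite [RHS]mulrCA; congr (_ * _).
  have -> : den.[x] ^+ N = den.[x] ^+ (N - j) * den.[x] ^+ j.
    by rewrite -exprD subnK // ltnW.
  by rewrite mulfK // expf_neq0.
have hd i : (h i)^`() = 0.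
  rewrite raddf_sum big1 // => j _; rewrite [LHS]derivZ derivM !deriv_exp numd dend.
  by rewrite !mul0r !mul0rn mul0r mulr0 addr0 scaler0.
pose H : {poly Om} := \sum_(i < m) h i * 'X^i.
have HE : pover Kb H.
  by apply: pover_sum => i _; apply: poverM => //; apply: pover_exp; exact: poverX.
have H0 : H = 0.
  apply: (Kbar_transc xK HE).
  transitivity (den.[x] ^+ N * d.[t] * q.[x]); last by rewrite (rootP px) mulr0.
  rewrite horner_sum [q.[x]]horner_coef mulr_sumr; apply: eq_bigr => i _.
  by rewrite hornerM hornerXn hx // !mulrA.
have : H^`().[x] = den.[x] ^+ N * d.[t] * q^`().[x].
  rewrite raddf_sum horner_sum -[in RHS](coefK q) poly_def raddf_sum horner_sum.
  rewrite mulr_sumr; apply: eq_bigr => i _.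
  have -> : (h i * 'X^i)^`().[x] = (h i).[x] * (('X^i)^`()).[x].
    by rewrite derivM hd mul0r add0r hornerM.
  have -> : (q`_i *: 'X^i)^`().[x] = q`_i * (('X^i)^`()).[x].
    by rewrite derivZ hornerZ.
  by rewrite hx // !mulrA.
rewrite H0 deriv0 horner0 => /esym/eqP.
by rewrite !mulf_eq0 expf_eq0 (negPf denx) (negPf d0) (negPf dqx) andbF.
Qed.

Hypothesis wr0 : wronskian (rnum f) (rden f) != 0.

(** Infinity has an algebraic image, so it is not in the fiber and the degree does not drop. *)
Lemma fiber_lead_transc c : c \notin Kb -> size (fiber_poly iota f (Some c)) = (rdeg f).+1.
Proof.
move=> cK; apply/eqP; rewrite eqn_leq size_fiber ltnNge; apply/negP.
move=> /(nth_default 0); move/reval_fiber_inf => e.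
by have := @algpt_reval _ _ iota f None (fun x => fun h : None = Some x => match h with end);
  rewrite e => /(_ _ erefl); apply/negP.
Qed.

(** A multiple root, taken in an extension of [Om], is a zero of the Wronskian and hence algebraic
    over [K]; then so is its image [c]. *)
Lemma fiber_sep_transc c : c \notin Kb -> separable_poly (fiber_poly iota f (Some c)).
Proof.
move=> cK; set F := fiber_poly _ _ _; have F0 : F != 0 by exact: fiber_neq0.
rewrite unlock; apply: contraNT cK => ncop.
have dn0 : gcdp F F^`() != 0 by rewrite gcdp_eq0 negb_and F0.
have [|Om' [j [z]]] := @root_in_extension _ (gcdp F F^`()).
  by move: ncop dn0; rewrite /coprimep -size_poly_gt0; case: (size _) => [|[]].
rewrite gcdp_map root_gcd -deriv_map.
pose jio : {rmorphism K -> Om'} := j \o iota.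
have Fj : map_poly j F = fiber_poly jio f (Some (j c)).
  by rewrite /F /= rmorphB /= map_polyZ !map_poly_comp.
rewrite Fj => /andP[rz rz'].
have Wz := fiber_double rz rz'.
have [p p0 pz] : algebraicOver jio z by exists (wronskian (rnum f) (rden f)).
have zK : z \in Kbar jio by apply/mem_Kbar; exists p.
have zr : Defs.reval jio f (Some z) = Some (j c) by apply/reval_fiber.
have : j c \in Kbar jio.
  by have := @algpt_reval _ _ jio f (Some z) (fun _ => _); rewrite zr; apply => // _ [<-].
move/mem_Kbar => [P P0 Pj]; apply/mem_Kbar; exists P => //.
by move: Pj; rewrite map_poly_comp fmorph_root.
Qed.

Lemma unramified_transc c : c \notin Kb -> unramified_over iota f (Some c).
Proof.
move=> cK; have [rs urs ers] := separable_split (fiber_sep_transc cK).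
exists (map Some rs); split.
- by rewrite map_inj_uniq // => x y [].
- have := fiber_lead_transc cK; rewrite ers size_scale ?lead_coef_eq0 ?fiber_neq0 //.
  by rewrite size_prod_XsubC size_map => -[].
- move=> _ /mapP[r rrs ->]; apply/reval_fiber; rewrite ers rootZ.
    by rewrite root_prod_XsubC.
  by rewrite lead_coef_eq0 fiber_neq0.
Qed.

Lemma tree_transc n t p : t \notin Kb -> iter n reval p = Some t ->
  exists2 c, p = Some c & c \notin Kb.
Proof.
move=> tK e; have h : ~ algpt iota p.
  by move/(algpt_iter iota f n); rewrite e => /(_ _ erefl); apply/negP.
case: p e h => [c|] e h; last by case: h.
by exists c => //; apply/negP => cK; apply: h => _ [<-].
Qed.

Lemma unramified_tree_transc t : t \notin Kb ->
  forall n q, iter n reval q = Some t -> unramified_over iota f q.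
Proof.
by move=> tK n q /(tree_transc tK)[c -> cK]; exact: unramified_transc.
Qed.

End SeparablyClosed.

Lemma surj_on_list (T : choiceType) (l : seq T) (Q : T -> T -> Prop) :
  (forall x, x \in l -> exists2 u, u \in l & Q x u) ->
  (forall x y u, Q x u -> Q y u -> x = y) ->
  forall u, u \in l -> exists2 x, x \in l & Q x u.
Proof.
move=> hl hQ.
have /choice[g hg] : forall x, exists u, x \in l -> u \in l /\ Q x u.
  by move=> x; case: (boolP (x \in l)) => [/hl[u ul h]|_]; [exists u|exists x].
have gin x : x \in undup l -> g x \in undup l.
  by rewrite !mem_undup => /hg[].
have ginj : {in undup l &, injective g}.
  move=> x y; rewrite !mem_undup => /hg[_ hx] /hg[_ hy] e.
  by apply: (hQ _ _ (g y)) hy; rewrite -e.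
have sub : {subset map g (undup l) <= undup l} by move=> _ /mapP[x xl ->]; exact: gin.
have [||_ e] := uniq_min_size _ sub.
- by rewrite map_inj_in_uniq ?undup_uniq.
- by rewrite size_map.
move=> u; rewrite -mem_undup -e => /mapP[x]; rewrite mem_undup => xl ->.
by exists x => //; have [] := hg x xl.
Qed.

(** * Galois theory of the tree *)

Section TreeGalois.
Variables (K Om : fieldType) (iota : {rmorphism K -> Om}) (f : ratmap K).
Variables (k : subfld Om) (b : Om) (F : subfld Om).
Local Notation reval := (reval iota f).
Local Notation tree := (backward_orbit iota f b).
Local Notation A := (adjoin k tree).
Local Notation FA := [pred x : subfld_of A | val x \in F].
Hypotheses (kinf : forall l : seq Om, exists2 c, c \in k & c \notin l)
  (iotak : forall c, iota c \in k) (kF : forall c, c \in k -> c \in F)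
  (FAs : forall c, c \in F -> c \in A) (bF : b \in F).

Lemma gal_pgraph (s : gal FA) : pgraph A (graph_of s).
Proof. by apply: aut_pgraph; [exact: gal_zmod_morphism|exact: gal_monoid_morphism]. Qed.

Lemma gal_dgraph (s : gal FA) : dgraph 0 (graph_of s).
Proof. by apply: aut_dgraph; [exact: gal_zmod_morphism|exact: gal_monoid_morphism]. Qed.

Lemma graph_ofP (s : gal FA) (x : subfld_of A) : graph_of s (val x) (val (s x)).
Proof. by exists x. Qed.

Lemma graph_fix (s : gal FA) c : c \in F -> graph_of s c c.
Proof.
by move=> cF; exists (SubfldOf (FAs cF)); split=> //; rewrite gal_fix.
Qed.

Lemma graph_point n (R : Om -> Om -> Prop) (E : subfld Om) b' p q : pgraph E R ->
  (forall c, R (iota c) (iota c)) -> R b b' -> point_rel R p q ->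
  iter n reval p = Some b -> iter n reval q = Some b'.
Proof.
move=> PR RK Rb h e; have := iter_point_rel PR f RK n h; rewrite e => h'.
exact: (point_rel_fun PR h' (Rb : point_rel R (Some b) (Some b'))).
Qed.

Lemma gal_level n (s : gal FA) (x : subfld_of A) :
  iter n reval (Some (val x)) = Some b -> iter n reval (Some (val (s x))) = Some b.
Proof.
apply: (graph_point (gal_pgraph s)); last exact: graph_ofP.
  by move=> c; apply/graph_fix/kF/iotak.
exact: graph_fix.
Qed.

Lemma tree_gen (x : subfld_of A) : exists S : seq (subfld_of A),
  (forall y, y \in S -> tree (val y)) /\
  forall s r : gal FA, {in S, forall y, s y = r y} -> s x = r x.
Proof.
suff H : forall x, x \in A -> forall xA : x \in A, exists S : seq (subfld_of A),
    (forall y, y \in S -> tree (val y)) /\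
    forall s r : gal FA, {in S, forall y, s y = r y} -> s (SubfldOf xA) = r (SubfldOf xA).
  have [S hS] := H _ (valP x) (valP x); exists S.
  by have -> : x = SubfldOf (valP x) by exact: val_inj.
move=> {x} z zA zA'.
suff : exists y : subfld_of A, val y = z /\ exists S : seq (subfld_of A),
    (forall y, y \in S -> tree (val y)) /\
    forall s r : gal FA, {in S, forall y, s y = r y} -> s y = r y.
  move=> [y [ey [S [h1 h2]]]]; exists S; split=> //.
  by have -> : SubfldOf zA' = y by exact: val_inj.
move: z zA {zA'}; apply: adjoin_ind.
- move=> x xk; exists (SubfldOf (mem_adjoin_base _ xk)); split=> //.
  by exists [::]; split=> // s r _; rewrite !gal_fix //= ?inE /=; exact: kF.
- move=> x xt; exists (SubfldOf (mem_adjoin k xt)); split=> //.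
  exists [:: SubfldOf (mem_adjoin k xt)]; split=> [y|s r]; first by rewrite inE => /eqP->.
  by apply; rewrite inE.
- move=> x y [x' [ex [S [ST hS]]]] [y' [ey [S' [ST' hS']]]].
  exists (x' - y'); rewrite rmorphB /= -ex -ey; split=> //; exists (S ++ S'); split.
    by move=> z; rewrite mem_cat => /orP[/ST|/ST'].
  move=> s r e; rewrite !rmorphB; congr (_ - _); [apply: hS|apply: hS'] => z zS;
    by apply: e; rewrite mem_cat zS ?orbT.
- move=> x y [x' [ex [S [ST hS]]]] [y' [ey [S' [ST' hS']]]].
  exists (x' / y'); rewrite fmorph_div /= -ex -ey; split=> //; exists (S ++ S'); split.
    by move=> z; rewrite mem_cat => /orP[/ST|/ST'].
  move=> s r e; rewrite !fmorph_div; congr (_ / _); [apply: hS|apply: hS'] => z zS;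
    by apply: e; rewrite mem_cat zS ?orbT.
Qed.

(** Automorphisms preserve the finite levels of the tree, and [x] depends on finitely many tree
    points. *)
Lemma tree_finorb (x : subfld_of A) :
  exists O : seq (subfld_of A), forall s : gal FA, s x \in O.
Proof.
have [S [ST hS]] := tree_gen x.
have orb1 (y : subfld_of A) : tree (val y) ->
    exists O : seq (subfld_of A), forall s : gal FA, s y \in O.
  move=> [n hn]; have [l hl] := level_finite iota f n (Some b).
  exists (pmap insub (pmap id l)) => s; rewrite mem_pmap_sub.
  by rewrite mem_pmap map_id; apply: hl; exact: gal_level.
have [B hB] : exists B : seq (seq (subfld_of A)), forall s : gal FA, map s S \in B.
  elim: S ST {hS} => [|y S IH] ST; first by exists [:: [::]] => s; rewrite inE.
  have [|B hB] := IH; first by move=> z zS; apply: ST; rewrite inE zS orbT.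
  have [|O hO] := orb1 y; first by apply: ST; rewrite inE eqxx.
  exists [seq z :: Z | z <- O, Z <- B] => s /=.
  by apply: allpairs_f; [exact: hO|exact: hB].
have /choice[g hg] : forall Z : seq (subfld_of A), exists u,
    forall s : gal FA, Z = map s S -> s x = u.
  move=> Z; case: (pselect (exists s : gal FA, Z = map s S)) => [[s es]|ns]; last first.
    by exists 0 => s es; case: ns; exists s.
  exists (s x) => r er; apply: hS => y yS.
  by apply: (eq_in_map _ _ _).2 y yS => //; rewrite -er es.
by exists (map g B) => s; apply/mapP; exists (map s S); [exact: hB|exact: hg].
Qed.

Hypothesis unr : forall n q, iter n reval q = Some b -> unramified_over iota f q.

(** The identity of [F] is a place with uniformizer 0. The extension step sends [y] to [y'], and
    [tree_extension] continues over the tree. *)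
Lemma conj_lift (y : subfld_of A) (y' : Om) (p : {poly Om}) : p \is monic ->
    pover F p -> root p (val y) -> (forall q, pover F q -> root q (val y) -> p %| q) ->
    root p y' -> ~~ root p^`() y' ->
  exists s : gal FA, val (s y) = y'.
Proof.
move=> pm pF py pmin py' dpy'.
pose R00 (x u : Om) := x = u /\ x \in F.
have D00 : dgraph 0 R00.
  split; [split| | | |].
  - by split=> //; exact: subfld1.
  - by move=> x z u w [<- xF] [<- zF]; split=> //; exact: subfldB.
  - by move=> x z u w [<- xF] [<- zF]; split=> //; exact: subfldM.
  - by move=> u [].
  - by move=> x u [<- xF] _; split=> //; exact: subfldV.
  - by split=> //; exact: subfld0.
  - by move=> x u [_ xF] x0; exists 0%N, x, x; rewrite expr0 mul1r.
have hp : polyrel R00 p p by move=> i; split.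
have [D0 [R0F R0y R0A]] : exists D0 : dgraph 0 (ext_rel R00 (val y) y'),
    [/\ forall c, c \in F -> ext_rel R00 (val y) y' c c,
        ext_rel R00 (val y) y' (val y) y' &
        forall x u, ext_rel R00 (val y) y' x u -> x \in A /\ u \in full_subfld Om].
  have pmin' q : pover (frac_subfld D00) q -> root q (val y) -> p %| q.
    move=> qE; apply: pmin => i; have /frac_predP := qE i.
    by move=> [a [_ [c [_ [[_ aF] [_ cF] _ ->]]]]]; exact: subfld_div.
  exists (ext_dgraph pm hp py pmin' py' dpy'); split.
  - by move=> c cF; apply: (ext_sub D00).
  - exact: (ext_gen D00).
  - move=> x u [g [gb [h [hb [hg hh _ -> _]]]]]; split=> //.
    by apply: subfld_div; apply: pover_horner; try exact: valP; move=> i;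
      [have [_ ] := hg i|have [_ ] := hh i] => ?; exact: FAs.
have kA c : c \in k -> c \in A by exact: mem_adjoin_base.
have kT c : c \in k -> c \in full_subfld Om by [].
have tA x : tree x -> x \in A by exact: mem_adjoin.
have tT x : tree x -> x \in full_subfld Om by [].
have R0k c : c \in k -> ext_rel R00 (val y) y' c c by move=> /kF/R0F.
(* The target is all of [Om]; that the image is again [A] follows from the action on the levels. *)
have [R [DR [R0R RA Rtree]]] :=
  tree_extension kinf iotak kA kT tA tT unr D0 R0k (R0F b bF) R0A.
have PR := dg_pgraph DR; have RF c : c \in F -> R c c by move=> /R0F/R0R.
have RK c : R (iota c) (iota c) by apply/RF/kF/iotak.
have Rx n x : iter n reval (Some x) = Some b ->
    exists2 u, R x u & iter n reval (Some u) = Some b.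
  move=> /Rtree[[u|] /= [h e]]; first by exists u.
  have [x0 hx] := h; have := dg0_neq0 DR hx.
  by rewrite invr_eq0 eqxx => /(_ x0).
have injR x z u : R x u -> R z u -> x = z.
  move=> hx hz; apply/eqP; rewrite -subr_eq0; apply: contraT => n0.
  have := dg0_neq0 DR (ringrelB (dg_ring DR) hx hz) n0.
  by rewrite subrr eqxx.
have [|||s [sB sM sb hs]] := @graph_aut _ k tree R DR.
- by move=> c /kF/RF.
- by move=> x [n /Rx[u h e]]; exists u => //; exists n.
(* [R] is injective and maps the finite level to itself, so it permutes it. *)
- move=> u [n e]; have [l hl] := level_finite iota f n (Some b).
  pose l' := [seq x <- pmap id l | iter n reval (Some x) == Some b].
  have l'P x : x \in l' <-> iter n reval (Some x) = Some b.
    rewrite mem_filter; split=> [/andP[/eqP]//|h]; rewrite h eqxx.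
    by rewrite mem_pmap map_id; exact: hl.
  have [||x /l'P xl h] := @surj_on_list _ l' R _ injR u; last by exists x => //; exists n.
    by move=> x /l'P/Rx[w h1 /l'P h2]; exists w.
  exact/l'P.
have saut : is_galois_aut FA s.
  split=> // x xF; apply/val_inj/(pg_fun PR (hs x)); exact: RF.
exists (Gal (introT (asboolP _) saut)) => /=.
by apply: (pg_fun PR (hs y)); exact: R0R.
Qed.

Hypothesis sepcl : forall p : {poly Om}, separable_poly p -> (1 < size p)%N ->
  exists x, root p x.

(** By [conj_lift] every root of the separable minimal polynomial is a conjugate of [y], hence equal
    to [y]; so the polynomial is linear. *)
Lemma gal_fixed_field (y : subfld_of A) :
  (exists p : {poly Om}, [/\ separable_poly p, pover F p & root p (val y)]) ->
  (forall s : gal FA, s y = y) -> val y \in F.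
Proof.
move=> [q [qsep qF qy]] hy.
have [|p [pm pF py pmin]] := @minpoly_ex _ F (val y).
  by exists q; split=> //; exact: separable_poly_neq0.
have psep := dvdp_separable (pmin _ qF qy) qsep.
have [rs urs ep] := separable_split sepcl psep.
rewrite (monicP pm) scale1r in ep.
have yrs : val y \in rs by move: py; rewrite ep root_prod_XsubC.
have hrs y' : y' \in rs -> y' = val y.
  move=> y'rs; have py' : root p y' by rewrite ep root_prod_XsubC.
  have [|s hs] := conj_lift pm pF py pmin py'; last by rewrite -hs hy.
  by apply: (@coprimep_root _ p) py'; move: psep; rewrite unlock.
have ers : rs = [:: val y].
  move: urs yrs hrs; clear ep; case: rs => [//|z [|w rs]] urs yrs h.
    by congr [:: _]; apply: h; rewrite inE.
  have /andP[zwrs _] := urs.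
  have zw : z = w by rewrite (h w) ?inE ?eqxx ?orbT //; apply: h; rewrite inE eqxx.
  by rewrite zw inE eqxx in zwrs.
have := pF 0%N; rewrite ep ers big_seq1 coefB coefX coefC sub0r => h.
by rewrite -[val y]opprK; exact: subfldN.
Qed.

End TreeGalois.

(** * Tame ramification *)

Section Valuation.
Variables (L : fieldType) (k : {pred L}) (v : L -> int).
Hypothesis vP : normalized_valuation k v.

Lemma nvalM x y : x != 0 -> y != 0 -> v (x * y) = v x + v y.
Proof. by have [h _ _ _] := vP; exact: h. Qed.

Lemma nval1 : v 1 = 0.
Proof.
have := nvalM (oner_neq0 L) (oner_neq0 L); rewrite mulr1 => /eqP.
by rewrite -{1}[v 1]addr0 (inj_eq (addrI _)) eq_sym => /eqP.
Qed.

Lemma nvalV x : x != 0 -> v x^-1 = - v x.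
Proof.
move=> x0; apply/eqP; rewrite -addr_eq0 -nvalM ?invr_eq0 // mulVf //.
by rewrite nval1.
Qed.

Lemma nvalN x : v (- x) = v x.
Proof.
have [->|x0] := eqVneq x 0; first by rewrite oppr0.
have n0 : (-1 : L) != 0 by rewrite oppr_eq0 oner_neq0.
have : v (-1) + v (-1) = 0 by rewrite -nvalM // mulrNN mulr1 nval1.
rewrite -[- x]mulN1r nvalM // => e; have -> : v (-1) = 0; last by rewrite add0r.
by move/eqP: e; rewrite -mulr2n -mulr_natr mulf_eq0 orbF => /eqP.
Qed.

Lemma val_integer0 : val_integer v 0. Proof. by left. Qed.
Lemma val_integer1 : val_integer v 1. Proof. by right; rewrite nval1. Qed.

Lemma val_maximal_integer x : val_maximal v x -> val_integer v x.
Proof. by case=> [->|h]; [left|right; exact: Order.POrderTheory.ltW]. Qed.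

Lemma val_integerM x y : val_integer v x -> val_integer v y -> val_integer v (x * y).
Proof.
have [->|x0] := eqVneq x 0; first by rewrite mul0r; left.
have [->|y0] := eqVneq y 0; first by rewrite mulr0; left.
case=> [/eqP|hx]; first by rewrite (negPf x0).
case=> [/eqP|hy]; first by rewrite (negPf y0).
by right; rewrite nvalM //; exact: Num.Theory.addr_ge0.
Qed.

Lemma val_maximalM x y : val_maximal v x -> val_integer v y -> val_maximal v (x * y).
Proof.
have [->|x0] := eqVneq x 0; first by rewrite mul0r; left.
have [->|y0] := eqVneq y 0; first by rewrite mulr0; left.
case=> [/eqP|hx]; first by rewrite (negPf x0).
case=> [/eqP|hy]; first by rewrite (negPf y0).
by right; rewrite nvalM //; exact: Num.Theory.ltr_wpDr.
Qed.

Lemma val_integerN x : val_integer v x -> val_integer v (- x).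
Proof. by case=> [->|h]; [left; rewrite oppr0|right; rewrite nvalN]. Qed.

Lemma val_maximalN x : val_maximal v x -> val_maximal v (- x).
Proof. by case=> [->|h]; [left; rewrite oppr0|right; rewrite nvalN]. Qed.

Lemma val_integerD x y : val_integer v x -> val_integer v y -> val_integer v (x + y).
Proof.
have [->|x0] := eqVneq x 0; first by rewrite add0r.
have [->|y0] := eqVneq y 0; first by rewrite addr0.
have [->|xy0] := eqVneq (x + y) 0; first by left.
case=> [/eqP|hx]; first by rewrite (negPf x0).
case=> [/eqP|hy]; first by rewrite (negPf y0).
right; have [_ h _ _] := vP; apply: Order.POrderTheory.le_trans (h _ _ x0 y0 xy0).
by rewrite Order.TotalTheory.le_min hx hy.
Qed.

Lemma val_maximalD x y : val_maximal v x -> val_maximal v y -> val_maximal v (x + y).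
Proof.
have [->|x0] := eqVneq x 0; first by rewrite add0r.
have [->|y0] := eqVneq y 0; first by rewrite addr0.
have [->|xy0] := eqVneq (x + y) 0; first by left.
case=> [/eqP|hx]; first by rewrite (negPf x0).
case=> [/eqP|hy]; first by rewrite (negPf y0).
right; have [_ h _ _] := vP; apply: Order.POrderTheory.lt_le_trans (h _ _ x0 y0 xy0).
by rewrite Order.TotalTheory.lt_min hx hy.
Qed.

(** Congruence modulo the maximal ideal within the field itself: residues are represented by
    elements, without forming the residue field. *)
Definition val_cong x y :=
  [/\ val_integer v x, val_integer v y & val_maximal v (x - y)].

Lemma val_cong_ring : ringrel val_cong.
Proof.
split.
- by split; rewrite ?subrr; [exact: val_integer1|exact: val_integer1|left].
- move=> x y u w [xi ui xu] [yi wi yw]; split.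
  + by apply: val_integerD => //; exact: val_integerN.
  + by apply: val_integerD => //; exact: val_integerN.
  + have -> : x - y - (u - w) = (x - u) - (y - w).
      by ring.
    by apply: val_maximalD => //; exact: val_maximalN.
- move=> x y u w [xi ui xu] [yi wi yw]; split; try exact: val_integerM.
  have -> : x * y - u * w = (x - u) * y + (y - w) * u by ring.
  by apply: val_maximalD; apply: val_maximalM.
Qed.

Lemma val_const_integer c : c \in k -> val_integer v c.
Proof.
move=> ck; have [->|c0] := eqVneq c 0; first by left.
by right; have [_ _ _ ->] := vP.
Qed.

Lemma val_cong_const c : c \in k -> val_cong c c.
Proof. by move=> ck; split; rewrite ?subrr; [exact: val_const_integer..|left]. Qed.

Lemma val_cong_unit x c : c \in k -> c != 0 -> val_cong x c -> x != 0 /\ v x = 0.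
Proof.
move=> ck c0 [xi ci xc]; have vc : v c = 0 by have [_ _ _ ->] := vP.
have nm : ~ val_maximal v c by case=> [/eqP|]; rewrite ?(negPf c0) // vc.
have x0 : x != 0.
  by apply/eqP => x0; apply: nm; move: xc => /val_maximalN; rewrite x0 sub0r opprK.
split=> //; case: xi => [/eqP|]; first by rewrite (negPf x0).
rewrite Order.POrderTheory.le_eqVlt => /predU1P[//|xm]; case: nm.
have -> : c = x - (x - c) by rewrite subKr.
by apply: val_maximalD; [right|exact: val_maximalN].
Qed.

Lemma val_cong_div x y c d : d \in k -> d != 0 -> val_cong x c -> val_cong y d ->
  val_cong (x / y) (c / d).
Proof.
move=> dk d0 hx hy; have [y0 vy] := val_cong_unit dk d0 hy.
apply: (ringrelM val_cong_ring) => //; have vd : v d = 0 by have [_ _ _ ->] := vP.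
have yi : val_integer v y^-1 by right; rewrite nvalV // vy oppr0.
have di : val_integer v d^-1 by right; rewrite nvalV // vd oppr0.
split=> //; have -> : y^-1 - d^-1 = - (y - d) * (y^-1 * d^-1).
  rewrite opprB mulrBl mulrCA divff // mulr1 mulrA divff // mul1r.
  by [].
apply: val_maximalM; last exact: val_integerM.
by apply: val_maximalN; case: hy.
Qed.

End Valuation.

(** * The valuation of a rational function field at an irreducible polynomial *)

Section AdicValuation.
Variables (L : fieldType) (E : subfld L) (x : L) (h : {poly L}).
Hypotheses (xE : forall p, pover E p -> p.[x] = 0 -> p = 0)
  (hE : pover E h) (sh : (1 < size h)%N)
  (hmin : forall d, pover E d -> d %| h -> (1 < size d)%N -> h %| d).
Local Notation N := (adjoin E [set x]%classic).

Lemma adic_neq0 : h != 0.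
Proof. by rewrite -size_poly_gt0 (ltnW sh). Qed.

Lemma adic_coprime g : pover E g -> ~~ (h %| g) -> coprimep h g.
Proof.
move=> gE; apply: contraNT => ncop; apply: dvdp_trans (dvdp_gcdr h g).
apply: hmin; [exact: pover_gcdp|exact: dvdp_gcdl|].
have : gcdp h g != 0 by rewrite gcdp_eq0 negb_and adic_neq0.
by move: ncop; rewrite /coprimep -size_poly_gt0; case: (size _) => [|[]].
Qed.

Lemma adic_prime g g' : pover E g -> ~~ (h %| g) -> ~~ (h %| g') -> ~~ (h %| g * g').
Proof. by move=> gE hg; rewrite Gauss_dvdpr // adic_coprime. Qed.

Lemma adic_order g : g != 0 -> pover E g ->
  exists j g1, [/\ pover E g1, ~~ (h %| g1) & g = h ^+ j * g1].
Proof.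
move: {2}(size g) (leqnn (size g)) => m.
elim: m g => [|m IH] g sg g0 gE; first by move: sg; rewrite leqn0 size_poly_eq0 (negPf g0).
case: (boolP (h %| g)) => [/divpK e|hg]; last first.
  by exists 0%N, g; rewrite expr0 mul1r.
have q0 : g %/ h != 0 by apply: contra_neq g0 => q0; rewrite -e q0 mul0r.
have [||j [g1 [g1E hg1 e1]]] := IH (g %/ h) _ q0.
- move: sg; rewrite -{1}e size_mul ?adic_neq0 // => sg.
  rewrite -ltnS; apply: leq_trans sg; move: sh; case: (size h) => [//|[//|n]] _.
  by rewrite !addnS /= ltnS leq_addr.
- exact: pover_divp.
exists j.+1, g1; split=> //; rewrite -{1}e {1}e1 exprS mulrC mulrA.
by [].
Qed.

Lemma adic_ndvd_neq0 g : pover E g -> ~~ (h %| g) -> g.[x] != 0.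
Proof. by move=> gE; apply: contra => /eqP/(xE gE) ->; rewrite dvdp0. Qed.

Lemma adic_hx : h.[x] != 0.
Proof. by apply/eqP => /(xE hE)/eqP; rewrite (negPf adic_neq0). Qed.

(** The order of [y] along [h], as a relation; existence and uniqueness of [z] turn it into a
    valuation by choice. *)
Definition adic_rel (y : subfld_of N) (z : int) := exists g g',
  [/\ pover E g, pover E g', ~~ (h %| g), ~~ (h %| g') &
    val y = h.[x] ^ z * (g.[x] / g'.[x])].

Lemma adic_rel_ex y : y != 0 -> exists z, adic_rel y z.
Proof.
move=> y0; have [n [d [nE dE d0 ey]]] := adjoin_frac (valP y).
have n0 : n != 0.
  apply: contra_neq y0 => n0; apply/val_inj; rewrite ey n0 horner0 mul0r.
  by [].
have d0' : d != 0 by apply: contra_neq d0 => ->; rewrite horner0.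
have [i [g [gE hg en]]] := adic_order n0 nE.
have [j [g' [gE' hg' ed]]] := adic_order d0' dE.
exists (i%:Z - j%:Z), g, g'; split=> //.
rewrite ey en ed !hornerM !horner_exp expfzDr ?adic_hx //.
by rewrite -mulf_div -exprnP -exprnN.
Qed.

Lemma adic_rel_uniq_le y z w : adic_rel y z -> adic_rel y w -> (z <= w)%R -> z = w.
Proof.
move=> [g1 [g1' [E1 E1' h1 h1' e1]]] [g2 [g2' [E2 E2' h2 h2' e2]]] zw.
have [j ej] : exists j : nat, w = z + j%:Z.
  by exists `|w - z|%N; rewrite gez0_abs ?Num.Theory.subr_ge0 // [z + _]addrC subrK.
have hz : h.[x] ^ z != 0 by rewrite expfz_neq0 // adic_hx.
have g1'0 := adic_ndvd_neq0 E1' h1'; have g2'0 := adic_ndvd_neq0 E2' h2'.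
have : (g1 * g2' - h ^+ j * (g2 * g1')).[x] = 0.
  apply/eqP; rewrite hornerD hornerN !hornerM subr_eq0 horner_exp; apply/eqP.
  have := e1; rewrite e2 ej expfzDr ?adic_hx // -mulrA => /(mulfI hz).
  rewrite -exprnP => e; have : h.[x] ^+ j * (g2.[x] / g2'.[x]) * (g1'.[x] * g2'.[x]) =
    g1.[x] / g1'.[x] * (g1'.[x] * g2'.[x]) by rewrite e.
  have -> : g1.[x] / g1'.[x] * (g1'.[x] * g2'.[x]) = g1.[x] * g2'.[x] by field.
  by move=> <-; field.
move/xE => /(_ _)/eqP; rewrite subr_eq0 => H.
have {H}/eqP H : g1 * g2' == h ^+ j * (g2 * g1').
  apply: H; apply: poverB; first exact: poverM.
  by apply: poverM; [exact: pover_exp|exact: poverM].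
case: j ej H => [|j] ej H; first by rewrite ej addr0.
by have := adic_prime E1 h1 h2'; rewrite H exprS -mulrA dvdp_mulIl.
Qed.

Lemma adic_rel_uniq y z w : adic_rel y z -> adic_rel y w -> z = w.
Proof.
move=> hz hw; case: (Order.TotalTheory.leP z w) => [zw|/Order.POrderTheory.ltW wz].
  exact: adic_rel_uniq_le hz hw zw.
exact/esym/(adic_rel_uniq_le hw hz wz).
Qed.

Lemma adic_relM y y' z z' : adic_rel y z -> adic_rel y' z' -> adic_rel (y * y') (z + z').
Proof.
move=> [g1 [g1' [E1 E1' h1 h1' e1]]] [g2 [g2' [E2 E2' h2 h2' e2]]].
exists (g1 * g2), (g1' * g2'); split; try exact: poverM; try exact: adic_prime.
by rewrite rmorphM /= e1 e2 expfzDr ?adic_hx // !hornerM -mulf_div mulrACA.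
Qed.

Lemma adic_relD y y' z z' w : adic_rel y z -> adic_rel y' z' -> (z <= z')%R ->
  y + y' != 0 -> adic_rel (y + y') w -> (z <= w)%R.
Proof.
move=> [g1 [g1' [E1 E1' h1 h1' e1]]] [g2 [g2' [E2 E2' h2 h2' e2]]] zz' y0 hw.
have [j ej] : exists j : nat, z' = z + j%:Z.
  by exists `|z' - z|%N; rewrite gez0_abs ?Num.Theory.subr_ge0 // [z + _]addrC subrK.
have g1'0 := adic_ndvd_neq0 E1' h1'; have g2'0 := adic_ndvd_neq0 E2' h2'.
pose G := g1 * g2' + h ^+ j * (g2 * g1').
have GE : pover E G.
  apply: poverD; first exact: poverM.
  by apply: poverM; [exact: pover_exp|exact: poverM].
have e : val (y + y') = h.[x] ^ z * (G.[x] / (g1' * g2').[x]).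
  rewrite rmorphD /= e1 e2 ej expfzDr ?adic_hx // -exprnP /G hornerD !hornerM horner_exp.
  by field; rewrite g1'0 g2'0.
have G0 : G != 0.
  apply: contra_neq y0 => G0; apply/val_inj; rewrite e G0 horner0 mul0r mulr0.
  by [].
have [i [G1 [G1E hG1 eG]]] := adic_order G0 GE.
have : adic_rel (y + y') (z + i%:Z).
  exists G1, (g1' * g2'); split=> //; [exact: poverM|exact: adic_prime|].
  by rewrite e eG expfzDr ?adic_hx // hornerM horner_exp -exprnP !mulrA.
by move/(adic_rel_uniq hw) ->; rewrite Num.Theory.lerDl.
Qed.

Lemma adic_valuation : exists v : subfld_of N -> int,
  [/\ normalized_valuation [pred y : subfld_of N | val y \in E] v,
    forall y, y != 0 -> adic_rel y (v y) &
    forall y z, y != 0 -> adic_rel y z -> v y = z].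
Proof.
have /choice[v hv] : forall y, exists z, y != 0 -> adic_rel y z.
  by move=> y; have [->|/adic_rel_ex[z hz]] := eqVneq y 0; [exists 0|exists z].
have vu y z : y != 0 -> adic_rel y z -> v y = z.
  by move=> y0; exact: adic_rel_uniq (hv _ y0).
have h1 : ~~ (h %| 1).
  by rewrite dvdp1; case: (size h) sh => [|[]].
exists v; split=> //; split.
- move=> y y' y0 y0'; apply: vu; first exact: mulf_neq0.
  by apply: adic_relM; exact: hv.
- move=> y y' y0 y0' s0; case: (Order.TotalTheory.leP (v y) (v y')) => [le|/Order.POrderTheory.ltW le].
    exact: adic_relD (hv _ y0) (hv _ y0') le s0 (hv _ s0).
  rewrite addrC in s0 *; exact: adic_relD (hv _ y0') (hv _ y0) le s0 (hv _ s0).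
- have hN : h.[x] \in N.
    apply: pover_horner; last exact: mem_adjoin.
    by move=> i; apply: mem_adjoin_base; exact: hE.
  have y0 : SubfldOf hN != 0.
    by apply: contraNneq adic_hx => /(congr1 val) /= ->.
  exists (SubfldOf hN) => //; apply: vu => //; exists 1, 1.
  by rewrite expr1z hornerC divr1 mulr1; split=> //; exact: pover1.
- move=> y yE y0; apply: vu => //; exists (val y)%:P, 1.
  rewrite expr0z mul1r !hornerC divr1; split=> //; [exact: poverC|exact: pover1|].
  rewrite gtNdvdp ?polyC_eq0 //.
  by rewrite size_polyC (leq_ltn_trans _ sh) // leq_b1.
Qed.

End AdicValuation.

(** * Fibers over constants under tame ramification *)

Section TameFiber.
Variables (K Om : fieldType) (iota : {rmorphism K -> Om}) (f : ratmap K) (t x : Om).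
Local Notation Kb := (Kbar iota).
Local Notation N := (adjoin Kb [set x]%classic).
Local Notation reval := (reval iota f).
Local Notation num := (map_poly iota (rnum f)).
Local Notation den := (map_poly iota (rden f)).
Hypotheses (xK : x \notin Kb) (xt : reval (Some x) = Some t)
  (tame : @tamely_ramified_ext (subfld_of N) [pred y | val y \in Kb]
    [pred y | val y \in adjoin Kb [set t]%classic]).

Section Factor.
Variables (q : option Om) (h : {poly Om}).
Hypotheses (qK : algpt iota q) (hE : pover Kb h) (sh : (1 < size h)%N)
  (hmin : forall d, pover Kb d -> d %| h -> (1 < size d)%N -> h %| d)
  (hq : h %| fiber_poly iota f q).

Let xE p : pover Kb p -> p.[x] = 0 -> p = 0 := @Kbar_transc _ _ _ p x xK.

Let h1 : ~~ (h %| 1).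
Proof. by rewrite dvdp1; case: (size h) sh => [|[]]. Qed.

Lemma tame_not_both : ~ (h %| num /\ h %| den).
Proof.
move=> [hn hd]; have := coprimep_dvdr hn (coprimep_dvdl hd (num_den_coprime iota f)).
by rewrite coprimepp; case: (size h) sh => [|[]].
Qed.

Lemma den_neq0 : den != 0.
Proof. exact: (fiber_neq0 iota f None). Qed.

Let numE : pover Kb num := pover_iota (rnum f) (iota_Kbar iota).
Let denE : pover Kb den := pover_iota (rden f) (iota_Kbar iota).

Lemma horner_transc (g : {poly Om}) : g != 0 -> pover Kb g -> g.[x] != 0.
Proof. by move=> g0 gE; apply: contra_neq g0; exact: xE. Qed.

(* A uniformizing coordinate w of Kbar(t) that vanishes at the place: t - q, or
   1/t when q is infinity. *)
Lemma tame_coordinate : exists w : Om,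
  (forall c, c \in adjoin Kb [set t]%classic -> c \in adjoin Kb [set w]%classic) /\
  exists g g', [/\ pover Kb g, pover Kb g', h %| g, ~~ (h %| g') &
    g != 0 /\ w = g.[x] / g'.[x]].
Proof.
have denx : den.[x] != 0 by apply: horner_transc => //; exact: den_neq0.
have et : t = num.[x] / den.[x].
  by have := xt; rewrite /= /ratdiv (negPf denx) => -[].
case: q qK hq => [c|] cK /= hd.
- exists (t - c); split.
    apply: adjoin_min => [z zK|z ->]; first exact: mem_adjoin_base.
    have cE : c \in adjoin Kb [set t - c]%classic.
      by apply: mem_adjoin_base; exact: cK.
    have tc : t - c \in adjoin Kb [set t - c]%classic by exact: mem_adjoin.
    by have := subfldD tc cE; rewrite subrK.
  exists (num - c *: den), den; split=> //.
  + by apply: poverB => //; apply: poverZ => //; exact: cK.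
  + apply/negP => hden; apply: tame_not_both; split=> //.
    have -> : num = (num - c *: den) + c *: den by rewrite subrK.
    by apply: dvdp_add => //; rewrite -mul_polyC; exact: dvdp_mull.
  + split; first exact: (fiber_neq0 iota f (Some c)).
    by rewrite et !hornerE; field.
- exists t^-1; split.
    apply: adjoin_min => [z zK|z ->]; first exact: mem_adjoin_base.
    have tV : t^-1 \in adjoin Kb [set t^-1]%classic by exact: mem_adjoin.
    by have := subfldV tV; rewrite invrK.
  exists den, num; split=> //.
  + by apply/negP => hn; exact: tame_not_both.
  + split; first exact: den_neq0.
    by rewrite et invf_div.
Qed.

(** The [h]-adic place of [Kbar(x)] lies over the place [t = q] of [Kbar(t)], whose residue field is
    [Kbar]. Separability of the residue class of [x] yields [P] over [Kbar] with [h] dividing [P]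
    but not its derivative, so [h] does not divide its own derivative. *)
Lemma tame_factor_separable : separable_poly h.
Proof.
have [v [vP vr vu]] := adic_valuation xE hE sh hmin.
have vmax g g' (y : subfld_of N) : pover Kb g -> pover Kb g' -> h %| g ->
    ~~ (h %| g') -> val y = g.[x] / g'.[x] -> val_maximal v y.
  move=> gE gE' hg hg' ey; have [y0|y0] := eqVneq y 0; [by left|right].
  have g0 : g != 0.
    by apply: contra_neq y0 => g0; apply/val_inj; rewrite ey g0 horner0 mul0r.
  have [[|j] [g1 [g1E hg1 eg]]] := adic_order hE sh g0 gE.
    by move: hg hg1; rewrite eg expr0 mul1r => ->.
  rewrite (vu y j.+1%:Z) //; exists g1, g'; split=> //.
  by rewrite ey eg hornerM horner_exp -exprnP mulrA.
have xN : x \in N by exact: mem_adjoin.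
have KN c : c \in Kb -> c \in N by exact: mem_adjoin_base.
have vint g (y : subfld_of N) : pover Kb g -> val y = g.[x] -> val_integer v y.
  move=> gE ey; have [y0|y0] := eqVneq y 0; [by left|right].
  have g0 : g != 0 by apply: contra_neq y0 => g0; apply/val_inj; rewrite ey g0 horner0.
  have [j [g1 [g1E hg1 eg]]] := adic_order hE sh g0 gE.
  rewrite (vu y j%:Z) //; exists g1, 1; split=> //; first exact: pover1.
  by rewrite ey eg hornerM horner_exp -exprnP hornerC divr1.
have vmaxh g (y : subfld_of N) : pover Kb g -> val y = g.[x] -> val_maximal v y -> h %| g.
  move=> gE ey; have [->|g0] := eqVneq g 0; first by rewrite dvdp0.
  have y0 : y != 0.
    by apply: contraNneq (horner_transc g0 gE) => y0; rewrite -ey y0.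
  have [[|j] [g1 [g1E hg1 eg]]] := adic_order hE sh g0 gE.
    case=> [/eqP|]; first by rewrite (negPf y0).
    rewrite (vu y 0) //; exists g, 1; rewrite expr0z hornerC divr1 mul1r; split=> //.
      exact: pover1.
    by rewrite eg expr0 mul1r.
  by rewrite eg exprS -mulrA dvdp_mulIl.
have [w [tw [g [g' [gE gE' hg hg' [g0 ew]]]]]] := tame_coordinate.
have wN : w \in N.
  by rewrite ew; apply: subfld_div; apply: pover_horner => // i; apply: KN;
    [exact: gE|exact: gE'].
pose W := SubfldOf wN.
have Wmax : val_maximal v W by exact: (vmax _ _ W gE gE' hg hg' ew).
have W0 : w != 0.
  rewrite ew mulf_neq0 ?invr_eq0 ?horner_transc //.
  by apply: contraNneq hg' => ->; rewrite dvdp0.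
have CR := val_cong_ring vP.
have Wc : val_cong v W 0.
  by split; rewrite ?subr0 //; [exact: val_maximal_integer|exact: val_integer0].
(* An integral element of [Kbar(t)] is a reduced fraction in [w], congruent to its value at [w = 0];
   a zero of the denominator there would be a pole. *)
have resid (c : subfld_of N) : val c \in adjoin Kb [set t]%classic -> val_integer v c ->
    exists kap : subfld_of N, val kap \in Kb /\ val_cong v c kap.
  move=> /tw/adjoin_frac_coprime[n' [d' [n'E d'E d'0 cop ec]]] ci.
  have lift p : pover Kb p -> exists P : {poly subfld_of N},
      [/\ p = map_poly val P, polyrel (val_cong v) P P & P.[0] \in [pred y | val y \in Kb]].
    move=> pE; have /poverP[P eP] : pover N p by move=> i; apply: KN; exact: pE.
    exists P; split=> // [i|].
      by apply: (val_cong_const vP); have := pE i; rewrite {1}eP coef_map.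
    by have := pE 0%N; rewrite {1}eP coef_map -horner_coef0.
  have [nn [enn nc n0K]] := lift _ n'E; have [dd [edd dc d0K]] := lift _ d'E.
  have hn := polyrel_horner CR nc Wc; have hd := polyrel_horner CR dc Wc.
  have ec' : c = nn.[W] / dd.[W].
    by apply/val_inj; rewrite fmorph_div -!horner_map -enn -edd.
  have [dd0|dd0] := eqVneq dd.[0] 0; last first.
    exists (nn.[0] / dd.[0]); split.
      by rewrite fmorph_div; apply: subfld_div; [exact: n0K|exact: d0K].
    by rewrite ec'; exact: (val_cong_div vP).
  have nn0 : nn.[0] != 0.
    apply/negP => /eqP nn0.
    have aux (P : {poly subfld_of N}) p : p = map_poly val P -> P.[0] = 0 -> root p 0.
      move=> ->; rewrite rootE; have -> : 0 = val (0 : subfld_of N) by [].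
      by rewrite horner_map => ->.
    have := coprimep_root cop (aux _ _ enn nn0).
    by rewrite (rootP (aux _ _ edd dd0)) eqxx.
  have [nW0 vn] := val_cong_unit vP n0K nn0 hn.
  have dW0 : dd.[W] != 0.
    by apply: contra_neq d'0 => e; rewrite edd -[w]/(val W) horner_map e.
  have dmax : val_maximal v dd.[W] by case: hd; rewrite dd0 subr0.
  case: dmax => [/eqP|dpos]; first by rewrite (negPf dW0).
  case: ci => [/eqP|]; first by rewrite ec' mulf_eq0 invr_eq0 (negPf nW0) (negPf dW0).
  rewrite ec' (nvalM vP) ?invr_eq0 // (nvalV vP) // vn add0r Num.Theory.oppr_ge0.
  by rewrite Order.TotalTheory.leNgt dpos.
have [sepv _] := tame vP.
pose X := SubfldOf xN.
have XE : val X = ('X : {poly Om}).[x] by rewrite hornerX.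
have Xi : val_integer v X by apply: vint XE; exact: poverX.
have Xc : val_cong v X X by split; rewrite ?subrr //; left.
(* Residual separability is applied to the residue class of [x], and the coefficients of [p] are
   then replaced by congruent constants. *)
have [p [pc pX dpX]] := sepv X Xi.
have /choice[kap hkap] : forall i, exists kap : subfld_of N,
    val kap \in Kb /\ val_cong v p`_i kap.
  by move=> i; have [pt pint] := pc i; exact: resid.
pose pb := \poly_(i < size p) kap i.
have ppb : polyrel (val_cong v) p pb.
  move=> i; rewrite coef_poly; case: ltnP => [_|/(nth_default 0)->].
    by have [] := hkap i.
  exact: ringrel0 CR.
pose P := map_poly val pb.
have PE : pover Kb P.
  move=> i; rewrite coef_map coef_poly; case: ltnP => _.
    by have [] := hkap i.
  exact: subfld0.
have [_ _ c1] := polyrel_horner CR ppb Xc.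
have [_ _ c2] := polyrel_horner CR (polyrel_deriv CR ppb) Xc.
have e1 : val pb.[X] = P.[x] by rewrite -horner_map.
have e2 : val pb^`().[X] = P^`().[x] by rewrite deriv_map -horner_map.
have hP : h %| P.
  apply: (vmaxh P pb.[X]) => //; rewrite -[pb.[X]](subKr p.[X]).
  by apply: (val_maximalD vP) => //; exact: (val_maximalN vP).
have hP' : ~~ (h %| P^`()).
  apply/negP => hP'; apply: dpX; rewrite -[p^`().[X]](subrK pb^`().[X]).
  apply: (val_maximalD vP) => //; apply: (vmax _ 1 _ (pover_deriv PE) (pover1 _) hP' h1).
  by rewrite e2 hornerC divr1.
have hh' : ~~ (h %| h^`()).
  apply: contra hP' => hh'; rewrite -(divpK hP) derivM.
  by rewrite dvdp_add ?dvdp_mulIr // dvdp_mull.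
rewrite unlock; exact: (adic_coprime hE sh hmin (pover_deriv hE) hh').
Qed.

End Factor.

Hypothesis sepcl : forall p : {poly Om}, separable_poly p -> (1 < size p)%N ->
  exists x, root p x.

(** Irreducible factors over [Kbar] are separable, hence have roots in the separably closed [Om]. *)
Lemma tame_split (q : option Om) : algpt iota q -> exists rs : seq Om,
  fiber_poly iota f q = lead_coef (fiber_poly iota f q) *: \prod_(r <- rs) ('X - r%:P).
Proof.
move=> qK; apply: (split_prod_XsubC (E := Kb)) => [||g gE gq sg].
- by apply: pover_fiber => //; exact: iota_Kbar.
- exact: fiber_neq0.
have [h [hE sh hg hmin]] := irreducible_factor gE sg.
have hsep := tame_factor_separable qK hE sh hmin (dvdp_trans hg gq).
have [z hz] := sepcl hsep sh; exists z.
  by apply: Kbar_root hz => //; exact: separable_poly_neq0.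
by rewrite -(divpK hg) rootM hz orbT.
Qed.

(** A critical point in the fiber over [q] would reach [a] after [n.+1] steps. So the fiber, which
    splits, has no double point, whether finite or at infinity. *)
Lemma unramified_tame (a : Om) : a \in Kb -> ~ post_critical iota f a ->
  forall n q, iter n reval q = Some a -> unramified_over iota f q.
Proof.
move=> aK npc n q eq.
have qK : algpt iota q by apply/(algpt_iter iota f n); rewrite eq => _ [<-].
have ncrit r : reval r = q -> ~ critical_point iota f r.
  by move=> er cr; apply: npc; exists r, n.+1; rewrite iterSr er.
set F := fiber_poly iota f q; have F0 : F != 0 by exact: fiber_neq0.
have lF0 : lead_coef F != 0 by rewrite lead_coef_eq0.
have [rs ers] := tame_split qK; rewrite -/F in ers.
have urs : uniq rs.
  rewrite -separable_prod_XsubC unlock; apply: contraT => ncop.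
  set P := \prod_(_ <- _) _ in ncop ers.
  have P0 : P != 0 by apply: contra_neq F0 => P0; rewrite ers P0 scaler0.
  have [g [m eg]] : exists g, exists m, g = gcdp P P^`() /\ g %= \prod_(r <- mask m rs) ('X - r%:P).
    have [m em] := dvdp_prod_XsubC (dvdp_gcdl P P^`()).
    by exists (gcdp P P^`()), m.
  case: eg => eg eqg; case: (mask m rs) eqg => [|r l] eqg.
    by move: ncop; rewrite /coprimep -eg (eqp_size eqg) big_nil size_poly1.
  have : root g r by rewrite (eqp_root eqg) root_prod_XsubC inE eqxx.
  rewrite eg root_gcd => /andP[Pr P'r].
  have Fr : root F r by rewrite ers rootZ.
  have F'r : root F^`() r by rewrite ers derivZ rootZ.
  by case: (ncrit (Some r)); [apply/reval_fiber|exact: fiber_double Fr F'r].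
have szF : size F = (size rs).+1 by rewrite ers size_scale // size_prod_XsubC.
have rsq r : r \in map Some rs -> reval r = q.
  move=> /mapP[z zrs ->]; apply/reval_fiber; rewrite -/F ers rootZ //.
  by rewrite root_prod_XsubC.
have umap : uniq (map Some rs) by rewrite map_inj_uniq // => u w [].
have [FD|FD] := eqVneq F`_(rdeg f) 0; last first.
  exists (map Some rs); split=> //; rewrite size_map; apply/eqP.
  rewrite eqn_leq -ltnS -szF size_fiber -ltnS -szF ltnNge /=.
  by apply: contra FD => /(nth_default 0) ->.
have eN : reval None = q by apply/reval_fiber_inf.
exists (None :: map Some rs); split.
- by rewrite /= umap andbT; apply/negP => /mapP[].
- rewrite /= size_map -szF; have D0 := rdeg_gt0 f.
  have sF : (size F <= rdeg f)%N.
    apply/leq_sizeP => j; rewrite leq_eqVlt => /predU1P[<-//|jD].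
    by rewrite nth_default // (leq_trans (size_fiber _ _ _)).
  apply/eqP; rewrite eqn_leq sF /= leqNgt; apply/negP => lt.
  (* Two vanishing top coefficients make infinity a double zero of the form, hence a critical
     point. *)
  have FD1 : F`_(rdeg f).-1 = 0 by rewrite nth_default // -ltnS prednK.
  apply: (ncrit None eN); apply: (fmorph_inj iota); rewrite !rmorphM.
  move: FD FD1; rewrite /F; case: (q) => [c|] /=.
    rewrite !coefB !coefZ !coef_map => /eqP; rewrite subr_eq0 => /eqP -> /eqP.
    rewrite subr_eq0 => /eqP ->.
    by rewrite mulrAC.
  by rewrite !coef_map => -> ->; rewrite !mulr0.
- by move=> r; rewrite inE => /predU1P[->//|]; exact: rsq.
Qed.

End TameFiber.

(** * The place t = a *)

Section PlaceSpecialization.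
Variables (K : fieldType) (f : ratmap K) (Om : fieldType) (iota : {rmorphism K -> Om}).
Variables (t a : Om) (k : subfld Om).
Local Notation reval := (reval iota f).
Local Notation Kb := (Kbar iota).
Local Notation tree := (backward_orbit iota f).
Local Notation M := (adjoin k (tree t)).
Local Notation Ma := (adjoin k (tree a)).
Hypotheses (kinf : forall l : seq Om, exists2 c, c \in k & c \notin l)
  (iotak : forall c, iota c \in k) (kK : forall c, c \in k -> c \in Kb)
  (tK : t \notin Kb) (ak : a \in k)
  (unrt : forall n q, iter n reval q = Some t -> unramified_over iota f q)
  (unra : forall n q, iter n reval q = Some a -> unramified_over iota f q).

Lemma pover_transc (p : {poly Om}) : pover k p -> p.[t] = 0 -> p = 0.
Proof. by move=> pE; apply: (Kbar_transc tK) => i; exact/kK/pE. Qed.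

(** The local ring of [k[t]] at [t = a] with its residues. *)
Definition base_place (x u : Om) := exists n d,
  [/\ pover k n, pover k d, d.[a] != 0, x = n.[t] / d.[t] & u = n.[a] / d.[a]].

Lemma base_place_denom d : pover k d -> d.[a] != 0 -> d.[t] != 0.
Proof.
by move=> dE; apply: contra_neq => /(pover_transc dE) ->; rewrite horner0.
Qed.

Lemma base_place_poly p : pover k p -> base_place p.[t] p.[a].
Proof.
move=> pE; exists p, 1; rewrite !hornerC !divr1 oner_eq0; split=> //.
exact: pover1.
Qed.

Lemma base_place_const c : c \in k -> base_place c c.
Proof.
by move=> ck; have := base_place_poly (poverC ck); rewrite !hornerC.
Qed.

Lemma base_place_t : base_place t a.
Proof. by have := base_place_poly (poverX k); rewrite !hornerX. Qed.

Lemma base_dgraph : dgraph (t - a) base_place.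
Proof.
split; [split| | | |].
- by apply: base_place_const; exact: subfld1.
- move=> _ _ _ _ [n [d [nE dE d0 -> ->]]] [n' [d' [nE' dE' d0' -> ->]]].
  have h := base_place_denom dE d0; have h' := base_place_denom dE' d0'.
  exists (n * d' - n' * d), (d * d'); split.
  + by apply: poverB; apply: poverM.
  + exact: poverM.
  + by rewrite hornerM mulf_neq0.
  + by rewrite -mulNr addf_div // !hornerE mulNr.
  + by rewrite -mulNr addf_div // !hornerE mulNr.
- move=> _ _ _ _ [n [d [nE dE d0 -> ->]]] [n' [d' [nE' dE' d0' -> ->]]].
  exists (n * n'), (d * d'); split; try exact: poverM.
  + by rewrite hornerM mulf_neq0.
  + by rewrite !hornerM mulf_div.
  + by rewrite !hornerM mulf_div.
- move=> _ [n [d [nE dE d0 /esym/eqP e ->]]]; move: e.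
  rewrite mulf_eq0 invr_eq0 (negPf (base_place_denom dE d0)) orbF => /eqP.
  by move/(pover_transc nE) ->; rewrite horner0 mul0r.
- move=> _ _ [n [d [nE dE d0 -> ->]]]; rewrite mulf_eq0 negb_or => /andP[n0 _].
  by exists d, n; rewrite !invf_div.
- by have := base_place_poly (poverXsubC ak); rewrite !hornerXsubC subrr.
- move=> _ _ [n [d [nE dE d0 -> _]]]; rewrite mulf_eq0 negb_or => /andP[nt0 _].
  (* The exponent of the uniformizer [t - a] is the multiplicity of [a] as a root of the
     numerator. *)
  have [m [q qa eq]] := multiplicity_XsubC n a.
  have n0 : n != 0 by apply: contra_neq nt0 => ->; rewrite horner0.
  rewrite n0 /= in qa.
  have qE : pover k q.
    have -> : q = n %/ ('X - a%:P) ^+ m.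
      by rewrite eq mulpK // expf_neq0 // polyXsubC_eq0.
    by apply: pover_divp => //; apply: pover_exp; exact: poverXsubC.
  exists m, (q.[t] / d.[t]), (q.[a] / d.[a]); split.
  + by exists q, d.
  + by rewrite mulf_neq0 ?invr_eq0.
  + by rewrite eq hornerM horner_exp hornerXsubC mulrAC mulrC.
Qed.

Lemma tree_mem n x : iter n reval (Some x) = Some t -> x \in M.
Proof. by move=> e; apply: mem_adjoin; exists n. Qed.

(** The images one level lower have a common reduction and agree by induction, so [reduction_inj]
    applies within one fiber. *)
Lemma tree_reduction_inj (R : Om -> Om -> Prop) n p1 p2 q : pgraph M R ->
  (forall c, c \in k -> R c c) -> R t a ->
  iter n reval p1 = Some t -> iter n reval p2 = Some t ->
  point_rel R p1 q -> point_rel R p2 q -> p1 = p2.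
Proof.
move=> PR Rk Rt; have RK c : R (iota c) (iota c) by exact: Rk.
elim: n p1 p2 q => [|n IH] p1 p2 q; first by move=> /= -> ->.
move=> e1 e2 h1 h2; have := e1; have := e2; rewrite !iterSr => e2' e1'.
have r1 := reval_rel PR f RK h1; have r2 := reval_rel PR f RK h2.
have ey := IH _ _ _ e1' e2' r1 r2.
have eq : iter n reval (reval q) = Some a.
  have := iter_point_rel PR f RK n r1; rewrite e1' => h.
  exact: (point_rel_fun PR h (Rt : point_rel R (Some t) (Some a))).
have [c ck qc] := chart_exists iota f kinf (reval q).
apply: (reduction_inj PR RK r1 (Rk c ck) qc (unra eq)) h1 h2 => //.
- by move=> x ex; apply: (@tree_mem n.+1); rewrite -ex.
- by move=> x ex; apply: (@tree_mem n.+1); rewrite -ex.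
Qed.

(** By counting: the [rdeg f] points above a lift of the image of [q] have distinct reductions,
    which exhaust the fiber of [q]. *)
Lemma tree_reduction_surj (R : Om -> Om -> Prop) n q : pgraph M R ->
  (forall c, c \in k -> R c c) -> R t a -> iter n reval q = Some a ->
  exists2 p, iter n reval p = Some t & point_rel R p q.
Proof.
move=> PR Rk Rt; have RK c : R (iota c) (iota c) by exact: Rk.
elim: n q => [|n IH] q; first by move=> /= ->; exists (Some t).
move=> eq; have := eq; rewrite iterSr => eq'; have [y ey hy] := IH _ eq'.
have [rs [urs srs hrs]] := unrt ey.
have rsM r : r \in rs -> forall x, r = Some x -> x \in M.
  by move=> rrs x ex; apply: (@tree_mem n.+1); rewrite -ex iterSr hrs.
have /choice[g hg] : forall r, exists r', r \in rs -> point_rel R r r'.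
  move=> r; case: (boolP (r \in rs)) => [rrs|_]; last by exists None.
  by have [r' h] := point_rel_ex PR (rsM r rrs); exists r'.
have greval r : r \in rs -> reval (g r) = reval q.
  move=> rrs; apply: (point_rel_fun PR) hy; rewrite -(hrs r rrs).
  exact: (reval_rel PR f RK (hg r rrs)).
have [c ck qc] := chart_exists iota f kinf (reval q).
case: (boolP (q \in map g rs)) => [/mapP[r rrs ->]|qn].
  by exists r; [rewrite iterSr hrs|exact: hg].
have := @fiber_card _ _ _ _ (reval q) c (q :: map g rs) qc.
rewrite /= size_map srs qn ltnn map_inj_in_uniq ?urs; first last.
  move=> r r' rrs rrs' e; have h' := hg r' rrs'; rewrite -e in h'.
  apply: (tree_reduction_inj (n := n.+1) PR Rk Rt _ _ (hg r rrs) h');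
    by rewrite iterSr hrs.
move=> H; suff : false by []; apply: H => // r.
by rewrite inE => /predU1P[->//|/mapP[r' rrs' ->]]; exact: greval.
Qed.

Lemma place_exists : exists phi : subfld_of M -> option (subfld_of Ma),
  [/\ is_place phi,
      forall (x : subfld_of M) (c : subfld_of Ma), val x \in k -> val x = val c ->
        phi x = Some c
    & forall (x : subfld_of M) (c : subfld_of Ma), val x = t -> val c = a ->
        phi x = Some c].
Proof.
have kM c : c \in k -> c \in M by exact: mem_adjoin_base.
have kMa c : c \in k -> c \in Ma by exact: mem_adjoin_base.
have tM : t \in M by apply: (@tree_mem 0).
have treeM x : tree t x -> x \in M by exact: mem_adjoin.
have treeMa x : tree a x -> x \in Ma by exact: mem_adjoin.
have [|R [DR [R0R RA Rtree]]] := tree_extension kinf iotak kM kMa treeM treeMa unra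
    base_dgraph base_place_const base_place_t.
  move=> _ _ [n [d [nE dE _ -> ->]]].
  by split; apply: subfld_div; apply: pover_horner; auto => i; auto.
have Rk c : c \in k -> R c c by move=> ck; apply/R0R/base_place_const.
have Rt : R t a by apply/R0R/base_place_t.
have PR : pgraph M R.
  have PF := dg_pgraph DR; split.
  - exact: dg_ring DR.
  - exact: dg_0 DR.
  - by move=> x u /RA[].
  (* The domain is a field that contains [k] and each tree point or its inverse, hence all of
     [M]. *)
  - move=> x xM; apply: (pg_val PF); move: x xM; apply: adjoin_min.
      by move=> c ck; exact: mem_frac (Rk c ck).
    move=> x [n /Rtree[[u|] /= [h _]]]; first exact: mem_frac h.
    by case: h => _ h; rewrite -[x]invrK; apply: subfldV; exact: mem_frac h.
have /choice[phi hphi] : forall x : subfld_of M, exists o : option (subfld_of Ma),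
    if o is Some c then R (val x) (val c) else ~ exists u, R (val x) u.
  move=> x; case: (pselect (exists u, R (val x) u)) => [[u hu]|nu]; last by exists None.
  by have [_ uM] := RA _ _ hu; exists (Some (SubfldOf uM)).
have phiE x c : R (val x) (val c) -> phi x = Some c.
  move=> h; have := hphi x; case: (phi x) => [d hd|nu]; last by case: nu; exists (val c).
  by congr Some; apply/val_inj/(pg_fun PR hd).
have phiR x c : phi x = Some c -> R (val x) (val c).
  by move=> e; have := hphi x; rewrite e.
exists phi; split.
- split.
  + by apply: phiE; rewrite !rmorph1; exact: ringrel1 (pg_ring PR).
  + move=> x y u w /phiR hx /phiR hy; split; apply: phiE.
      by rewrite !rmorphD; exact: ringrelD (pg_ring PR) _ _ _ _ hx hy.
    by rewrite !rmorphM; exact: ringrelM (pg_ring PR) _ _ _ _ hx hy.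
  + move=> x e; apply: phiE; rewrite fmorphV rmorph0.
    case: (pg_val PR (valP x)) => // -[u hu].
    by have := hphi x; rewrite e => -[]; exists u.
  (* A finite point over [a] is the reduction of a point over [t], and points over [t] are finite
     because [t] is transcendental. *)
  + have resMa u : u \in Ma -> u \in res_subfld DR.
      move: u; apply: adjoin_min => [c ck|u [n]]; first exact: mem_res (Rk c ck).
      move=> /(tree_reduction_surj PR Rk Rt)[p ep h].
      have [x ex _] := tree_transc tK ep.
      by move: h; rewrite ex /= => h; exact: mem_res h.
    move=> u; have /res_predP[x hx] := resMa _ (valP u).
    by have [xM _] := RA _ _ hx; exists (SubfldOf xM); exact: phiE.
- by move=> x c xk xc; apply: phiE; rewrite -xc; exact: Rk.
- by move=> x c ex ec; apply: phiE; rewrite ex ec.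
Qed.

Section Place.
Variable phi : subfld_of M -> option (subfld_of Ma).
Hypotheses (phiP : is_place phi)
  (phik : forall (x : subfld_of M) (c : subfld_of Ma), val x \in k -> val x = val c ->
        phi x = Some c)
  (phit : forall (x : subfld_of M) (c : subfld_of Ma), val x = t -> val c = a ->
        phi x = Some c).

Definition place_graph (u w : Om) := exists (x : subfld_of M) (c : subfld_of Ma),
  [/\ u = val x, w = val c & phi x = Some c].

Lemma place_graph_pgraph : pgraph M place_graph.
Proof.
have PR := place_pgraph phiP; split.
- split.
  + by exists 1, 1; rewrite !rmorph1; split=> //; exact: ringrel1 (pg_ring PR).
  + move=> _ _ _ _ [x [c [-> -> h]]] [y [d [-> -> h']]]; exists (x - y), (c - d).
    by rewrite !rmorphB; split=> //; exact: ringrelB (pg_ring PR) _ _ _ _ h h'.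
  + move=> _ _ _ _ [x [c [-> -> h]]] [y [d [-> -> h']]]; exists (x * y), (c * d).
    by rewrite !rmorphM; split=> //; exact: ringrelM (pg_ring PR) _ _ _ _ h h'.
- move=> _ [x [c [/esym e -> h]]]; have x0 : x = 0 by exact: val_inj.
  by rewrite x0 in h; rewrite (pg_0 PR h) rmorph0.
- by move=> _ _ [x [c [-> _ _]]]; exact: valP.
- move=> x xM; case: (pg_val PR (isT : SubfldOf xM \in full_subfld _)) => [[u h]|h].
    by left; exists (val u), (SubfldOf xM), u.
  by right; exists (SubfldOf xM)^-1, 0; rewrite fmorphV rmorph0.
Qed.

Lemma place_graph_k c : c \in k -> place_graph c c.
Proof.
move=> ck; exists (SubfldOf (mem_adjoin_base (tree t) ck)).
by exists (SubfldOf (mem_adjoin_base (tree a) ck)); split=> //; exact: phik.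
Qed.

Lemma place_graph_t : place_graph t a.
Proof.
have tM : t \in M by apply: mem_adjoin; exists 0%N.
exists (SubfldOf tM), (SubfldOf (mem_adjoin_base (tree a) ak)).
by split=> //; exact: phit.
Qed.

Lemma place_point (x : subfld_of M) :
  point_rel place_graph (Some (val x)) (omap val (phi x)).
Proof.
case e: (phi x) => [u|] /=; first by exists x, u.
have /(place_None phiP)[x0 h] := e; split.
  by apply: contra x0 => /eqP x0; apply/eqP/val_inj.
by exists x^-1, 0; rewrite fmorphV rmorph0.
Qed.

Local Notation F := (adjoin k [set t]%classic).

Lemma kF c : c \in k -> c \in F. Proof. exact: mem_adjoin_base. Qed.
Lemma tF : t \in F. Proof. exact: mem_adjoin. Qed.
Lemma FM c : c \in F -> c \in M.
Proof.
move: c; apply: adjoin_min => [c|_ ->]; first exact: mem_adjoin_base.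
by apply: mem_adjoin; exists 0%N.
Qed.

Hypothesis sepF : forall y : subfld_of M, exists p : {poly Om},
  [/\ separable_poly p, pover F p & root p (val y)].
Hypothesis sepcl : forall p : {poly Om}, separable_poly p -> (1 < size p)%N ->
  exists x, root p x.

Local Notation G := (gal [pred x : subfld_of M | val x \in F]).
Local Notation Ga := (gal [pred x : subfld_of Ma | val x \in k]).

Lemma generic_finorb (x : subfld_of M) :
  exists O : seq (subfld_of M), forall s : G, s x \in O.
Proof. exact: (tree_finorb iotak kF FM tF). Qed.

Lemma generic_fixed (x : subfld_of M) : (forall s : G, s x = x) -> val x \in F.
Proof. exact: (gal_fixed_field kinf iotak kF FM tF unrt sepcl (sepF x)). Qed.

(** The place is forced on [k(t)]: in a reduced fraction whose denominator vanishes at [a], a finite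
    residue would make the numerator vanish there too. *)
Lemma generic_residue (x : subfld_of M) (u : subfld_of Ma) :
  val x \in F -> phi x = Some u -> val u \in k /\ base_place (val x) (val u).
Proof.
move=> /adjoin_frac_coprime[n' [d' [n'E d'E d't cop ex]]] e.
have PR := place_graph_pgraph.
have hpoly p : pover k p -> place_graph p.[t] p.[a].
  move=> pE; apply: (polyrel_horner (pg_ring PR)); last exact: place_graph_t.
  by move=> i; apply: place_graph_k; exact: pE.
have hx : place_graph (val x) (val u) by exists x, u.
have [da|da] := eqVneq d'.[a] 0; last first.
  have h : val u = n'.[a] / d'.[a].
    apply: (pg_fun PR hx); rewrite ex; apply: (ringrelM (pg_ring PR)); first exact: hpoly.
    by apply: (pg_inv PR) => //; exact: hpoly.
  split; last by exists n', d'.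
  by rewrite h; apply: subfld_div; exact: pover_horner.
have na : n'.[a] = 0.
  apply: (pg_fun PR (hpoly _ n'E)).
  have -> : n'.[t] = val x * d'.[t] by rewrite ex divfK.
  rewrite -(mulr0 (val u)) -da; apply: (ringrelM (pg_ring PR)) => //; exact: hpoly.
have := coprimep_root cop (introT rootP na).
by rewrite da eqxx.
Qed.

Lemma place_tree_inj (x : subfld_of M) (s r : G) : tree t (val x) ->
  phi (s x) = phi (r x) -> s x = r x.
Proof.
move=> [n ex] e.
have lev (s' : G) : iter n reval (Some (val (s' x))) = Some t.
  exact: (gal_level iotak kF FM tF).
have h1 := place_point (s x); have h2 := place_point (r x); rewrite e in h1.
have := tree_reduction_inj place_graph_pgraph place_graph_k place_graph_t
  (lev s) (lev r) h1 h2.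
by case=> h; exact: val_inj.
Qed.

Lemma place_specialization : exists spec : Ga -> G,
  [/\ {morph spec : r s / (r * s)%g}, injective spec,
    range spec = abs_decomposition (F := [pred x : subfld_of M | val x \in F]) phi &
    forall r x, phi (spec r x) = omap r (phi x)].
Proof.
apply: (@residue_automorphisms _ _ _ _ _ generic_finorb phiP _ _
  (fun x : subfld_of M => tree t (val x))).
- move=> x u /generic_fixed xF e; rewrite inE.
  by have [] := generic_residue xF e.
- move=> u uk; have uM := mem_adjoin_base (tree t) uk.
  by exists (SubfldOf uM); [exact: kF|exact: phik].
- exact: (tree_gen kF).
- exact: place_tree_inj.
Qed.

End Place.
End PlaceSpecialization.

Lemma polyrel_comp (A B : comNzRingType) (R : A -> B -> Prop) p q g h : ringrel R ->
  polyrel R p q -> polyrel R g h -> polyrel R (p \Po g) (q \Po h).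
Proof.
move=> RR hp hg; apply: (polyrel_horner (polyrel_ring RR)) hg => i.
by rewrite !coef_map; exact: polyrelC.
Qed.

(** * Extension of constants *)

Section ConstantExtension.
Variables (K : fieldType) (f : ratmap K) (Om : fieldType) (iota : {rmorphism K -> Om}).
Variables (t : Om) (k : subfld Om).
Local Notation reval := (reval iota f).
Local Notation Kb := (Kbar iota).
Local Notation tree := (backward_orbit iota f t).
Local Notation M := (adjoin k tree).
Local Notation B := (adjoin Kb tree).
Local Notation F := (adjoin k [set t]%classic).
Local Notation FB := (adjoin Kb [set t]%classic).
Local Notation G := (gal [pred x : subfld_of M | val x \in F]).
Local Notation GB := (gal [pred x : subfld_of B | val x \in FB]).
Hypotheses (kinf : forall l : seq Om, exists2 c, c \in k & c \notin l)
  (iotak : forall c, iota c \in k) (kK : forall c, c \in k -> c \in Kb)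
  (kalg : forall c, c \in M -> c \in Kb -> c \in k)
  (sepM : forall y, exists p : {poly Om}, [/\ separable_poly p, pover M p & root p y])
  (sepcl : forall p : {poly Om}, separable_poly p -> (1 < size p)%N ->
    exists x, root p x).

Let tM : t \in M. Proof. by apply: mem_adjoin; exists 0%N. Qed.
Let tB : t \in B. Proof. by apply: mem_adjoin; exists 0%N. Qed.
Let FM c : c \in F -> c \in M.
Proof. by move: c; apply: adjoin_min => [c|_ -> //]; exact: mem_adjoin_base. Qed.
Let FBB c : c \in FB -> c \in B.
Proof. by move: c; apply: adjoin_min => [c|_ -> //]; exact: mem_adjoin_base. Qed.
Let kF c : c \in k -> c \in F. Proof. exact: mem_adjoin_base. Qed.
Let KF c : c \in Kb -> c \in FB. Proof. exact: mem_adjoin_base. Qed.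
Let MB c : c \in M -> c \in B.
Proof.
move: c; apply: adjoin_min => [c /kK|c]; first exact: mem_adjoin_base.
exact: mem_adjoin.
Qed.

(* The minimal polynomial over M of a constant has constant roots, hence
   coefficients in the constants of M. *)
Lemma constant_minpoly al : al \in Kb -> exists p : {poly Om},
  [/\ p \is monic, pover k p, root p al, separable_poly p &
    forall q, pover M q -> root q al -> p %| q].
Proof.
move=> alK; have [q [qsep qM qal]] := sepM al.
have [|p [pm pM pal pmin]] := @minpoly_ex _ M al.
  by exists q; split=> //; exact: separable_poly_neq0.
have psep := dvdp_separable (pmin _ qM qal) qsep.
exists p; split=> //; have [rs _ ep] := separable_split sepcl psep.
have /mem_Kbar[P P0 Pal] := alK.
have PM : pover M (map_poly iota P).
  by apply: pover_iota => c; apply: mem_adjoin_base; exact: iotak.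
have pP := pmin _ PM Pal.
have rsK : {in rs, forall r, r \in Kb}.
  move=> r rrs; apply/mem_Kbar; exists P => //; rewrite -(divpK pP) rootM.
  by rewrite ep (monicP pm) scale1r root_prod_XsubC rrs orbT.
move=> i; apply: kalg; first exact: pM.
suff : pover Kb p by apply.
rewrite ep (monicP pm) scale1r; apply: pover_prod => r rrs.
by apply: poverXsubC; exact: rsK.
Qed.

(** Primitive element theorem over the infinite field [k]; it lets two elements of the compositum be
    written with one and the same constant. *)
Lemma constant_primitive al be : al \in Kb -> be \in Kb -> exists ga g h,
  [/\ ga \in Kb, pover k g, pover k h, al = g.[ga] & be = h.[ga]].
Proof.
move=> alK beK.
have [p [pm /poverP[p' ep] pal _ _]] := constant_minpoly alK.
have [q [qm /poverP[q' eq] qbe qsep _]] := constant_minpoly beK.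
have p'0 : p' != 0 by apply: contra_neq (monic_neq0 pm) => e; rewrite ep e rmorph0.
have q'sep : separable_poly q' by move: qsep; rewrite eq separable_map.
rewrite ep in pal; rewrite eq in qbe.
have [r r0 hr] := large_field_PET p'0 pal qbe q'sep.
have [l hl] := roots_finite r0.
have [c ck cl] := kinf l.
have [|[g eg] [h eh]] := hr (SubfldOf ck); first by apply: contra cl => /hl.
exists (c * be - al), (map_poly val g), (map_poly val h); split.
- by apply: subfldB => //; apply: subfldM => //; exact: kK.
- by apply/poverP; exists g.
- by apply/poverP; exists h.
- by rewrite -[LHS]eg.
- by rewrite -[LHS]eh.
Qed.

Section Lift.
Variable s : G.
Local Notation S := (graph_of s).
Let PS : pgraph M S := gal_pgraph s.
Let DS : dgraph 0 S := gal_dgraph s.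
Let RS := pg_ring PS.

(** The extension of [s] to the compositum of [M] and [Kbar] by the identity on constants.
    Polynomials in one constant suffice, since constants are algebraic over [M]. *)
Definition lift_rel (u w : Om) := exists al Q Qs,
  [/\ al \in Kb, polyrel S Q Qs, u = Q.[al] & w = Qs.[al]].

Let Sk c : c \in k -> S c c. Proof. by move=> ck; apply: (graph_fix FM); exact: kF. Qed.

Let Spoly Q : pover M Q -> exists Qs, polyrel S Q Qs.
Proof.
move=> QM; apply: (polyrel_liftr RS) => i.
by exists (val (s (SubfldOf (QM i)))), (SubfldOf (QM i)).
Qed.

Lemma lift_rel_common u w u' w' : lift_rel u w -> lift_rel u' w' ->
  exists al Q Qs Q' Qs', [/\ al \in Kb, polyrel S Q Qs, polyrel S Q' Qs',
    u = Q.[al] /\ w = Qs.[al] & u' = Q'.[al] /\ w' = Qs'.[al]].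
Proof.
move=> [al [Q [Qs [alK hQ -> ->]]]] [be [Q' [Qs' [beK hQ' -> ->]]]].
have [ga [g [h [gaK gk hk -> ->]]]] := constant_primitive alK beK.
have hg : polyrel S g g by move=> i; exact: Sk.
have hh : polyrel S h h by move=> i; exact: Sk.
exists ga, (Q \Po g), (Qs \Po g), (Q' \Po h), (Qs' \Po h).
rewrite !horner_comp; split=> //; exact: polyrel_comp.
Qed.

Lemma lift_rel_ring : ringrel lift_rel.
Proof.
split.
- exists 0, 1, 1; rewrite !hornerC; split=> //; first exact: subfld0.
  exact: ringrel1 (polyrel_ring RS).
- move=> u u' w w' h h'.
  have [al [Q [Qs [Q' [Qs' [alK hQ hQ' [-> ->] [-> ->]]]]]]] := lift_rel_common h h'.
  exists al, (Q - Q'), (Qs - Qs'); rewrite !hornerE; split=> //.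
  exact: ringrelB (polyrel_ring RS) _ _ _ _ hQ hQ'.
- move=> u u' w w' h h'.
  have [al [Q [Qs [Q' [Qs' [alK hQ hQ' [-> ->] [-> ->]]]]]]] := lift_rel_common h h'.
  exists al, (Q * Q'), (Qs * Qs'); rewrite !hornerE; split=> //.
  exact: ringrelM (polyrel_ring RS) _ _ _ _ hQ hQ'.
Qed.

(** The minimal polynomial of [al] over [M] divides [Q]; its coefficients lie in [k] and are fixed
    by [s], so it divides [Qs] too. *)
Lemma lift_rel0 u : lift_rel 0 u -> u = 0.
Proof.
move=> [al [Q [Qs [alK hQ /esym eQ ->]]]].
have [p [pm pk pal _ pmin]] := constant_minpoly alK.
have QM : pover M Q := pg_pover PS hQ.
have /divpK e := pmin _ QM (introT rootP eQ).
have [|q hq] := @Spoly (Q %/ p).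
  by apply: pover_divp => // i; apply: mem_adjoin_base; exact: pk.
have hp : polyrel S p p by move=> i; exact: Sk.
have := ringrelM (polyrel_ring RS) hq hp; rewrite e => /(pg_polyfun PS hQ) ->.
by rewrite hornerM (rootP pal) mulr0.
Qed.

Lemma lift_rel_fun u w w' : lift_rel u w -> lift_rel u w' -> w = w'.
Proof.
move=> h h'; apply/eqP; rewrite -subr_eq0; apply/eqP/lift_rel0.
by rewrite -(subrr u); exact: ringrelB lift_rel_ring _ _ _ _ h h'.
Qed.

(** A Bezout relation with the minimal polynomial of [al] writes the inverse as a polynomial in
    [al]. *)
Lemma lift_rel_inv u w : lift_rel u w -> u != 0 -> w != 0 /\ lift_rel u^-1 w^-1.
Proof.
move=> h u0; have [al [Q [Qs [alK hQ eu ew]]]] := h.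
have [p [pm pk pal _ pmin]] := constant_minpoly alK.
have QM : pover M Q := pg_pover PS hQ.
have pM : pover M p by move=> i; apply: mem_adjoin_base; exact: pk.
have cop : coprimep Q p.
  by apply: (minpoly_coprime pm pM pal pmin QM); rewrite rootE -eu.
have [[A C] /= [AM _ AC]] := pover_Bezout QM pM cop.
have [As hA] := Spoly AM.
have eA : A.[al] = u^-1.
  apply: (mulIf u0); rewrite mulVf // eu.
  have := congr1 (horner^~ al) AC.
  by rewrite hornerD !hornerM (rootP pal) mulr0 addr0 hornerC.
have h' : lift_rel u^-1 As.[al] by exists al, A, As; rewrite eA.
have : 1 = w * As.[al].
  apply: (lift_rel_fun (ringrel1 lift_rel_ring)).
  by rewrite -[X in lift_rel X](mulfV u0); exact: ringrelM lift_rel_ring _ _ _ _ h h'.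
move=> e; have w0 : w != 0.
  by apply: contra_eq_neq e => ->; rewrite mul0r oner_neq0.
split=> //; have -> // : w^-1 = As.[al].
by apply: (mulfI w0); rewrite divff.
Qed.

Lemma lift_dgraph : dgraph 0 lift_rel.
Proof.
split.
- exact: lift_rel_ring.
- exact: lift_rel0.
- move=> u w h w0; have [u0|u0] := eqVneq u 0.
    by move: h w0; rewrite u0 => /lift_rel0 ->; rewrite eqxx.
  by have [] := lift_rel_inv h u0.
- exact: ringrel0 lift_rel_ring.
- move=> u w h u0; exists 0%N, u, w; rewrite expr0 mul1r; split=> //.
  by have [] := lift_rel_inv h u0.
Qed.

Lemma lift_rel_M u w : S u w -> lift_rel u w.
Proof.
move=> h; exists 0, u%:P, w%:P; rewrite !hornerC; split=> //; first exact: subfld0.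
exact: polyrelC.
Qed.

Lemma lift_rel_K c : c \in Kb -> lift_rel c c.
Proof.
move=> cK; exists c, 'X, 'X; rewrite !hornerX; split=> //.
exact: polyrelX.
Qed.

Lemma gal_lift : exists r : GB, forall (x : subfld_of M) (y : subfld_of B),
  val x = val y -> val (s x) = val (r y).
Proof.
have lev n (s' : G) (x : subfld_of M) : iter n reval (Some (val x)) = Some t ->
    iter n reval (Some (val (s' x))) = Some t.
  exact: (gal_level iotak kF FM (mem_adjoin k (erefl t))).
have treeM x : tree x -> x \in M by exact: mem_adjoin.
have [|||r [rB rM rb hr]] := @graph_aut _ Kb tree lift_rel lift_dgraph.
- exact: lift_rel_K.
- move=> x [n xn]; have xM : x \in M by apply: treeM; exists n.
  exists (val (s (SubfldOf xM))); first by exists n; exact: lev.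
  by apply: lift_rel_M; exists (SubfldOf xM).
- move=> u [n un]; have uM : u \in M by apply: treeM; exists n.
  exists (val ((s^-1)%g (SubfldOf uM))); first by exists n; exact: lev.
  apply: lift_rel_M; exists ((s^-1)%g (SubfldOf uM)); split=> //.
  by rewrite galVK.
have raut : is_galois_aut [pred x : subfld_of B | val x \in FB] r.
  split=> // x xF; apply/val_inj/(lift_rel_fun (hr x)).
  have : val x \in FB by []; move: (val x) => {xF}; apply: adjoin_ind.
  + exact: lift_rel_K.
  + by move=> _ ->; apply: lift_rel_M; apply: (graph_fix FM); exact: mem_adjoin.
  + by move=> u w hu hw; exact: ringrelB lift_rel_ring _ _ _ _ hu hw.
  + move=> u w hu hw; apply: (ringrelM lift_rel_ring) => //.
    have [->|w0] := eqVneq w 0; first by rewrite invr0; exact: ringrel0 lift_rel_ring.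
    by have [] := lift_rel_inv hw w0.
exists (Gal (introT (asboolP _) raut)) => x y e /=.
apply: (lift_rel_fun _ (hr y)); apply: lift_rel_M; exists x; split=> //.
Qed.

End Lift.

Lemma gal_restrict (r : GB) : exists s : G, forall (x : subfld_of M) (y : subfld_of B),
  val x = val y -> val (s x) = val (r y).
Proof.
have lev n (r' : GB) (x : subfld_of B) : iter n reval (Some (val x)) = Some t ->
    iter n reval (Some (val (r' x))) = Some t.
  exact: (gal_level (iota_Kbar iota) KF FBB (mem_adjoin Kb (erefl t))).
have treeB x : tree x -> x \in B by exact: mem_adjoin.
have [|||s [sB sM sb hs]] := @graph_aut _ k tree (graph_of r) (gal_dgraph r).
- by move=> c ck; apply: (graph_fix FBB); apply: KF; exact: kK.
- move=> x [n xn]; have xB : x \in B by apply: treeB; exists n.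
  exists (val (r (SubfldOf xB))); first by exists n; exact: lev.
  by exists (SubfldOf xB).
- move=> u [n un]; have uB : u \in B by apply: treeB; exists n.
  exists (val ((r^-1)%g (SubfldOf uB))); first by exists n; exact: lev.
  by exists ((r^-1)%g (SubfldOf uB)); rewrite galVK.
have saut : is_galois_aut [pred x : subfld_of M | val x \in F] s.
  split=> // x xF; apply/val_inj/(pg_fun (gal_pgraph r) (hs x)).
  apply: (graph_fix FBB); have : val x \in F by [].
  move: (val x) => {xF}; apply: adjoin_min => [c /kK|_ ->]; first exact: KF.
  exact: mem_adjoin.
exists (Gal (introT (asboolP _) saut)) => x y e /=.
by apply: (pg_fun (gal_pgraph r) (hs x)); exists y.
Qed.

(* Restriction is an isomorphism of topological groups, so the Frattini
   subgroup is open for G as well. *)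
Lemma frattini_transfer : krull_open (@frattini _ _ : set GB) ->
  exists X : seq (subfld_of M), forall J : set G, maximal_open_subgroup J ->
    forall s : G, {in X, forall x, s x = x} -> J s.
Proof.
have /choice[res hres] := gal_restrict.
have /choice[lift hlift] := gal_lift.
have inM (x : subfld_of M) : val x \in B by exact: MB (valP x).
have resP (r : GB) (x : subfld_of M) : val (res r x) = val (r (SubfldOf (inM x))).
  exact: hres.
have resM r r' : res (r * r')%g = (res r * res r')%g.
  apply: gal_ext => x; apply/val_inj; rewrite galM !resP galM.
  congr (val (r _)); apply/val_inj => /=; exact/esym/resP.
have res1 : res 1%g = 1%g by apply: gal_ext => x; apply/val_inj; rewrite resP.
have resV r : res (r^-1)%g = (res r)^-1%g.
  have e : (res (r^-1) * res r)%g = 1%g.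
    by rewrite -resM -res1; congr res; apply: gal_ext => x; exact: galK.
  apply: gal_ext => x; rewrite -{1}(galVK (res r) x).
  exact: (congr1 (fun s : G => s ((res r)^-1%g x)) e).
have resL s : res (lift s) = s.
  by apply: gal_ext => x; apply/val_inj; rewrite resP -(hlift s x).
(* Both fields are generated by the same tree, over constants that the automorphisms fix. *)
have resI : injective res.
  move=> r r' e; apply: gal_ext => x; have [S [ST hS]] := tree_gen KF x.
  apply: hS => y /ST[n yn]; apply/val_inj.
  have yM : val y \in M by apply: mem_adjoin; exists n.
  by rewrite -(hres r (SubfldOf yM)) // -(hres r' (SubfldOf yM)) // e.
(* Openness at the identity: fixing the finite set [X] puts an automorphism in every maximal open
   subgroup. *)
move=> fo; have [|X hX] := fo 1%g.
  by move=> J [[[J1 _ _] _] _ _].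
have /choice[S hS] : forall x : subfld_of B, exists S : seq (subfld_of B),
    (forall y, y \in S -> tree (val y)) /\
    forall r r' : GB, {in S, forall y, r y = r' y} -> r x = r' x.
  by move=> x; exact: (tree_gen KF).
(* Elements of [X] need not lie in [M], but the tree points on which they depend do. *)
pose Y : seq (subfld_of M) := pmap insub (map val (flatten (map S X))).
exists Y => J [[[J1 JM JV] Jo] JT Jmax] s sY.
pose J' : set GB := fun r => J (res r).
suff mJ' : maximal_open_subgroup J'.
  rewrite -(resL s); apply: (hX (lift s) _ J' mJ') => x xX.
  have [ST hSx] := hS x; apply: (hSx (lift s) 1%g) => y yS; apply/val_inj.
  have [n yn] := ST y yS.
  have yM : val y \in M by apply: mem_adjoin; exists n.
  rewrite -(hlift s (SubfldOf yM)) // sY // mem_pmap_sub /=.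
  by apply: map_f; apply/flattenP; exists (S x) => //; exact: map_f.
have sJ' : is_subgroup J'.
  split; rewrite /J'; first by rewrite res1.
    by move=> r r' hr hr'; rewrite resM; exact: JM.
  by move=> r hr; rewrite resV; exact: JV.
have oJ' : krull_open J'.
  move=> r /Jo[xs hxs]; exists (map (fun x => SubfldOf (inM x)) xs) => r' e.
  by apply: hxs => x xxs; apply/val_inj; rewrite !resP e //; apply/mapP; exists x.
split=> //.
  move=> e; apply: JT; rewrite predeqE => s'; split=> // _.
  by rewrite -(resL s'); have : J' (lift s') by rewrite e.
move=> J2 [[J21 J2M J2V] J2o] sub.
(* The subgroup of [G] corresponding to [J2]; it is open because it contains the open [J]. *)
pose J3 : set G := fun s' => J2 (lift s').
have liftR r : lift (res r) = r by apply: resI; rewrite resL.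
have J3o : open_subgroup J3.
  split; [split|].
  - by rewrite /J3 -res1 liftR.
  - move=> s1 s2 h1 h2; rewrite /J3.
    have -> : lift (s1 * s2)%g = (lift s1 * lift s2)%g by apply: resI; rewrite resM !resL.
    exact: J2M.
  - move=> s1 h1; rewrite /J3.
    have -> : lift (s1^-1)%g = (lift s1)^-1%g by apply: resI; rewrite resV !resL.
    exact: J2V.
  - move=> s1 h1.
    have [xs hxs] : exists xs : seq (subfld_of M), forall s' : G,
        {in xs, forall x, s' x = x} -> J s' by have [xs h] := Jo _ J1; exists xs => s' e; exact: h.
    exists xs => s2 e; rewrite /J3.
    have -> : lift s2 = (lift s1 * (lift (s1^-1 * s2)%g))%g.
      by apply: resI; rewrite resM !resL gal_mulVK.
    apply: J2M => //; apply: sub; rewrite /J' resL; apply: hxs => x xxs.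
    by rewrite galM e // galK.
have [|e|e] := Jmax J3 J3o.
- by move=> s1 h1; apply: sub; rewrite /J' resL.
- left; rewrite predeqE => r; split=> [hr|/sub//].
  by rewrite /J' -e /J3 liftR.
- right; rewrite predeqE => r; split=> // _.
  by rewrite -(liftR r); have : J3 (res r) by rewrite e.
Qed.

End ConstantExtension.

Lemma fractionP (R : idomainType) (u : {fraction R}) :
  exists n d : R, d != 0 /\ u = tofrac n / tofrac d.
Proof.
elim/quotW: u => x; exists (\n_x), (\d_x); split; first exact: denom_ratioP.
have d0 : tofrac (\d_x) != 0 by rewrite tofrac_eq0 denom_ratioP.
apply: (mulIf d0); rewrite divfK //.
rewrite -[LHS]/(FracField.mul _ _) !piE; apply/eqmodP; rewrite /= FracField.equivfE.
rewrite /FracField.mulf !numden_Ratio ?mulf_neq0 ?oner_neq0 ?denom_ratioP //.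
by rewrite !mulr1 mulrC.
Qed.

(** * Hilbert sets *)

Section RationalFunctions.
Variables (L : fieldType) (k : subfld L) (t : L).
Hypothesis tk : forall p : {poly L}, pover k p -> p.[t] = 0 -> p = 0.
Local Notation kt := (subfld_of k).
Local Notation Ft := {fraction {poly kt}}.
Local Notation F := (adjoin k [set t]%classic).
Local Notation ev p := (map_poly (val : kt -> L) p).[t].

Lemma ev_eq0 (p : {poly kt}) : (ev p == 0) = (p == 0).
Proof.
apply/eqP/eqP => [e|->]; last by rewrite rmorph0 horner0.
apply/eqP; rewrite -(map_poly_eq0 (val : kt -> L)); apply/eqP; apply: tk e.
by apply/poverP; exists p.
Qed.

(* The isomorphism of the field of rational functions over k with k(t), as a
   relation. *)
Definition frac_rel (u : Ft) (x : L) := exists n d : {poly kt},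
  [/\ d != 0, u = tofrac n / tofrac d & x = ev n / ev d].

Lemma frac_rel_ex u : exists x, frac_rel u x.
Proof.
by have [n [d [d0 ->]]] := fractionP u; exists (ev n / ev d), n, d.
Qed.

Lemma frac_rel_adjoin u x : frac_rel u x -> x \in F.
Proof.
by move=> [n [d [d0 _ ->]]]; apply: frac_adjoin; apply/poverP; [exists n|exists d].
Qed.

Lemma frac_rel_surj x : x \in F -> exists u, frac_rel u x.
Proof.
move=> /adjoin_frac[n [d [/poverP[n' ->] /poverP[d' ->] d0 ->]]].
exists (tofrac n' / tofrac d'), n', d'; split=> //.
by rewrite -ev_eq0.
Qed.

Lemma frac_rel_pgraph : pgraph (full_subfld _) frac_rel.
Proof.
split.
- split.
  + by exists 1, 1; rewrite oner_neq0 !rmorph1 hornerC !divr1.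
  + move=> _ _ _ _ [n [d [d0 -> ->]]] [n' [d' [d0' -> ->]]].
    exists (n * d' - n' * d), (d * d'); split; first exact: mulf_neq0.
      by rewrite -mulNr addf_div ?tofrac_eq0 // mulNr rmorphB !rmorphM.
    by rewrite -mulNr addf_div ?ev_eq0 // mulNr rmorphB !rmorphM hornerD hornerN !hornerM.
  + move=> _ _ _ _ [n [d [d0 -> ->]]] [n' [d' [d0' -> ->]]].
    exists (n * n'), (d * d').
    by rewrite mulf_neq0 // !mulf_div !rmorphM !hornerM.
- move=> x [n [d [d0 /esym/eqP e ->]]]; move: e.
  rewrite mulf_eq0 invr_eq0 !tofrac_eq0 (negPf d0) orbF => /eqP ->.
  by rewrite rmorph0 horner0 mul0r.
- by [].
- by move=> u _; left; exact: frac_rel_ex.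
Qed.

Let PJ := frac_rel_pgraph.
Let RJ := pg_ring PJ.

Lemma frac_rel_neq0 u x : frac_rel u x -> u != 0 -> x != 0.
Proof.
move=> [n [d [d0 -> ->]]]; rewrite !mulf_eq0 !invr_eq0 !tofrac_eq0 !ev_eq0.
by [].
Qed.

Lemma frac_rel_size (p : {poly Ft}) q : polyrel frac_rel p q -> size p = size q.
Proof.
move=> h; apply/eqP; rewrite eqn_leq; apply/andP; split.
  have [->|p0] := eqVneq p 0; first by rewrite size_poly0.
  rewrite leqNgt; apply/negP => lt.
  have := frac_rel_neq0 (h (size p).-1); rewrite -lead_coefE lead_coef_eq0 p0.
  rewrite nth_default ?eqxx; last by rewrite -ltnS prednK // size_poly_gt0.
  by move=> /(_ isT).
apply/leq_sizeP => j hj; apply: (pg_0 PJ).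
by have := h j; rewrite nth_default.
Qed.

Lemma frac_rel_lift (p : {poly L}) : pover F p -> exists q, polyrel frac_rel q p.
Proof. by move=> pF; apply: (polyrel_liftl RJ) => i; exact: frac_rel_surj. Qed.

Lemma frac_rel_dvdp (p q : {poly Ft}) P : polyrel frac_rel p P -> q %| p ->
  exists2 Q, polyrel frac_rel q Q & Q %| P.
Proof.
move=> hp /dvdpP[c e].
have [Q hQ] := polyrel_liftr RJ (fun i => frac_rel_ex q`_i).
have [C hC] := polyrel_liftr RJ (fun i => frac_rel_ex c`_i).
exists Q => //; apply/dvdpP; exists C; apply: (pg_polyfun PJ hp).
by rewrite e; exact: ringrelM (polyrel_ring RJ) _ _ _ _ hC hQ.
Qed.

Lemma frac_rel_irreducible (p : {poly Ft}) P : polyrel frac_rel p P -> (1 < size P)%N ->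
  (forall d, pover F d -> d %| P -> (1 < size d)%N -> P %| d) -> irreducible_poly p.
Proof.
move=> hp sP irr; split; first by rewrite (frac_rel_size hp).
move=> q sq qp; have [Q hQ QP] := frac_rel_dvdp hp qp.
have p0 : p != 0 by rewrite -size_poly_gt0 (frac_rel_size hp) ltnW.
have q0 : q != 0 by apply: contraTneq qp => ->; rewrite dvd0p.
have QF : pover F Q by move=> i; exact: frac_rel_adjoin (hQ i).
have sQ : (1 < size Q)%N.
  by rewrite -(frac_rel_size hQ); move: sq q0; rewrite -size_poly_gt0; case: (size q) => [|[]].
rewrite -dvdp_size_eqp // eqn_leq dvdp_leq //=.
rewrite (frac_rel_size hp) (frac_rel_size hQ); apply: dvdp_leq; last exact: irr.
by rewrite -size_poly_gt0 ltnW.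
Qed.

Lemma frac_rel_separable (p : {poly Ft}) P : polyrel frac_rel p P ->
  separable_poly P -> separable_poly p.
Proof.
move=> hp; rewrite !unlock => cop; apply/coprimepP => q qp qp'.
have [Q hQ QP] := frac_rel_dvdp hp qp.
have [Q' hQ' QP'] := frac_rel_dvdp (polyrel_deriv RJ hp) qp'.
rewrite -(pg_polyfun PJ hQ hQ') in QP'.
have /coprimepP/(_ Q QP QP') := cop.
by rewrite -!size_poly_eq1 (frac_rel_size hQ).
Qed.

Lemma frac_rel_specialize (a b : kt) (u : Ft) x :
  frac_rel u x -> specializes a u b -> base_place t (val a) k x (val b).
Proof.
move=> hu [n [d [da e ->]]].
have d0 : d != 0 by apply: contra_neq da => ->; rewrite horner0.
exists (map_poly val n), (map_poly val d); split.
- by apply/poverP; exists n.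
- by apply/poverP; exists d.
- by rewrite horner_map fmorph_eq0.
- by apply: (pg_fun PJ hu); exists n, d.
- by rewrite !horner_map fmorph_div.
Qed.

End RationalFunctions.

(** * The Hilbert set of a primitive element *)

Section HilbertSet.
Variables (K : fieldType) (f : ratmap K) (Om : fieldType) (iota : {rmorphism K -> Om}).
Variables (t : Om) (k : subfld Om).
Local Notation reval := (reval iota f).
Local Notation Kb := (Kbar iota).
Local Notation tree := (backward_orbit iota f).
Local Notation M := (adjoin k (tree t)).
Local Notation F := (adjoin k [set t]%classic).
Local Notation G := (gal [pred x : subfld_of M | val x \in F]).
Hypotheses (kinf : forall l : seq Om, exists2 c, c \in k & c \notin l)
  (iotak : forall c, iota c \in k) (kK : forall c, c \in k -> c \in Kb)
  (tK : t \notin Kb)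
  (unrt : forall n q, iter n reval q = Some t -> unramified_over iota f q)
  (sepF : forall y : subfld_of M, exists p : {poly Om},
    [/\ separable_poly p, pover F p & root p (val y)])
  (sepcl : forall p : {poly Om}, separable_poly p -> (1 < size p)%N ->
    exists x, root p x).

Let finorb (x : subfld_of M) : exists O : seq (subfld_of M), forall s : G, s x \in O :=
  generic_finorb iotak x.
Let fixed (x : subfld_of M) : (forall s : G, s x = x) -> val x \in F :=
  @generic_fixed _ _ _ _ _ _ kinf iotak unrt sepF sepcl x.
Let tk (p : {poly Om}) : pover k p -> p.[t] = 0 -> p = 0 := @pover_transc _ _ _ _ _ kK tK p.

(** The tuple is encoded as the polynomial [Poly X] and evaluated at a constant [c] that is no root
    of its differences with the distinct conjugate polynomials. Fixing the value then means fixing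
    the tuple. *)
Lemma generic_primitive (X : seq (subfld_of M)) : exists th : subfld_of M,
  forall s : G, s th = th -> {in X, forall x, s x = x}.
Proof.
have [O [_ hO]] := orbit_list finorb X.
pose P : {poly subfld_of M} := \prod_(Z <- O | Poly Z != Poly X) (Poly Z - Poly X).
have P0 : P != 0.
  rewrite /P; elim/big_ind: _ => [|p q p0 q0|Z h]; first exact: oner_neq0.
    exact: mulf_neq0.
  by rewrite subr_eq0.
have [l hl] := roots_finite P0.
have [c ck cl] := kinf (map val l).
pose cM : subfld_of M := SubfldOf (mem_adjoin_base (tree t) ck).
have Pc : P.[cM] != 0.
  apply: contra cl => Pc; apply/mapP; exists cM => //; exact: hl.
exists (Poly X).[cM] => s sX x xX.
have smap : map_poly s (Poly X) = Poly (map s X).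
  apply/polyP => i; rewrite coef_map !coef_Poly.
  have [hi|hi] := ltnP i (size X); first by rewrite (nth_map 0).
  by rewrite !nth_default ?size_map //; exact: (rmorph0 s).
have sc : s cM = cM by apply: gal_fix; apply: mem_adjoin_base.
have sXO : map s X \in O by apply/hO; exists s.
have e : Poly (map s X) = Poly X.
  apply/eqP; apply: contraNT Pc => ne; rewrite horner_prod.
  have e1 : (map_poly s (Poly X)).[s cM] = s (Poly X).[cM] by rewrite horner_map.
  have e2 : (Poly (map s X)).[cM] = (Poly X).[cM] by rewrite -smap -{1}sc e1.
  by rewrite (big_rem _ sXO) /= ne hornerD hornerN e2 subrr mul0r.
have := congr1 (fun p : {poly subfld_of M} => p`_(index x X)) e.
by rewrite !coef_Poly (nth_map 0) ?index_mem // nth_index.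
Qed.

Lemma orbit_poly_fixed (th : subfld_of M) (O : seq (subfld_of M)) : uniq O ->
    (forall y, y \in O <-> exists s : G, y = s th) ->
  forall s : G, map_poly s (\prod_(y <- O) ('X - y%:P)) = \prod_(y <- O) ('X - y%:P).
Proof.
move=> uO hO s; rewrite rmorph_prod /= -[RHS](perm_big _ (orbit1_map s uO hO)) big_map.
by apply: eq_bigr => y _; rewrite rmorphB /= map_polyX map_polyC.
Qed.

(* p is the minimal polynomial of th over k(t); g vanishes at the zeros and
   poles of its discriminant. *)
Lemma generic_hilbert (th : subfld_of M) : exists (O : seq (subfld_of M))
    (p : {poly {fraction {poly subfld_of k}}}) (g : {poly subfld_of k}),
  [/\ uniq O /\ (forall y, y \in O <-> exists s : G, y = s th),
    irreducible_poly p /\ separable_poly p,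
    polyrel (frac_rel t) p (\prod_(y <- O) ('X - (val y)%:P)), g != 0 &
    exists n d : {poly subfld_of k}, g = n * d /\
      \prod_(y <- O) val ((\prod_(z <- O) ('X - z%:P))^`()).[y] =
        (map_poly val n).[t] / (map_poly val d).[t]].
Proof.
have [O [uO hO]] := orbit1 finorb th.
set p := \prod_(z <- O) ('X - z%:P); have pfix := orbit_poly_fixed uO hO.
have pval : map_poly val p = \prod_(y <- O) ('X - (val y)%:P).
  by rewrite rmorph_prod; apply: eq_bigr => y _; exact: map_polyXsubC.
have pF : pover F (\prod_(y <- O) ('X - (val y)%:P)).
  rewrite -pval => i; rewrite coef_map; apply: fixed => s.
  by rewrite -coef_map pfix.
have pmap : \prod_(y <- O) ('X - (val y)%:P) = \prod_(z <- map val O) ('X - z%:P).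
  by rewrite big_map.
have [q hq] := frac_rel_lift tk pF.
have thO : th \in O by apply/hO; exists 1%g.
have uval : uniq (map val O) by rewrite map_inj_uniq //; exact: val_inj.
have psep : separable_poly (\prod_(y <- O) ('X - (val y)%:P)).
  by rewrite pmap separable_prod_XsubC.
have psize : (1 < size (\prod_(y <- O) ('X - (val y)%:P))%R)%N.
  rewrite pmap size_prod_XsubC size_map.
  by case: (O) thO.
(* A nonconstant factor over [k(t)] vanishes at one conjugate of [th], hence at all, its
   coefficients being fixed by the group. *)
have pirr d : pover F d -> d %| \prod_(y <- O) ('X - (val y)%:P) -> (1 < size d)%N ->
    \prod_(y <- O) ('X - (val y)%:P) %| d.
  move=> dF; rewrite pmap => dp sd.
  have [m em] := dvdp_prod_XsubC dp.
  have [z zO dz] : exists2 z, z \in O & root d (val z).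
    move: sd; rewrite (eqp_size em) size_prod_XsubC ltnS.
    case em' : (mask m (map val O)) => [//|z l] _.
    have : z \in map val O by apply: (mem_mask (m := m)); rewrite em' inE eqxx.
    case/mapP => z' z'O ez; exists z' => //.
    by rewrite (eqp_root em) em' root_prod_XsubC inE ez eqxx.
  have /poverP[d' ed] : pover M d.
    by move=> i; apply: FM; exact: dF.
  have dfix (s : G) : map_poly s d' = d'.
    apply/polyP => i; rewrite coef_map; apply: gal_fix.
    by suff : val d'`_i \in F by []; have := dF i; rewrite {1}ed coef_map.
  apply: uniq_roots_dvdp; last by rewrite uniq_rootsE.
  apply/allP => _ /mapP[y /hO[s ->] ->].
  have [s' ez] := (hO z).1 zO.
  have -> : s th = (s * s'^-1)%g z by rewrite ez galM galK.
  move: dz; rewrite ed !rootE !horner_map !fmorph_eq0 => dz.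
  by rewrite -(dfix (s * s'^-1)%g) horner_map fmorph_eq0.
(* The discriminant up to sign; being fixed, it is a fraction in [t]. *)
pose del := \prod_(y <- O) p^`().[y].
have delfix (s : G) : s del = del.
  rewrite rmorph_prod /= /del -[RHS](perm_big _ (orbit1_map s uO hO)) big_map.
  apply: eq_bigr => y _; rewrite -horner_map /=; congr (_.[_]).
  by rewrite -deriv_map /= pfix.
have [n [d [/poverP[n' en] /poverP[d' ed] d0 edel]]] := adjoin_frac (fixed delfix).
have del0 : del != 0.
  rewrite prodf_seq_neq0; apply/allP => y yO /=.
  apply: (@coprimep_root _ p); last by rewrite root_prod_XsubC.
  by have := separable_prod_XsubC O; rewrite uO unlock => ->.
exists O, q, (n' * d'); split=> //.
- split; last exact: (frac_rel_separable tk hq).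
  exact: (frac_rel_irreducible tk hq).
- have dt : d' != 0 by apply: contra_neq d0 => e; rewrite ed e rmorph0 horner0.
  rewrite mulf_neq0 //; apply: contra_neq del0 => e; apply/val_inj.
  by rewrite edel en e rmorph0 horner0 mul0r.
- by exists n', d'; split=> //; rewrite -en -ed -edel rmorph_prod.
Qed.

Section AtPoint.
Variable a : subfld_of k.
Local Notation Ma := (adjoin k (tree (val a))).
Local Notation Ga := (gal [pred x : subfld_of Ma | val x \in k]).
Hypothesis unra : forall n q, iter n reval q = Some (val a) -> unramified_over iota f q.
Variable phi : subfld_of M -> option (subfld_of Ma).
Hypotheses (phiP : is_place phi)
  (phik : forall (x : subfld_of M) (c : subfld_of Ma), val x \in k -> val x = val c ->
        phi x = Some c)
  (phit : forall (x : subfld_of M) (c : subfld_of Ma), val x = t -> val c = val a ->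
        phi x = Some c).
Local Notation R := (place_graph phi).

Lemma base_place_sub x u : base_place t (val a) k x u -> R x u.
Proof.
have PR := place_graph_pgraph phiP.
have hpoly p : pover k p -> R p.[t] p.[val a].
  move=> pE; apply: (polyrel_horner (pg_ring PR)).
    by move=> i; apply: (place_graph_k phik); exact: pE.
  exact: (place_graph_t (valP a) phit).
move=> [n [d [nE dE da -> ->]]]; apply: (ringrelM (pg_ring PR)); first exact: hpoly.
by apply: (pg_inv PR) => //; exact: hpoly.
Qed.

(** The reduced polynomial [Q] is irreducible over [k] with distinct roots, so some [r] carries the
    residue of [th] to that of [s th]. Then [spec r th] and [s th] are conjugates with the same
    residue, hence equal. *)
Theorem hilbert_surjective (th : subfld_of M) (O : seq (subfld_of M))
    (p : {poly {fraction {poly subfld_of k}}}) (g q : {poly subfld_of k})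
    (n d : {poly subfld_of k}) (spec : Ga -> G) :
  uniq O -> (forall y, y \in O <-> exists s : G, y = s th) ->
  polyrel (frac_rel t) p (\prod_(y <- O) ('X - (val y)%:P)) ->
  g = n * d ->
  \prod_(y <- O) val ((\prod_(z <- O) ('X - z%:P))^`()).[y] =
        (map_poly val n).[t] / (map_poly val d).[t] ->
  g.[a] != 0 -> specializes_poly a p q -> irreducible_poly q ->
  (forall r x, phi (spec r x) = omap r (phi x)) ->
  forall s : G, exists r : Ga, spec r th = s th.
Proof.
move=> uO hO hp eg edel ga spq qirr hspec s.
have PR := place_graph_pgraph phiP; have RR := pg_ring PR.
set P := \prod_(y <- O) ('X - (val y)%:P) in hp.
set PM := \prod_(z <- O) ('X - z%:P) in edel.
have Pval : map_poly val PM = P.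
  by rewrite rmorph_prod; apply: eq_bigr => y _; exact: map_polyXsubC.
have hPq : polyrel R P (map_poly val q).
  move=> i; rewrite coef_map; apply: base_place_sub.
  by apply: (frac_rel_specialize tk) (hp i) (spq i).
have Pm : P \is monic.
  by rewrite /P -(big_map val xpredT (fun z => 'X - z%:P)) monic_prod_XsubC.
have [Qm _] := pg_monic PR Pm hPq; set Q := map_poly val q in hPq Qm.
have fin y : y \in O -> exists w, R (val y) w.
  move=> yO; apply: (pg_integral PR Pm hPq); first exact: valP.
  by rewrite -Pval rootE horner_map /= (rootP (_ : root PM y)) ?root_prod_XsubC ?rmorph0.
have /choice[w hw] : forall y, exists w, y \in O -> R (val y) w.
  by move=> y; case: (boolP (y \in O)) => [/fin[w hw]|_]; [exists w|exists 0].
have eQ : Q = \prod_(y <- O) ('X - (w y)%:P).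
  apply: (pg_polyfun PR hPq); rewrite /P big_seq [X in polyrel _ _ X]big_seq.
  apply: (ringrel_prod (polyrel_ring RR)) => y yO.
  by apply: (polyrelXsubC RR); exact: hw.
(* Two equal residues give a double root of [Q], and the reduced discriminant would vanish, against
   [g.[a] != 0]. *)
have winj : {in O &, injective w}.
  move=> y z yO zO e; apply/eqP; apply: contraT => yz.
  have Qw : Q^`().[w y] = 0.
    have zO' : z \in rem y O by rewrite (rem_filter _ uO) mem_filter /= eq_sym yz.
    rewrite eQ (big_rem _ yO) (big_rem _ zO') /= -e derivM derivXsubC mul1r.
    by rewrite hornerD !hornerM hornerXsubC subrr !mul0r addr0.
  have hdel : R (\prod_(y <- O) (P^`()).[val y]) (\prod_(y <- O) (Q^`()).[w y]).
    rewrite big_seq [X in R _ X]big_seq; apply: (ringrel_prod RR) => z' z'O.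
    apply: (polyrel_horner RR); last exact: hw.
    exact: polyrel_deriv.
  have : \prod_(y <- O) (Q^`()).[w y] = 0 by rewrite (big_rem _ yO) /= Qw mul0r.
  move: hdel; have -> : \prod_(y <- O) (P^`()).[val y] = \prod_(y <- O) val (PM^`()).[y].
    by apply: eq_bigr => y' _; rewrite -Pval deriv_map horner_map.
  rewrite edel; have na : n.[a] != 0 by move: ga; rewrite eg hornerM mulf_eq0 negb_or => /andP[].
  have da : d.[a] != 0 by move: ga; rewrite eg hornerM mulf_eq0 negb_or => /andP[].
  have hb : R ((map_poly val n).[t] / (map_poly val d).[t])
      ((map_poly val n).[val a] / (map_poly val d).[val a]).
    apply: base_place_sub; exists (map_poly val n), (map_poly val d); split=> //.
    + by apply/poverP; exists n.
    + by apply/poverP; exists d.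
    + by rewrite horner_map fmorph_eq0.
  move=> /(pg_fun PR hb) <- /eqP; rewrite !horner_map mulf_eq0 invr_eq0 !fmorph_eq0.
  by rewrite (negPf na) (negPf da).
have thO : th \in O by apply/hO; exists 1%g.
have sthO : s th \in O by apply/hO; exists s.
have Qk : pover k Q by apply/poverP; exists q.
have uw : uniq (map w O) by rewrite map_inj_in_uniq.
have Qsep : separable_poly Q.
  by rewrite eQ -(big_map w xpredT (fun z => 'X - z%:P)) separable_prod_XsubC.
have Qroot y : y \in O -> root Q (w y).
  move=> yO; rewrite eQ -(big_map w xpredT (fun z => 'X - z%:P)) root_prod_XsubC.
  exact: map_f.
have [xth [u [exth eu hu]]] := hw th thO.
have {}exth : xth = th by apply/val_inj.
rewrite {xth}exth in hu.
(* Irreducibility of the specialization makes [Q] the minimal polynomial over [k] of the residue of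
   [th]. *)
have Qmin (T : {poly Om}) : pover k T -> root T (val u) -> Q %| T.
  move=> /poverP[T' ->] rT; rewrite dvdp_map; have [_ qmin] := qirr.
  have rg : root (map_poly val (gcdp q T')) (val u).
    by rewrite gcdp_map root_gcd rT andbT -eu; exact: Qroot.
  have sg : size (gcdp q T') != 1%N.
    apply: contraL rg => /size_poly1P[c c0 ->].
    by rewrite map_polyC rootE hornerC fmorph_eq0.
  by rewrite -(eqp_dvdl _ (qmin _ sg (dvdp_gcdl _ _))) dvdp_gcdr.
have Qu : root Q (val u) by rewrite -eu; exact: Qroot.
have Qdw : ~~ root Q^`() (w (s th)).
  by apply: (@coprimep_root _ Q) (Qroot _ sthO); move: Qsep; rewrite unlock.
have kMa c : c \in k -> c \in Ma by exact: mem_adjoin_base.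
have [r hr] := conj_lift kinf iotak (fun c ck => ck) kMa (valP a) unra Qm Qk Qu Qmin
  (Qroot _ sthO) Qdw.
exists r.
have srO : spec r th \in O by apply/hO; exists (spec r).
apply: (winj _ _ srO sthO); apply: (pg_fun PR (hw _ srO)).
exists (spec r th), (r u); split=> //.
by rewrite hspec hu.
Qed.

End AtPoint.
End HilbertSet.

(** With an empty list of polynomials, the hilbertian property says that every nonzero [g] has a
    point where it does not vanish. *)
Lemma hilbertian_infinite (L : fieldType) (k : subfld L) : hilbertian (subfld_of k) ->
  forall l : seq L, exists2 c, c \in k & c \notin l.
Proof.
move=> hk l; pose l' : seq (subfld_of k) := pmap insub l.
have [//||a [ga _]] := hk [::] (\prod_(c <- l') ('X - c%:P)).
  by rewrite monic_neq0 // monic_prod_XsubC.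
exists (val a); first exact: valP.
apply: contra ga => al; rewrite -rootE root_prod_XsubC mem_pmap_sub.
exact: al.
Qed.

(** * Surjectivity of specialization on the Hilbert set *)

Theorem corollary40 (K : fieldType) (f : ratmap K)
    (Om : fieldType) (iota : {rmorphism K -> Om}) (t : Om) :
  ~ algebraicOver iota t ->
  is_separable_closure (base_rat iota t) ->
  tamely_ramified f iota t ->
  krull_open (@frattini _ _ : set (IMGbar f iota t)) ->
  hilbertian (subfld_of (Khat f iota t)) ->
  exists H : set (subfld_of (Khat f iota t)),
    [/\ is_hilbert_subset H, nonempty H &
        forall a, H a -> ~ post_critical iota f (val a) ->
          specialization_surjective a].
Proof.
move=> talg [sepb sepcl] [x xt tame] fro hilb.
pose k := Khat f iota t; pose Kb := Kbar iota.
have tK : t \notin Kb by apply/negP => /mem_Kbar.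
have kinf := hilbertian_infinite hilb.
have kP c : c \in k <-> c \in Kinfty f iota t /\ algebraicOver iota c.
  by split=> [/alg_predP//|h]; apply/alg_predP.
have baseinf c : c \in base_rat iota t -> c \in Kinfty f iota t.
  exact: mem_adjoin_base.
have iotab c : iota c \in base_rat iota t by apply: mem_generated; left; exists c.
have iotak c : iota c \in k.
  by apply/kP; split; [exact: baseinf|exact: algebraic_id].
have kK c : c \in k -> c \in Kb by move=> /kP[_ h]; apply/mem_Kbar.
have baseF (E : subfld Om) : (forall c, iota c \in E) ->
    forall y, y \in base_rat iota t -> y \in adjoin E [set t]%classic.
  move=> iE; apply: generated_min => y [[c _ <-]|->]; last exact: mem_adjoin.
  exact: mem_adjoin_base.
(* If [x] were algebraic, its image [t] would be too. *)
have xK : x \notin Kb.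
  apply: contra tK => xK; have := @algpt_reval _ _ iota f (Some x).
  by rewrite xt; apply=> // _ [<-].
have wr0 : wronskian (rnum f) (rden f) != 0.
  have [p [psep px]] := sepb x.
  exact: (wronskian_neq0 (baseF _ (iota_Kbar iota)) xK xt psep px).
have unrt := unramified_tree_transc sepcl wr0 tK.
have treeinf c : backward_orbit iota f t c -> c \in Kinfty f iota t by exact: mem_adjoin.
have kalg c : c \in adjoin k (backward_orbit iota f t) -> c \in Kb -> c \in k.
  move=> cM /mem_Kbar ca; apply/kP; split=> //; move: c cM {ca}.
  by apply: adjoin_min => [c /kP[]|].
have sepE (E : subfld Om) (y : Om) : (forall c, c \in base_rat iota t -> c \in E) ->
    exists p : {poly Om}, [/\ separable_poly p, pover E p & root p y].
  move=> bE; have [p [psep py]] := sepb y; exists (map_poly val p).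
  split=> //; first by rewrite separable_map.
  by move=> i; rewrite coef_map; apply: bE; exact: valP.
have tM : t \in adjoin k (backward_orbit iota f t).
  by apply: mem_adjoin; exists 0%N.
have sepM y : exists p : {poly Om},
    [/\ separable_poly p, pover (adjoin k (backward_orbit iota f t)) p & root p y].
  apply: sepE; apply: generated_min => z [[c _ <-]|-> //].
  exact: mem_adjoin_base.
have sepF (y : subfld_of (adjoin k (backward_orbit iota f t))) : exists p : {poly Om},
    [/\ separable_poly p, pover (adjoin k [set t]%classic) p & root p (val y)].
  by apply: sepE; exact: baseF.
have [X hX] := frattini_transfer kinf iotak kK kalg sepM sepcl fro.
have [th hth] := generic_primitive kinf iotak X.
have [O [p [g [[uO hO] [pirr psep] hp g0 [n [d [eg edel]]]]]]] :=
  generic_hilbert kinf iotak kK tK unrt sepF sepcl th.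
exists (hilbert_set [:: p] g); split.
- by exists [:: p], g; split=> // q; rewrite inE => /eqP ->.
- by apply: hilb => // q; rewrite inE => /eqP ->.
move=> a [ga /(_ p (mem_head _ _))[q spq qirr]] npc.
have aK : val a \in Kb by apply: kK; exact: valP.
have unra := unramified_tame xK xt tame sepcl aK npc.
split.
  have [phi [phiP phik phit]] := place_exists kinf iotak kK tK (valP a) unrt unra.
  by exists phi.
move=> phi [phiP phik phit].
have [spec [specM specI specr hspec]] :=
  place_specialization kinf iotak (valP a) unrt unra phiP phik phit sepF sepcl.
exists spec; first by split.
apply: (@frattini_criterion _ _ _ _ X).
- exact: generic_finorb.
- exact: abs_decomposition_subgroup.
- exact: abs_decomposition_closed.
- exact: hX.
move=> s; have [r hr] := hilbert_surjective kinf iotak kK tK unra phiP phik phit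
  uO hO hp eg edel ga spq qirr hspec s.
exists (spec r).
  suff : abs_decomposition phi (spec r) by [].
  by rewrite -specr; exists r.
(* The quotient of [spec r] and [s] fixes [th], hence every element of [X]. *)
have fixth : (s^-1 * spec r)%g th = th by rewrite galM hr galK.
move=> y /(hth _ fixth) e; rewrite -[in RHS]e galM galVK.
by [].
Qed.
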